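(* Let $K$ be an algebraically closed field, let $A$ be a connected cyclic quasi-hereditary Nakayama algebra over $K$ with $n$ simple modules, and let $r=\lambda_1(A)$. Then the global dimension of $A$ is $r+1$ if and only if the defining relations of $A$ form a chain.
   Context: Algebras are finite dimensional over $K$ and assumed to be of the form $A=KQ/I$ with $I$ admissible. A Nakayama algebra is an algebra such that every indecomposable module has a unique composition series; a connected one is called cyclic if its quiver is not acyclic. Then $Q$ is the oriented cycle with vertices $1,\dots,n$ and arrows $\alpha_i:i\to i+1$ ($1\le i\le n-1$), $\alpha_n:n\to 1$. $\lambda_1(A)$ is the number of isomorphism classes of simple $A$-modules with projective dimension not equal to $1$; it equals the number of relations in an irredundant system of path relations defining $A$ (the minimal set of paths generating $I$). The defining relations form a chain if, after a cyclic relabelling of the vertices, the irredundant system of relations consists of $r$ paths $\rho_1,\dots,\rho_r$, where $\rho_i$ is the path running successively through the arrows $\alpha_{k_{2i-1}},\alpha_{k_{2i-1}+1},\dots,\alpha_{k_{2i}}$, for integers $k_1,\dots,k_{2r}\in\{1,\dots,n\}$ with $k_{2i-1}<k_{2i}$ for $1\le i\le r$, satisfying: $k_1=1$; $k_1<k_3<\cdots<k_{2r-1}$; $k_2<k_4<\cdots<k_{2r}\le n$; $k_{2i+1}\le k_{2i}$ for all $1\le i\le r-1$; and $k_{2i}<k_{2i+3}$ for all $1\le i\le r-2$. $A$ is called quasi-hereditary if there are a poset $X$ and a bijection $x\mapsto S_x$ from $X$ to the set of isomorphism classes of simple $A$-modules (let $P_x$ be the projective cover of $S_x$) such that for each $x\in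 X$ there exists a quotient module $\Delta(x)$ of $P_x$ with: (1) the kernel of $\Delta(x)\to S_x$ is filtered by simple modules $S_y$ with $y<x$; (2) the kernel of $P_x\to\Delta(x)$ is filtered by modules $\Delta(t)$ with $t>x$. *)

(* Defs.v *)
From HB Require Import structures.
From mathcomp Require Import all_boot all_order all_algebra.
From mathcomp Require Import falgebra.
From mathcomp Require Import finmap.
From mathcomp.multinomials Require Import monalg.
From mathcomp Require Import boolp classical_sets.

Set Implicit Arguments.
Unset Strict Implicit.
Unset Printing Implicit Defensive.

Import GRing.Theory.

Local Open Scope classical_set_scope.
Local Open Scope ring_scope.

(* The vertex set is nonempty because the algebra structures of the library
   require 1 != 0. *)
Record quiver := Quiver {
  vert : finType;
  arrow : finType;
  src : arrow -> vert;
  tgt : arrow -> vert;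
  vert_gt0 : (0 < #|vert|)%N }.

Section Paths.
Variable Q : quiver.

Fixpoint walk (x : vert Q) (s : seq (arrow Q)) : bool :=
  if s is a :: s' then (src a == x) && walk (tgt a) s' else true.

(* A path is its source together with the sequence of arrows it runs through,
   in this order; the trivial path at x is (x, [::]). *)
Definition qpath := {p : vert Q * seq (arrow Q) | walk p.1 p.2}.

Definition psrc (p : qpath) : vert Q := (val p).1.
Definition parrows (p : qpath) : seq (arrow Q) := (val p).2.
Definition walk_end (x : vert Q) (s : seq (arrow Q)) : vert Q :=
  last x [seq tgt a | a <- s].
Definition ptgt (p : qpath) : vert Q := walk_end (psrc p) (parrows p).
Definition plength (p : qpath) : nat := size (parrows p).

Definition ptriv (x : vert Q) : qpath :=
  @exist _ (fun p : vert Q * seq (arrow Q) => walk p.1 p.2) (x, [::]) isT.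

Lemma walk_cat x s t : walk x (s ++ t) = walk x s && walk (walk_end x s) t.
Proof. by elim: s x => //= a s IHs x; rewrite IHs andbA. Qed.

Lemma walk_end_cat x s t : walk_end x (s ++ t) = walk_end (walk_end x s) t.
Proof. by rewrite /walk_end map_cat last_cat. Qed.

(* [pcomp p q] runs through q first and then through p, so that left modules
   over the path algebra are the representations of Q. *)
Definition pcomp (p q : qpath) : option qpath :=
  if ptgt q == psrc p then (insub (psrc q, parrows q ++ parrows p) : option qpath) else None.

Lemma pcomp_Some p q : ptgt q = psrc p ->
  exists2 r, pcomp p q = Some r & val r = (psrc q, parrows q ++ parrows p).
Proof.
move=> e; rewrite /pcomp e eqxx.
case: insubP => [r _ rE|]; first by exists r.
by rewrite /= walk_cat -/(ptgt q) e (valP q) (valP p).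
Qed.

Lemma pcomp_None p q : ptgt q != psrc p -> pcomp p q = None.
Proof. by rewrite /pcomp => /negbTE ->. Qed.

Lemma ptgt_val (r : qpath) x s : val r = (x, s) -> ptgt r = walk_end x s.
Proof. by rewrite /ptgt /psrc /parrows => ->. Qed.

Lemma pcompA p q r :
  obind (fun t => pcomp t r) (pcomp p q) = obind (pcomp p) (pcomp q r).
Proof.
have [pq|npq] := eqVneq (ptgt q) (psrc p); last first.
  rewrite (pcomp_None npq) /=.
  have [qr|nqr] := eqVneq (ptgt r) (psrc q); last by rewrite (pcomp_None nqr).
  have [t -> tE] := pcomp_Some qr; rewrite /= pcomp_None //.
  rewrite (ptgt_val tE) walk_end_cat -/(ptgt r) qr; exact: npq.
have [t te tE] := pcomp_Some pq; rewrite te /=.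
have [qr|nqr] := eqVneq (ptgt r) (psrc q); last first.
  by rewrite (pcomp_None nqr) pcomp_None // {1}/psrc tE.
have [u ue uE] := pcomp_Some qr; rewrite ue /=.
have tr : ptgt r = psrc t by rewrite {1}/psrc tE.
have pu : ptgt u = psrc p.
  by rewrite (ptgt_val uE) walk_end_cat -/(ptgt r) qr.
have [v ve vE] := pcomp_Some tr; have [w we wE] := pcomp_Some pu.
rewrite ve we; congr Some; apply: val_inj; rewrite vE wE.
by rewrite /psrc /parrows uE tE /= catA.
Qed.

Lemma pcomp_trivl x q :
  pcomp (ptriv x) q = if x == ptgt q then Some q else None.
Proof.
have [e|ne] := eqVneq x (ptgt q); last by rewrite pcomp_None // eq_sym.
have [r -> rE] := @pcomp_Some (ptriv x) q (esym e); congr Some.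
by apply: val_inj; rewrite rE cats0 /psrc /parrows -surjective_pairing.
Qed.

Lemma pcomp_trivr p x :
  pcomp p (ptriv x) = if x == psrc p then Some p else None.
Proof.
have [e|ne] := eqVneq x (psrc p); last by rewrite pcomp_None.
have [r -> rE] := @pcomp_Some p (ptriv x) e; congr Some.
by apply: val_inj; rewrite rE /psrc /= -/(psrc p) e /psrc /parrows -surjective_pairing.
Qed.

End Paths.

Definition path_algebra (K : fieldType) (Q : quiver) := {malg K[qpath Q]}.

HB.instance Definition _ (K : fieldType) (Q : quiver) :=
  GRing.Zmodule.on (path_algebra K Q).

(* The operations are locked, since unification would otherwise unfold them
   down to finite maps. *)
HB.lock Definition pa_scale (K : fieldType) (Q : quiver) (c : K)
  (f : path_algebra K Q) : path_algebra K Q := fgscale c f.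
Canonical pa_scale_unlockable := Unlockable pa_scale.unlock.

Section PathAlgebraLmodule.
Variables (K : fieldType) (Q : quiver).
Local Notation KQ := (path_algebra K Q).
Implicit Types (f g : KQ) (c : K).

Lemma pa_scaleA c1 c2 f : pa_scale c1 (pa_scale c2 f) = pa_scale (c1 * c2) f.
Proof. by rewrite unlock fgscaleA. Qed.

Lemma pa_scale1 : left_id 1 (@pa_scale K Q).
Proof. by move=> f; rewrite unlock fgscale1r. Qed.

Lemma pa_scaleDr : right_distributive (@pa_scale K Q) +%R.
Proof. by move=> c f g; rewrite unlock fgscaleDr. Qed.

Lemma pa_scaleDl f : {morph (@pa_scale K Q)^~ f : c1 c2 / c1 + c2}.
Proof. by move=> c1 c2; rewrite unlock fgscaleDl. Qed.

HB.instance Definition _ := GRing.Zmodule_isLmodule.Build K KQ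
  pa_scaleA pa_scale1 pa_scaleDr pa_scaleDl.

Lemma pa_coeffZ c f p : (c *: f : KQ)@_p = c * f@_p.
Proof. by rewrite /GRing.scale /= unlock; apply: fgscaleE. Qed.

Lemma pa_suppZ_le c f : (msupp (c *: f : KQ) `<=` msupp f)%fset.
Proof.
apply/fsubsetP=> p; rewrite -!mcoeff_neq0 pa_coeffZ.
by apply/contraTneq=> ->; rewrite mulr0 negbK.
Qed.

End PathAlgebraLmodule.

HB.lock Definition path_elt (K : fieldType) (Q : quiver) (p : qpath Q) :
  path_algebra K Q := << p >>.
Canonical path_elt_unlockable := Unlockable path_elt.unlock.
Arguments path_elt {K Q} p.

Definition path_mul (K : fieldType) (Q : quiver) (p q : qpath Q) :
  path_algebra K Q := oapp path_elt 0 (pcomp p q).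
Arguments path_mul {K Q} p q.

HB.lock Definition pa_mul (K : fieldType) (Q : quiver)
    (f g : path_algebra K Q) : path_algebra K Q :=
  \sum_(p <- msupp f) \sum_(q <- msupp g) (f@_p * g@_q) *: path_mul p q.
Canonical pa_mul_unlockable := Unlockable pa_mul.unlock.
Arguments pa_mul {K Q} f g.

Section PathAlgebra.
Variables (K : fieldType) (Q : quiver).
Local Notation KQ := (path_algebra K Q).
Implicit Types (f g h : KQ) (p q r : qpath Q).

Definition pa_one : KQ := \sum_(x : vert Q) path_elt (ptriv x).

Local Open Scope fset_scope.

Lemma pa_mulE f g : pa_mul f g =
  \sum_(p <- msupp f) \sum_(q <- msupp g) (f@_p * g@_q) *: path_mul p q.
Proof. by rewrite unlock. Qed.

Lemma pa_mulEw (d1 d2 : {fset qpath Q}) f g :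
  msupp f `<=` d1 -> msupp g `<=` d2 ->
  pa_mul f g = \sum_(p <- d1) \sum_(q <- d2) (f@_p * g@_q) *: path_mul p q.
Proof.
move=> le1 le2; rewrite pa_mulE (big_fset_incl _ le1) /=.
  apply/eq_bigr=> p _; apply/big_fset_incl => // q _ /mcoeff_outdom ->.
  by rewrite mulr0 scale0r.
move=> p _ /mcoeff_outdom fp.
by rewrite big1 => // q _; rewrite fp mul0r scale0r.
Qed.

Lemma pa_mulDl : left_distributive (@pa_mul K Q) +%R.
Proof.
move=> f g h.
rewrite (pa_mulEw (msuppD_le f g) (fsubset_refl (msupp h))).
rewrite (pa_mulEw (fsubsetUl (msupp f) (msupp g)) (fsubset_refl (msupp h))).
rewrite (pa_mulEw (fsubsetUr (msupp f) (msupp g)) (fsubset_refl (msupp h))).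
rewrite -big_split /=; apply/eq_bigr=> p _.
rewrite -big_split /=; apply/eq_bigr=> q _.
by rewrite mcoeffD mulrDl scalerDl.
Qed.

Lemma pa_mulDr : right_distributive (@pa_mul K Q) +%R.
Proof.
move=> h f g.
rewrite (pa_mulEw (fsubset_refl (msupp h)) (msuppD_le f g)).
rewrite (pa_mulEw (fsubset_refl (msupp h)) (fsubsetUl (msupp f) (msupp g))).
rewrite (pa_mulEw (fsubset_refl (msupp h)) (fsubsetUr (msupp f) (msupp g))).
rewrite -big_split /=; apply/eq_bigr=> p _.
rewrite -big_split /=; apply/eq_bigr=> q _.
by rewrite mcoeffD mulrDr scalerDl.
Qed.

Lemma pa_mulZl c f g : pa_mul (c *: f) g = c *: pa_mul f g.
Proof.
rewrite (pa_mulEw (pa_suppZ_le c f) (fsubset_refl (msupp g))).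
rewrite (pa_mulE f g) scaler_sumr; apply/eq_bigr=> p _.
by rewrite scaler_sumr; apply/eq_bigr=> q _; rewrite pa_coeffZ scalerA mulrA.
Qed.

Lemma pa_mulZr c f g : pa_mul f (c *: g) = c *: pa_mul f g.
Proof.
rewrite (pa_mulEw (fsubset_refl (msupp f)) (pa_suppZ_le c g)).
rewrite (pa_mulE f g) scaler_sumr; apply/eq_bigr=> p _.
by rewrite scaler_sumr; apply/eq_bigr=> q _; rewrite pa_coeffZ scalerA mulrCA.
Qed.

Lemma pa_mul0l f : pa_mul 0 f = 0.
Proof. by rewrite -[in LHS](scale0r 0) pa_mulZl scale0r. Qed.

Lemma pa_mul0r f : pa_mul f 0 = 0.
Proof. by rewrite -[in LHS](scale0r 0) pa_mulZr scale0r. Qed.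

Lemma pa_mul_suml I (s : seq I) (F : I -> KQ) g :
  pa_mul (\sum_(i <- s) F i) g = \sum_(i <- s) pa_mul (F i) g.
Proof. exact: (big_morph (pa_mul^~ g) (fun u v => pa_mulDl u v g) (pa_mul0l g)). Qed.

Lemma pa_mul_sumr I (s : seq I) (F : I -> KQ) f :
  pa_mul f (\sum_(i <- s) F i) = \sum_(i <- s) pa_mul f (F i).
Proof. exact: (big_morph (pa_mul f) (pa_mulDr f) (pa_mul0r f)). Qed.

Lemma pa_expand f : f = \sum_(p <- msupp f) f@_p *: path_elt p.
Proof.
rewrite [LHS]monalgE; apply/eq_bigr=> p _; apply/malgP=> q.
rewrite mcoeffU pa_coeffZ unlock mcoeffU.
by rewrite mulrnAr mulr1.
Qed.

Lemma pa_mul_path p q : @pa_mul K Q (path_elt p) (path_elt q) = path_mul p q.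
Proof.
have supp r : msupp (path_elt r : KQ) `<=` [fset r].
  by rewrite unlock; apply: msuppU_le.
have coef r : (path_elt r : KQ)@_r = 1 by rewrite unlock mcoeffUU.
by rewrite (pa_mulEw (supp p) (supp q)) !big_seq_fset1 !coef mulr1 scale1r.
Qed.

Lemma pa_mulA_path p q r :
  @pa_mul K Q (path_elt p) (pa_mul (path_elt q) (path_elt r)) =
  pa_mul (pa_mul (path_elt p) (path_elt q)) (path_elt r).
Proof.
rewrite !pa_mul_path /path_mul.
have := pcompA p q r.
case: (pcomp p q) => [t|]; case: (pcomp q r) => [u|] /= e.
- by rewrite (pa_mul_path p u) (pa_mul_path t r) /path_mul e.
- by rewrite pa_mul0r (pa_mul_path t r) /path_mul e.
- by rewrite pa_mul0l (pa_mul_path p u) /path_mul -e.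
- by rewrite pa_mul0l pa_mul0r.
Qed.

Lemma pa_ind (D : KQ -> Prop) :
  D 0 -> (forall f g, D f -> D g -> D (f + g)%R) ->
  (forall c f, D f -> D (c *: f)) -> (forall p, D (path_elt p)) ->
  forall f, D f.
Proof.
move=> D0 DD DZ Dp f; rewrite (pa_expand f).
by apply: big_ind => // p _; apply/DZ/Dp.
Qed.

Lemma pa_mulA : associative (@pa_mul K Q).
Proof.
move=> f g h.
elim/pa_ind: f => [|u v Eu Ev|c u Eu|p]; first by rewrite !pa_mul0l.
- by rewrite !pa_mulDl Eu Ev.
- by rewrite (pa_mulZl c u) (pa_mulZl c u) pa_mulZl Eu.
elim/pa_ind: g => [|u v Eu Ev|c u Eu|q]; first by rewrite pa_mul0l pa_mul0r pa_mul0l.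
- by rewrite pa_mulDl !pa_mulDr pa_mulDl Eu Ev.
- by rewrite (pa_mulZl c u) (pa_mulZr c) (pa_mulZr c) pa_mulZl Eu.
elim/pa_ind: h => [|u v Eu Ev|c u Eu|r]; first by rewrite !pa_mul0r.
- by rewrite !pa_mulDr Eu Ev.
- by rewrite (pa_mulZr c) (pa_mulZr c) (pa_mulZr c) Eu.
exact: pa_mulA_path.
Qed.

Lemma pa_mul1l : left_id pa_one (@pa_mul K Q).
Proof.
move=> f; rewrite [f in RHS]pa_expand [f in LHS]pa_expand pa_mul_sumr.
apply/eq_bigr=> p _; rewrite pa_mulZr; congr (_ *: _).
rewrite /pa_one pa_mul_suml (bigD1 (ptgt p)) //= big1 => [|x nx].
  by rewrite addr0 pa_mul_path /path_mul pcomp_trivl eqxx.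
by rewrite pa_mul_path /path_mul pcomp_trivl (negbTE nx).
Qed.

Lemma pa_mul1r : right_id pa_one (@pa_mul K Q).
Proof.
move=> f; rewrite [f in RHS]pa_expand [f in LHS]pa_expand pa_mul_suml.
apply/eq_bigr=> p _; rewrite pa_mulZl; congr (_ *: _).
rewrite /pa_one pa_mul_sumr (bigD1 (psrc p)) //= big1 => [|x nx].
  by rewrite addr0 pa_mul_path /path_mul pcomp_trivr eqxx.
by rewrite pa_mul_path /path_mul pcomp_trivr (negbTE nx).
Qed.

Lemma pa_one_neq0 : pa_one != 0.
Proof.
have /card_gt0P [x _] := vert_gt0 Q.
apply/eqP => /(congr1 (mcoeff (ptriv x))); rewrite mcoeff0 /pa_one raddf_sum /=.
rewrite (bigD1 x) //= big1 => [|y nyx]; last first.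
  rewrite unlock mcoeffU; case: eqVneq => // /(congr1 (@psrc Q)) e.
  by rewrite (e : y = x) eqxx in nyx.
by rewrite unlock mcoeffUU addr0 => /eqP; rewrite oner_eq0.
Qed.

HB.instance Definition _ := GRing.Zmodule_isNzRing.Build KQ
  pa_mulA pa_mul1l pa_mul1r pa_mulDl pa_mulDr pa_one_neq0.
HB.instance Definition _ := GRing.Lmodule_isLalgebra.Build K KQ
  (fun c f g => esym (pa_mulZl c f g)).
HB.instance Definition _ := GRing.Lalgebra_isAlgebra.Build K KQ
  (fun c f g => esym (pa_mulZr c f g)).

End PathAlgebra.

Definition two_sided_ideal (R : pzRingType) (I : set R) : Prop :=
  [/\ I 0, (forall u v, I u -> I v -> I (u + v)),
      (forall u v, I v -> I (u * v)) & (forall u v, I u -> I (u * v))].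

Definition ideal_generated (R : pzRingType) (S : set R) : set R :=
  smallest (@two_sided_ideal R) S.

Definition ker (U V : zmodType) (f : U -> V) : set U := [set u | f u = 0].

Section Relations.
Variables (K : fieldType) (Q : quiver).
Local Notation KQ := (path_algebra K Q).

(* The m-th power of the ideal generated by the arrows: the products of m
   arrows are the paths of length m, or 0. *)
Definition arrow_ideal_pow (m : nat) : set KQ :=
  ideal_generated [set path_elt p | p in [set p : qpath Q | plength p = m]].

Definition admissible (I : set KQ) : Prop :=
  two_sided_ideal I /\
  exists m : nat, [/\ (2 <= m)%N, arrow_ideal_pow m `<=` I
                    & I `<=` arrow_ideal_pow 2].

Definition path_ideal (T : set (qpath Q)) : set KQ :=
  ideal_generated [set path_elt p | p in T].

Definition irredundant_path_relations (I : set KQ) (T : set (qpath Q)) : Prop :=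
  path_ideal T = I /\
  forall T' : set (qpath Q), T' `<=` T -> path_ideal T' = I -> T' = T.

End Relations.

Definition cyclic_quiver (Q : quiver) : Prop :=
  exists p : qpath Q, (0 < plength p)%N /\ ptgt p = psrc p.

(* [v] and [alpha] are only meaningful on the labels 1, ..., n. *)
Definition oriented_cycle_labelling (Q : quiver) (n : nat)
    (v : nat -> vert Q) (alpha : nat -> arrow Q) : Prop :=
  [/\ (forall x, exists! i, (1 <= i <= n)%N /\ v i = x),
      (forall a, exists! i, (1 <= i <= n)%N /\ alpha i = a) &
      forall i, (1 <= i <= n)%N ->
        src (alpha i) = v i /\ tgt (alpha i) = v (if i == n then 1 else i.+1)%N].

Definition relations_form_chain (K : fieldType) (Q : quiver) (n r : nat)
    (I : set (path_algebra K Q)) : Prop :=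
  exists (v : nat -> vert Q) (alpha : nat -> arrow Q) (k : nat -> nat),
  [/\ oriented_cycle_labelling n v alpha,
      irredundant_path_relations I
        [set p | exists2 i, (1 <= i <= r)%N &
           psrc p = v (k (2 * i - 1)%N) /\
           parrows p = [seq alpha j | j <- index_iota (k (2 * i - 1)%N) (k (2 * i)%N).+1]],
      (forall j, (1 <= j <= 2 * r)%N -> (1 <= k j <= n)%N) /\
      (forall i, (1 <= i <= r)%N -> (k (2 * i - 1) < k (2 * i))%N),
      k 1%N = 1%N &
      [/\ (forall i, (1 <= i < r)%N -> (k (2 * i - 1) < k (2 * i + 1))%N),
          (forall i, (1 <= i < r)%N -> (k (2 * i) < k (2 * i + 2))%N),
          (forall i, (1 <= i < r)%N -> (k (2 * i + 1) <= k (2 * i))%N) &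
          (forall i, (1 <= i)%N -> (i + 2 <= r)%N ->
             (k (2 * i) < k (2 * i + 3))%N)]].

Definition surjective (U V : Type) (f : U -> V) : Prop := forall y, exists x, f x = y.

Section Modules.
Variables (K : fieldType) (A : falgType K).
Implicit Types (M N P S : lmodType A).

Definition finite_dim M : Prop :=
  exists (m : nat) (b : 'I_m -> M),
    forall x, exists c : 'I_m -> K, x = \sum_i ((c i)%:A : A) *: b i.

Definition isomorphic M N : Prop := exists f : {linear M -> N}, bijective f.

Definition submodule M (U : set M) : Prop :=
  U 0 /\ forall (a : A) x y, U x -> U y -> U (a *: x + y).

Definition simple M : Prop :=
  (exists x : M, x != 0) /\
  forall U : set M, submodule U -> U = [set 0] \/ U = setT.

Definition indecomposable M : Prop :=
  (exists x : M, x != 0) /\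
  forall U V : set M, submodule U -> submodule V ->
    U `&` V = [set 0] -> (forall x, exists u v, [/\ U u, V v & x = u + v]) ->
    U = [set 0] \/ V = [set 0].

(* V/U is isomorphic to N, through a linear surjection V -> N of kernel U. *)
Definition subquotient_iso M (U V : set M) N : Prop :=
  U `<=` V /\
  exists g : M -> N,
    [/\ (forall (a : A) x y, V x -> V y -> g (a *: x + y) = a *: g x + g y),
        (forall z, exists2 x, V x & g x = z) &
        (forall x, V x -> (g x = 0 <-> U x))].

(* s = [:: U_0; ...; U_l] is a filtration 0 = U_0 <= ... <= U_l = W whose
   factors U_(i+1)/U_i are all isomorphic to modules in the class F. *)
Definition filtration (F : lmodType A -> Prop) M (W : set M) (s : seq (set M)) : Prop :=
  [/\ head set0 s = [set 0], last set0 s = W,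
      (forall i, (i < size s)%N -> submodule (nth set0 s i)) &
      (forall i, (i.+1 < size s)%N ->
         exists2 N, F N & subquotient_iso (nth set0 s i) (nth set0 s i.+1) N)].

Definition filtered_by (F : lmodType A -> Prop) M (W : set M) : Prop :=
  exists s, filtration F W s.

Definition composition_series M (s : seq (set M)) : Prop :=
  filtration simple setT s.

Definition projective P : Prop :=
  forall M N (f : {linear M -> N}) (g : {linear P -> N}), surjective f ->
    exists h : {linear P -> M}, forall x, f (h x) = g x.

Definition projective_cover P M (p : {linear P -> M}) : Prop :=
  [/\ projective P, surjective p &
      forall U : set P, submodule U ->
        (forall x, exists u z, [/\ U u, ker p z & x = u + z]) -> U = setT].

Definition projective_resolution (d : nat) M (P : nat -> lmodType A)
    (f : forall i, {linear P i.+1 -> P i}) (e : {linear P 0%N -> M}) : Prop :=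
  [/\ (forall i, projective (P i)), surjective e,
      range (f 0%N) = ker e, (forall i, range (f i.+1) = ker (f i)) &
      (forall i, (d < i)%N -> forall x : P i, x = 0)].

Definition proj_dim_le M (d : nat) : Prop :=
  exists (P : nat -> lmodType A) (f : forall i, {linear P i.+1 -> P i})
         (e : {linear P 0%N -> M}), projective_resolution d f e.

Definition proj_dim_is M (d : nat) : Prop :=
  proj_dim_le M d /\ forall d', proj_dim_le M d' -> (d <= d')%N.

Definition num_iso_classes (F : lmodType A -> Prop) (m : nat) : Prop :=
  exists S : 'I_m -> lmodType A,
    [/\ (forall i, F (S i)),
        (forall i j, isomorphic (S i) (S j) -> i = j) &
        (forall N, F N -> exists i, isomorphic N (S i))].

End Modules.

Section Algebras.
Variables (K : fieldType) (A : falgType K).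

(* A direct product decomposition of A into two algebras is the same as a
   decomposition of A into a direct sum of two two-sided ideals. *)
Definition connected_algebra : Prop :=
  forall I J : set A, two_sided_ideal I -> two_sided_ideal J ->
    I `&` J = [set 0] -> (forall u, exists v w, [/\ I v, J w & u = v + w]) ->
    I = [set 0] \/ J = [set 0].

Definition nakayama : Prop :=
  forall M : lmodType A, finite_dim M -> indecomposable M ->
    exists! s : seq (set M), composition_series s.

(* The supremum is taken over finite dimensional modules. *)
Definition global_dim_le (d : nat) : Prop :=
  forall M : lmodType A, finite_dim M -> proj_dim_le M d.

Definition global_dim_is (d : nat) : Prop :=
  global_dim_le d /\ forall d', global_dim_le d' -> (d <= d')%N.

Definition num_simples_is (n : nat) : Prop := num_iso_classes (@simple K A) n.

Definition lambda1_is (r : nat) : Prop :=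
  num_iso_classes (fun S : lmodType A => simple S /\ ~ proj_dim_is S 1) r.

(* The poset X is finite, being in bijection with the isomorphism classes of
   simple modules.  [p x] is the projective cover P x -> S x, which
   factors through the quotient Delta x of P x. *)
Definition quasi_hereditary : Prop :=
  exists (disp : Order.disp_t) (X : finPOrderType disp)
         (S P Delta : X -> lmodType A)
         (p : forall x, {linear P x -> S x})
         (q : forall x, {linear P x -> Delta x})
         (s : forall x, {linear Delta x -> S x}),
  [/\ [/\ (forall x, simple (S x)),
          (forall x y, isomorphic (S x) (S y) -> x = y) &
          (forall N, simple N -> exists x, isomorphic N (S x))],
      (forall x, projective_cover (p x)),
      (forall x, surjective (q x) /\ forall u, s x (q x u) = p x u),
      (forall x, filtered_by
         (fun N => exists2 y, (y < x)%O & isomorphic N (S y)) (ker (s x))) &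
      (forall x, filtered_by
         (fun N => exists2 t, (x < t)%O & isomorphic N (Delta t)) (ker (q x)))].

End Algebras.

(* Main.v *)
Require Import Defs.
From HB Require Import structures.
From mathcomp Require Import all_boot all_order all_algebra.
From mathcomp Require Import falgebra finmap.
From mathcomp.multinomials Require Import monalg.
From mathcomp Require Import boolp classical_sets.
From mathcomp Require Import zify ring.

Set Implicit Arguments.
Unset Strict Implicit.
Unset Printing Implicit Defensive.

Import GRing.Theory.

Local Open Scope classical_set_scope.
Local Open Scope ring_scope.

(* Nakayama and connectedness force Q to be one oriented cycle, and then A is
   determined by the function e on the universal cover, where e(i) is the first
   vertex at which the paths starting in i become zero.  A uniserial module is an
   interval [i, j), with syzygy [j, e(i)), so the syzygies of the simple module at
   y are the successive intervals of the sequence y, y+1, e(y), e(y+1), ee(y), ...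
   The minimal relations are the paths [a, e(a)) with e(a) < e(a+1), and there
   are r of them up to the period.

   A maximal element of the poset of a quasi-hereditary structure is a vertex
   which no relation crosses.  Cut the cycle there and let g(y) be the number of
   relations starting before y.  Until the resolution stops, g increases strictly
   along the sequence above and stays at most r, so every simple module has
   projective dimension at most r+1.  Equality forces g to increase by exactly one
   at each step, which says that each relation overlaps the next one and no
   later one: the relations form a chain.  Conversely the first relation of a
   chain starts at a simple module of projective dimension r+1. *)

(** * Homological algebra *)

(** Resolutions may use arbitrary projectives, so a lower bound on a projective dimension needs
    Schanuel's lemma; with it, the single cover by [A e_x] computes every syzygy. The Nakayama
    property is tested only on three-dimensional modules, in which products of two arrows act as
    zero. Such modules exist over [A] because [ker pi] lies in the square of the arrow ideal, and
    they leave at most one arrow out of and one into each vertex. For y <= z, e(y) = e(z) exactly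
    when g(y) = g(z), so a resolution continues only while g grows. The cut keeps the relevant terms
    before the end of one period, where g is at most r; on the whole universal cover g is unbounded.
    A maximal x gives a cut because Delta(x) = A e_x. A nonzero path from another vertex y to x,
    shorter than the cycle, yields an embedding of A e_x into A e_y, and this forces the nonzero
    paths from y to reach exactly as far as those from x. Nonzero paths from x to itself of positive
    length are excluded since S_x is not a factor of the radical of Delta(x). *)

Section Submodules.
Variables (K : fieldType) (A : falgType K) (M : lmodType A) (U : set M).

Definition in_submod : {pred M} := fun x => `[< U x >].
(** The proof [HU] is an argument of the type, so that the subtype can carry its module structure as
    an instance. *)
Definition submod_type (HU : submodule U) : Type := {x : M | in_submod x}.

Variable HU : submodule U.

Lemma in_submod_closed : submod_closed in_submod.
Proof.
case: HU => U0 UD; split; first exact/asboolP.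
by move=> a x y /asboolP Ux /asboolP Uy; apply/asboolP/UD.
Qed.

HB.instance Definition _ := SubChoice.copy (submod_type HU) {x : M | in_submod x}.
HB.instance Definition _ :=
  GRing.SubChoice_isSubLmodule.Build A M in_submod (submod_type HU) in_submod_closed.

Lemma submod_typeP (u : submod_type HU) : U (val u).
Proof. exact/asboolP/(valP u). Qed.

Lemma submod_type_ex x : U x -> exists u : submod_type HU, val u = x.
Proof. by move=> Ux; exists (exist _ x (asboolT Ux)). Qed.

End Submodules.

Section Homological.
Variables (K : fieldType) (A : falgType K).
Implicit Types (L M N P X Y : lmodType A).

Definition mklin M N (f : M -> N) (f_lin : linear f) : {linear M -> N} :=
  HB.pack f (GRing.isLinear.Build A M N _ f f_lin).

Lemma mklinE M N (f : M -> N) (f_lin : linear f) x : mklin f_lin x = f x.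
Proof. by []. Qed.

Lemma submoduleZ M (U : set M) a x : submodule U -> U x -> U (a *: x).
Proof. by case=> U0 UD Ux; rewrite -[_ *: _]addr0; apply: UD. Qed.

Lemma submoduleD M (U : set M) x y : submodule U -> U x -> U y -> U (x + y).
Proof. by case=> U0 UD Ux Uy; rewrite -[x]scale1r; apply: UD. Qed.

Lemma submoduleN M (U : set M) x : submodule U -> U x -> U (- x).
Proof. by move=> HU Ux; rewrite -scaleN1r; apply: submoduleZ. Qed.

Lemma submodule_sum M (U : set M) I (s : seq I) (F : I -> M) : submodule U ->
  (forall i, U (F i)) -> U (\sum_(i <- s) F i).
Proof.
move=> HU UF; apply: big_ind => //; first by case: HU.
by move=> x y; apply: submoduleD.
Qed.

Lemma submodule_ker M N (f : {linear M -> N}) : submodule (ker f).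
Proof.
split; first by rewrite /ker /= linear0.
by move=> a x y fx fy; rewrite /ker /= linearP fx fy scaler0 addr0.
Qed.

Lemma submodule_range M N (f : {linear M -> N}) : submodule (range f).
Proof.
split; first by exists 0 => //; rewrite linear0.
by move=> a _ _ [x _ <-] [y _ <-]; exists (a *: x + y) => //; rewrite linearP.
Qed.

Lemma injective_ker M N (f : {linear M -> N}) :
  (forall x, f x = 0 -> x = 0) -> injective f.
Proof.
move=> f0 x y fxy; apply/eqP; rewrite -subr_eq0; apply/eqP/f0.
by rewrite linearB fxy subrr.
Qed.

Lemma bijective_inj_surj (U V : Type) (f : U -> V) :
  injective f -> surjective f -> bijective f.
Proof.
move=> f_inj f_surj; have [g fg] := choice f_surj.
by exists g => // x; apply: f_inj; rewrite fg.
Qed.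

Lemma factor_injective L M X (i : {linear L -> M}) (f : {linear X -> M}) :
  injective i -> (forall x, exists l, i l = f x) ->
  exists g : {linear X -> L}, forall x, i (g x) = f x.
Proof.
move=> i_inj /choice[g ig].
have g_lin : linear g.
  by move=> a x y; apply: i_inj; rewrite linearP !ig linearP.
by exists (mklin g_lin).
Qed.

Lemma pair_ext (U V : Type) (x y : U * V) : x.1 = y.1 -> x.2 = y.2 -> x = y.
Proof. by case: x y => [x1 x2] [y1 y2] /= -> ->. Qed.

Lemma isomorphic_sym M N : isomorphic M N -> isomorphic N M.
Proof.
case=> f [g fK gK].
have g_lin : linear g.
  by move=> a x y; apply: (can_inj fK); rewrite linearP !gK.
by exists (mklin g_lin); exists f.
Qed.

Lemma isomorphic_trans M N P : isomorphic M N -> isomorphic N P -> isomorphic M P.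
Proof.
by case=> f bf [g bg]; exists (g \o f : {linear M -> P}); apply: bij_comp.
Qed.

Lemma projective_section P X (q : {linear X -> P}) : projective P -> surjective q ->
  exists s : {linear P -> X}, forall x, q (s x) = x.
Proof. by move=> Pp qs; apply: (Pp _ _ q (idfun : {linear P -> P})). Qed.

Lemma projective_retract X Y (s : {linear Y -> X}) (t : {linear X -> Y}) :
  cancel s t -> projective X -> projective Y.
Proof.
move=> st Xp M N f g fs; have [h fh] := Xp _ _ f (g \o t : {linear X -> N}) fs.
by exists (h \o s : {linear Y -> M}) => x /=; rewrite fh /= st.
Qed.

Lemma projective_iso M N : isomorphic M N -> projective M -> projective N.
Proof.
move=> /isomorphic_sym[f [g fK gK]].
have g_lin : linear g.
  by move=> a x y; apply: (can_inj fK); rewrite linearP !gK.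
exact: (@projective_retract M N f (mklin g_lin)).
Qed.

Lemma projective_prod P X : projective P -> projective X -> projective (P * X)%type.
Proof.
move=> Pp Xp M N f g fs.
have l1 : linear (fun x : P => g (x, 0)).
  by move=> a x y; rewrite -linearP; congr (g _); apply: pair_ext;
     rewrite /= ?scaler0 ?addr0.
have l2 : linear (fun x : X => g (0, x)).
  by move=> a x y; rewrite -linearP; congr (g _); apply: pair_ext;
     rewrite /= ?scaler0 ?addr0.
have [h1 fh1] := Pp _ _ f (mklin l1) fs.
have [h2 fh2] := Xp _ _ f (mklin l2) fs.
have l : linear (fun x : P * X => h1 x.1 + h2 x.2).
  by move=> a x y; rewrite /= !linearP scalerDr !addrA; congr (_ + _); rewrite [RHS]addrAC.
exists (mklin l) => x; rewrite mklinE linearD fh1 fh2 !mklinE -linearD.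
by congr (g _); apply: pair_ext; rewrite /= ?addr0 ?add0r.
Qed.

Lemma projective0 P : (forall x : P, x = 0) -> projective P.
Proof.
move=> P0 M N f g fs.
have l : linear (fun _ : P => 0 : M) by move=> a x y; rewrite scaler0 addr0.
by exists (mklin l) => x; rewrite mklinE (P0 x) !linear0.
Qed.

Definition ses L M N (i : {linear L -> M}) (p : {linear M -> N}) : Prop :=
  [/\ injective i, surjective p & forall x, p x = 0 <-> exists l, i l = x].

Definition ker_type M N (p : {linear M -> N}) : lmodType A :=
  submod_type (submodule_ker p).

Definition ker_incl M N (p : {linear M -> N}) : {linear ker_type p -> M} := \val.

Lemma ker_typeP M N (p : {linear M -> N}) (x : ker_type p) : p (ker_incl p x) = 0.
Proof. exact: (submod_typeP x). Qed.

Lemma ker_type_ex M N (p : {linear M -> N}) x :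
  p x = 0 -> exists u : ker_type p, ker_incl p u = x.
Proof. exact: (@submod_type_ex _ _ _ _ (submodule_ker p)). Qed.

Lemma ses_ker M N (p : {linear M -> N}) : surjective p -> ses (ker_incl p) p.
Proof.
move=> ps; split=> //; first exact: val_inj.
by move=> x; split=> [/ker_type_ex|[l <-]] //; apply: ker_typeP.
Qed.

(** Projective dimension at most [d], in a form suited to induction. The syzygy is existentially
    quantified; [pdim_le_syzygy] shows that any choice of cover gives the same answer. *)
Fixpoint pdim_le (d : nat) (M : lmodType A) : Prop :=
  if d is d'.+1 then
    exists (L P : lmodType A) (i : {linear L -> P}) (p : {linear P -> M}),
      [/\ projective P, ses i p & pdim_le d' L]
  else projective M.

Lemma pdim_le_iso d M N : isomorphic M N -> pdim_le d M -> pdim_le d N.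
Proof.
case: d => [|d]; first exact: projective_iso.
case=> f bf [L [P [i [p [Pp [ii ps ex] Ld]]]]].
exists L, P, i, (f \o p : {linear P -> N}); split=> //; split=> //.
  by move=> y; have [g fK gK] := bf; have [x px] := ps (g y); exists x; rewrite /= px gK.
move=> x; rewrite -ex /=; split=> [|->]; last by rewrite linear0.
by rewrite -(linear0 f) => /(bij_inj bf).
Qed.

Lemma pdim_leS d M : pdim_le d M -> pdim_le d.+1 M.
Proof.
elim: d M => [|d IHd] M; last first.
  case=> L [P [i [p [Pp e Ld]]]]; exists L, P, i, p; split=> //; exact: IHd.
move=> Mp; pose f : {linear M -> M} := idfun.
have sf : surjective f by move=> x; exists x.
exists (ker_type f), M, (ker_incl f), f; split=> //; first exact: ses_ker.
by apply: projective0 => x; apply: val_inj; have := ker_typeP x.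
Qed.

Lemma pdim_le_leq d d' M : (d <= d')%N -> pdim_le d M -> pdim_le d' M.
Proof.
by move=> /subnK <-; elim: (d' - d)%N => //= k IHk /IHk; apply: pdim_leS.
Qed.

Lemma ses_splitl L M N (i : {linear L -> M}) (p : {linear M -> N}) (s : {linear N -> M}) :
  ses i p -> cancel s p -> exists t : {linear M -> L}, forall x, i (t x) + s (p x) = x.
Proof.
move=> [ii ps ex] sK.
have l : linear (fun x => x - s (p x)).
  by move=> a x y; rewrite /= !linearP scalerDr !addrA; congr (_ + _); rewrite [RHS]addrAC.
have [x|t it] := @factor_injective _ _ _ i (mklin l) ii.
  by apply/ex; rewrite mklinE linearB sK subrr.
by exists t => x; rewrite it mklinE subrK.
Qed.

Lemma projective_ext L M N (i : {linear L -> M}) (p : {linear M -> N}) :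
  ses i p -> projective L -> projective N -> projective M.
Proof.
move=> e Lp Np; have [ii ps ex] := e.
have [s sK] := projective_section Np ps.
have [t tE] := ses_splitl e sK.
have l1 : linear (fun x : L * N => i x.1 + s x.2).
  by move=> a x y; rewrite /= !linearP scalerDr !addrA; congr (_ + _); rewrite [RHS]addrAC.
have l2 : linear (fun x => (t x, p x)).
  by move=> a x y; rewrite !linearP.
apply: (@projective_retract _ _ (mklin l2) (mklin l1)); last exact: projective_prod.
by move=> x; rewrite !mklinE /= tE.
Qed.

(* The horseshoe lemma, for a submodule L of M and a map h from a projective
   whose image covers M / L. *)
Lemma pdim_le_horseshoe d L M P N (i : {linear L -> M}) (h : {linear P -> M})
    (j : {linear N -> P}) :
  (forall L' M' N' (i' : {linear L' -> M'}) (p' : {linear M' -> N'}),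
     ses i' p' -> pdim_le d L' -> pdim_le d N' -> pdim_le d M') ->
  injective i -> injective j -> projective P ->
  (forall x, exists l y, x = i l + h y) ->
  (forall y, (exists l, i l = h y) <-> exists n, j n = y) ->
  pdim_le d.+1 L -> pdim_le d N -> pdim_le d.+1 M.
Proof.
move=> ext ii ij Pp sum ex [L1 [P1 [i1 [p1 [P1p [ii1 ps1 ex1] L1d]]]]] Nd.
have l1 : linear (fun x : P1 * P => i (p1 x.1) + h x.2).
  by move=> a x y; rewrite /= !linearP scalerDr !addrA; congr (_ + _); rewrite [RHS]addrAC.
pose q := mklin l1.
have qs : surjective q.
  move=> x; have [l [y ->]] := sum x; have [z <-] := ps1 l.
  by exists (z, y).
exists (ker_type q), (P1 * P)%type, (ker_incl q), q; split.
- exact: projective_prod.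
- exact: ses_ker.
(* The kernel of [q] is an extension of [N] by [L1]: [k] embeds [L1] in the first coordinate, and
   [g] is the second coordinate read in [N]. Then [ext] applies one degree lower. *)
have l2 : linear (fun x : ker_type q => (ker_incl q x).2) by move=> a x y; rewrite linearP.
have [x|g jg] := @factor_injective _ _ _ j (mklin l2) ij.
  apply/ex; exists (- p1 (ker_incl q x).1); rewrite mklinE linearN.
  apply/eqP; rewrite eq_sym -addr_eq0 addrC; apply/eqP.
  exact: (ker_typeP x).
have l3 : linear (fun x : L1 => (i1 x, 0 : P)).
  by move=> a x y; rewrite linearP; apply: pair_ext; rewrite /= ?scaler0 ?addr0.
have [x|k kE] := @factor_injective _ _ _ (ker_incl q) (mklin l3) val_inj.
  apply: ker_type_ex; rewrite /ker /= linear0 addr0.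
  by rewrite (ex1 (i1 x)).2 ?linear0 //; exists x.
apply: (ext _ _ _ k g) => //; split.
- apply: injective_ker => x kx0; apply: ii1.
  by have := kE x; rewrite kx0 !linear0 mklinE => -[].
- move=> n; have [|l lE] := (ex (j n)).2; first by exists n.
  have [z zE] := ps1 (- l).
  have [|u uE] := @ker_type_ex _ _ q (z, j n).
    by rewrite /ker /= zE linearN lE addNr.
  by exists u; apply: ij; rewrite jg mklinE uE.
move=> x; split=> [gx0|[l <-]]; last first.
  by apply: ij; rewrite jg mklinE linear0 -/(ker_incl q (k l)) kE.
have x2 : (ker_incl q x).2 = 0 by have := jg x; rewrite gx0 linear0 mklinE.
have := ker_typeP x; rewrite /ker /= x2 linear0 addr0 -(linear0 i) => /ii /ex1[l lE].
exists l; apply: val_inj; have := kE l; rewrite mklinE lE -x2 => ->.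
exact: pair_ext.
Qed.

(** Lifting a projective cover of [N] along [p] supplies the map [h] of the horseshoe lemma, whose
    hypothesis [ext] is the induction hypothesis. *)
Lemma pdim_le_ext d L M N (i : {linear L -> M}) (p : {linear M -> N}) :
  ses i p -> pdim_le d L -> pdim_le d N -> pdim_le d M.
Proof.
elim: d L M N i p => [|d IHd] L M N i p e; first exact: projective_ext e.
move=> Ld [N1 [P [j [q [Pp [ij qs exq] N1d]]]]].
have [ii ps exp] := e.
have [h ph] := Pp _ _ p q ps.
apply: (@pdim_le_horseshoe d L M P N1 i h j) => //.
  move=> x; have [y yE] := qs (p x).
  have /exp[l lE] : p (x - h y) = 0 by rewrite linearB ph yE subrr.
  by exists l, y; rewrite lE subrK.
by move=> y; rewrite -exp ph exq.
Qed.

Lemma pdim_le_prod d M N : pdim_le d M -> pdim_le d N -> pdim_le d (M * N)%type.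
Proof.
have l1 : linear (fun x : M => (x, 0 : N)).
  by move=> a x y; apply: pair_ext; rewrite /= ?scaler0 ?addr0.
have l2 : linear (fun x : M * N => x.2) by move=> a x y; rewrite linearP.
apply: (@pdim_le_ext _ _ _ _ (mklin l1) (mklin l2)); split.
- by move=> x y [].
- by move=> y; exists (0, y).
- by case=> x y; rewrite mklinE /=; split=> [->|[z []]] //; exists x.
Qed.

(** Schanuel's lemma and stability under direct summands are proved in alternation: [retract_at d]
    gives [schanuel_at d], and both together give [retract_at d.+1]. *)
Definition schanuel_at d := forall M L P L' P' (i : {linear L -> P}) (p : {linear P -> M})
  (i' : {linear L' -> P'}) (p' : {linear P' -> M}), projective P -> projective P' ->
  ses i p -> ses i' p' -> pdim_le d L -> pdim_le d L'.

Definition retract_at d := forall X Y (s : {linear Y -> X}) (t : {linear X -> Y}),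
  cancel s t -> pdim_le d X -> pdim_le d Y.

(** [L'] is the kernel of a surjection from [L * P'] onto [P]. It splits since [P] is projective, so
    [L'] is a summand of [L * P']. *)
Lemma retract_schanuel d : retract_at d -> schanuel_at d.
Proof.
move=> ret M L P L' P' i p i' p' Pp P'p [ii ps ex] [ii' ps' ex'] Ld.
have [h ph] := P'p _ _ p p' ps.
have l1 : linear (fun x : L * P' => i x.1 + h x.2).
  by move=> a x y; rewrite /= !linearP scalerDr !addrA; congr (_ + _); rewrite [RHS]addrAC.
pose q := mklin l1.
have qs : surjective q.
  move=> x; have [y yE] := ps' (p x).
  have /ex[l lE] : p (x - h y) = 0 by rewrite linearB ph yE subrr.
  by exists (l, y); rewrite mklinE /= lE subrK.
have l2 : linear (fun x => - h (i' x)).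
  by move=> a x y; rewrite !linearP.
have [x|g ig] := @factor_injective _ _ _ i (mklin l2) ii.
  by apply/ex; rewrite mklinE linearN ph (ex' (i' x)).2 ?oppr0 //; exists x.
have l3 : linear (fun x => (g x, i' x)) by move=> a x y; rewrite !linearP.
have e : ses (mklin l3) q.
  split=> //; first by move=> x y [_ /ii'].
  case=> l y; rewrite mklinE /=; split=> [E|[x [<- <-]]]; last by rewrite ig mklinE addNr.
  have /ex'[x xE] : p' y = 0.
    rewrite -ph; have -> : h y = - i l by apply/eqP; rewrite -addr_eq0 addrC; apply/eqP.
    by rewrite linearN (ex (i l)).2 ?oppr0 //; exists l.
  exists x; apply: pair_ext => /=; last exact: xE.
  apply: ii; rewrite ig mklinE xE.
  by apply/eqP; rewrite eq_sym -addr_eq0; apply/eqP.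
have [s sK] := projective_section Pp qs.
have [t tE] := ses_splitl e sK.
apply: (ret _ _ (mklin l3) t); last first.
  by apply: pdim_le_prod => //; apply: (@pdim_le_leq 0).
move=> x; have [e1 _ e3] := e; apply: e1.
have := tE (mklin l3 x); rewrite (e3 (mklin l3 x)).2 ?linear0 ?addr0 //; by exists x.
Qed.

(* Complete the retract Y to X = Y + C, cover both summands by P, and apply
   Schanuel's lemma one degree lower to compare P + P -> X with P -> X. *)
Lemma retract_all d : retract_at d.
Proof.
elim: d => [|d IHd] X Y s t sK; first exact: projective_retract sK.
case=> L [P [i [p [Pp e Ld]]]].
have [_ ps _] := e.
have l1 : linear (fun x => x - s (t x)).
  by move=> a x y; rewrite /= !linearP scalerDr !addrA; congr (_ + _); rewrite [RHS]addrAC.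
have [c cE] : exists c : {linear X -> X}, forall x, c x = x - s (t x).
  by exists (mklin l1).
have ts : surjective (t \o p : {linear P -> Y}).
  by move=> y; have [x xE] := ps (s y); exists x; rewrite /= xE sK.
have l2 : linear (fun x : P * P => s (t (p x.1)) + c (p x.2)).
  by move=> a x y; rewrite /= !linearP scalerDr !addrA; congr (_ + _); rewrite [RHS]addrAC.
pose q := mklin l2.
have qs : surjective q.
  move=> x; have [y yE] := ps x; exists (y, y).
  by rewrite mklinE /= yE cE addrC subrK.
have kd : pdim_le d (ker_type q).
  apply: (retract_schanuel IHd _ _ e (ses_ker qs)) => //.
  exact: projective_prod.
have tc x : t (c x) = 0 by rewrite cE linearB sK subrr.
exists (ker_type (t \o p : {linear P -> Y})), P, (ker_incl _), (t \o p : {linear P -> Y}).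
split=> //; first exact: ses_ker.
have l3 : linear (fun x : ker_type (t \o p : {linear P -> Y}) => (ker_incl _ x, 0 : P)).
  by move=> a x y; rewrite linearP; apply: pair_ext; rewrite /= ?scaler0 ?addr0.
have [x|s' s'E] := @factor_injective _ _ _ (ker_incl q) (mklin l3) val_inj.
  apply: ker_type_ex; have := ker_typeP x; rewrite /ker /= => ->.
  by rewrite !linear0 addr0.
have l4 : linear (fun x : ker_type q => (ker_incl q x).1) by move=> a x y; rewrite linearP.
have [x|t' t'E] :=
    @factor_injective _ _ _ (ker_incl (t \o p : {linear P -> Y})) (mklin l4) val_inj.
  apply: ker_type_ex; have /(congr1 t) := ker_typeP x.
  by rewrite /= linearD sK tc addr0 linear0.
apply: (IHd _ _ s' t') => // x; apply: val_inj.
by have := t'E (s' x); rewrite /= => ->; have := s'E x; rewrite /= => ->.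
Qed.

Lemma schanuel d : schanuel_at d.
Proof. exact/retract_schanuel/retract_all. Qed.

Lemma pdim_le_syzygy d L P M (i : {linear L -> P}) (p : {linear P -> M}) :
  projective P -> ses i p -> pdim_le d.+1 M <-> pdim_le d L.
Proof.
move=> Pp e; split=> [|Ld]; last by exists L, P, i, p.
by case=> L' [P' [i' [p' [P'p e' L'd]]]]; apply: schanuel e' e L'd.
Qed.

End Homological.

(** * Comparison with projective resolutions *)

Section Resolutions.
Variables (K : fieldType) (A : falgType K).
Implicit Types (L M N P X Y : lmodType A).

Lemma pdim_le_proj_dim_le d M : proj_dim_le M d <-> pdim_le d M.
Proof.
split.
  elim: d M => [|d IHd] M [P [f [e [Pp es ex0 ex P0]]]].
    apply: (@projective_iso _ _ (P 0%N)) => //; exists e.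
    apply: bijective_inj_surj => //; apply: injective_ker => x xe.
    have [y _ <-] : range (f 0%N) x by rewrite ex0.
    by rewrite (P0 1%N isT y) linear0.
  exists (ker_type e), (P 0%N), (ker_incl e), e; split=> //; first exact: ses_ker.
  have [x|g gE] := @factor_injective _ _ _ _ _ (ker_incl e) (f 0%N) val_inj.
    by apply: ker_type_ex; have : range (f 0%N) (f 0%N x) by []; rewrite ex0.
  apply: IHd; exists (fun i => P i.+1), (fun i => f i.+1), g; split=> //.
  - move=> x; have : range (f 0%N) (ker_incl e x) by rewrite ex0; apply: ker_typeP.
    by case=> y _ yE; exists y; apply: val_inj; rewrite -[LHS]/(ker_incl e (g y)) gE.
  - rewrite ex; apply/seteqP; split=> x; rewrite /ker /= -gE => h.
      by apply: val_inj; rewrite -[LHS]/(ker_incl e (g x)) h.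
    by rewrite h linear0.
  - by move=> i id; apply: P0.
elim: d M => [|d IHd] M.
  move=> Mp; pose Z := ker_type (idfun : {linear M -> M}).
  have Z0 (x : Z) : x = 0 by apply: val_inj; apply: (ker_typeP x).
  pose P i := if i is 0%N then M else Z.
  pose f i : {linear P i.+1 -> P i} := \0.
  exists P, f, (idfun : {linear M -> M}); split.
  - by case=> [|i] //=; apply: projective0.
  - by move=> x; exists x.
  - apply/seteqP; split=> [_ [x _ <-]|x /= x0]; first by rewrite /ker.
    by exists 0 => //; rewrite linear0 -x0.
  - move=> i; apply/seteqP; split=> [_ [x _ <-]|x _]; first by rewrite /ker.
    by exists 0 => //; rewrite linear0 (Z0 x).
  - by case.
case=> L [P0 [i [p [P0p [ii ps ex] /IHd[P [f [e [Pp es ex0 exS PS]]]]]]]].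
pose Q j := if j is j'.+1 then P j' else P0.
pose g j : {linear Q j.+1 -> Q j} :=
  if j is j'.+1 return {linear Q j.+1 -> Q j} then f j' else (i \o e : {linear P 0%N -> P0}).
exists Q, g, p; split=> //.
- by case.
- apply/seteqP; split=> [_ [x _ <-]|x /ex[l <-]]; first by apply/ex; exists (e x).
  by have [y <-] := es l; exists y.
- case=> [|j]; last exact: exS.
  rewrite -[range _]/(range (f 0%N)) ex0; apply/seteqP; split=> x; rewrite /ker /=.
    by move=> ->; rewrite linear0.
  by rewrite -(linear0 i) => /ii.
- by case=> // j jd; apply: PS.
Qed.

Lemma proj_dim_is1 M : ~ projective M -> (proj_dim_is M 1 <-> pdim_le 1 M).
Proof.
move=> Mp; split=> [[/pdim_le_proj_dim_le]|/pdim_le_proj_dim_le M1] //.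
by split=> // -[/pdim_le_proj_dim_le|].
Qed.

End Resolutions.

(** * Modules with square zero arrows, and the shape of the quiver *)

Lemma coeff_path_elt (K : fieldType) (Q : quiver) (p x : qpath Q) :
  (path_elt p : path_algebra K Q)@_x = (p == x)%:R.
Proof. by rewrite unlock mcoeffU. Qed.

Section Coefficients.
Variables (K : fieldType) (Q : quiver).
Local Notation KQ := (path_algebra K Q).
Implicit Types (f g : KQ) (p q : qpath Q) (a : arrow Q).

Definition parrow a : qpath Q := exist _ (src a, [:: a]) (introT andP (conj (eqxx _) isT)).

Lemma path_mulE p q x : (path_mul p q : KQ)@_x = (Defs.pcomp p q == Some x)%:R.
Proof.
rewrite /path_mul; case: (Defs.pcomp p q) => [r|] /=; first exact: coeff_path_elt.
by rewrite mcoeff0.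
Qed.

Lemma path_eltM p q : (path_elt p * path_elt q : KQ) = path_mul p q.
Proof. exact: pa_mul_path. Qed.

(** Both sides are bilinear, so a formula for one coefficient of a product need only be checked on
    pairs of paths. *)
Lemma coeffM_bilinear (x : qpath Q) (D : KQ -> KQ -> K) :
  (forall g, linear_for *%R (D^~ g)) -> (forall f, linear_for *%R (D f)) ->
  (forall p q, (path_mul p q : KQ)@_x = D (path_elt p) (path_elt q)) ->
  forall f g, (f * g)@_x = D f g.
Proof.
move=> D1 D2 H.
have D10 g : D 0 g = 0.
  by have := D1 g (-1) 0 0; rewrite scaler0 addr0 mulN1r addNr.
have D20 f : D f 0 = 0.
  by have := D2 f (-1) 0 0; rewrite scaler0 addr0 mulN1r addNr.
elim/pa_ind => [|u v Eu Ev|c u Eu|p] g; first by rewrite mul0r mcoeff0.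
- by rewrite mulrDl mcoeffD Eu Ev -[u]scale1r D1 mul1r scale1r.
- by rewrite -scalerAl pa_coeffZ Eu -[c *: u in RHS]addr0 D1 D10 addr0.
elim/pa_ind: g => [|u v Eu Ev|c u Eu|q]; first by rewrite mulr0 mcoeff0.
- by rewrite mulrDr mcoeffD Eu Ev -[u]scale1r D2 mul1r scale1r.
- by rewrite -scalerAr pa_coeffZ Eu -[c *: u in RHS]addr0 D2 D20 addr0.
by rewrite path_eltM H.
Qed.

Lemma pcomp_eq p q r : (Defs.pcomp p q == Some r) =
  [&& ptgt q == psrc p, psrc q == psrc r & parrows q ++ parrows p == parrows r].
Proof.
have [e|ne] := eqVneq (ptgt q) (psrc p); last by rewrite pcomp_None.
have [t -> tE] := pcomp_Some e; rewrite (inj_eq (@Some_inj _)) -val_eqE tE.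
by rewrite /psrc /parrows; case: r => [[x s] h].
Qed.

Lemma qpath_eqE p q : (p == q) = (psrc p == psrc q) && (parrows p == parrows q).
Proof. by []. Qed.

Lemma coeffM_triv x f g :
  (f * g)@_(ptriv x) = f@_(ptriv x) * g@_(ptriv x).
Proof.
move: f g; apply: coeffM_bilinear => [g c u v|f c u v|p q].
- by rewrite mcoeffD pa_coeffZ mulrDl mulrA.
- by rewrite mcoeffD pa_coeffZ mulrDr mulrCA.
rewrite path_mulE !coeff_path_elt -natrM mulnb; congr (_%:R); congr nat_of_bool.
rewrite pcomp_eq !qpath_eqE.
case: p q => [[y s] hp] [[z t] hq]; rewrite /ptgt /psrc /parrows /walk_end /=.
case: t hq => [|b t] /= hq; case: s hp => [|a s] /= hp //; rewrite ?andbF //.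
by rewrite !andbT; apply/andP/andP=> -[/eqP -> /eqP ->].
Qed.

Lemma coeffM_arrow a f g : (f * g)@_(parrow a) =
  f@_(parrow a) * g@_(ptriv (src a)) + f@_(ptriv (tgt a)) * g@_(parrow a).
Proof.
move: f g; apply: coeffM_bilinear => [g c u v|f c u v|p q].
- by rewrite !mcoeffD !pa_coeffZ; ring.
- by rewrite !mcoeffD !pa_coeffZ; ring.
rewrite path_mulE !coeff_path_elt -!natrM !mulnb pcomp_eq !qpath_eqE.
case: p q => [[y s] hp] [[z t] hq]; rewrite /ptgt /psrc /parrows /walk_end /=.
case: t hq => [|b [|b' t]] /= hq; case: s hp => [|c [|c' s]] /= hp;
  rewrite ?andbF ?andbT ?eqseq_cons ?andbF ?andbT ?addr0 ?add0r //=.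
- case/andP: hp => /eqP <- _; case: (eqVneq c a) => [->|]; rewrite ?andbF //.
  by rewrite eqxx; case: (z == src a).
- case: (eqVneq b a) => [->|]; rewrite ?andbF //.
  by rewrite (eq_sym y).
Qed.

(** The elements without terms of length 0 or 1 form a two-sided ideal containing all paths of
    length 2. Hence, for an admissible [ker pi], the coefficients at vertices and arrows are well
    defined on [A]. *)
Lemma arrow_ideal_sq f : @arrow_ideal_pow K Q 2 f ->
  (forall x, f@_(ptriv x) = 0) /\ (forall a, f@_(parrow a) = 0).
Proof.
apply: (@smallest_sub _ (@two_sided_ideal KQ) _
  [set f | (forall x, f@_(ptriv x) = 0) /\ (forall a, f@_(parrow a) = 0)]).
  split.
  - by split=> x; rewrite mcoeff0.
  - by move=> u v [u1 u2] [v1 v2]; split=> x; rewrite mcoeffD ?u1 ?v1 ?u2 ?v2 addr0.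
  - move=> u v [v1 v2]; split=> x; first by rewrite coeffM_triv v1 mulr0.
    by rewrite coeffM_arrow v1 v2 !mulr0 addr0.
  - move=> u v [v1 v2]; split=> x; first by rewrite coeffM_triv v1 mul0r.
    by rewrite coeffM_arrow v1 v2 !mul0r addr0.
move=> _ [p /= p2 <-]; split=> x; rewrite coeff_path_elt qpath_eqE.
  by case: (parrows p =P _) => [e|]; rewrite ?andbF //; move: p2; rewrite /plength e.
by case: (parrows p =P _) => [e|]; rewrite ?andbF //; move: p2; rewrite /plength e.
Qed.

End Coefficients.

(* The data of a representation whose arrows act with square zero: [i] is a
   basis vector at the vertex [sq_vert i], and [sq_arrow i j = Some a] means
   that [a] maps the basis vector [j] to [i]. *)
Record sqdata (Q : quiver) := SqData {
  sq_dim : nat;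
  sq_vert : 'I_sq_dim -> vert Q;
  sq_arrow : 'I_sq_dim -> 'I_sq_dim -> option (arrow Q);
  sq_arrowP : forall i j a, sq_arrow i j = Some a -> src a = sq_vert j /\ tgt a = sq_vert i;
  sq_arrow2 : forall i j k, sq_arrow i j -> sq_arrow j k -> False }.

Section SqAction.
Variables (K : fieldType) (Q : quiver) (D : sqdata Q).
Local Notation KQ := (path_algebra K Q).

Definition sq_act (f : KQ) : 'M[K]_(sq_dim D) :=
  \matrix_(i, j) ((i == j)%:R * f@_(ptriv (sq_vert i)) +
                  oapp (fun a => f@_(parrow a)) 0 (sq_arrow i j)).

Lemma sq_act_linear c f g : sq_act (c *: f + g) = c *: sq_act f + sq_act g.
Proof.
apply/matrixP => i j; rewrite !mxE mcoeffD pa_coeffZ.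
case: (sq_arrow i j) => [a|] /=; first by rewrite mcoeffD pa_coeffZ; ring.
by ring.
Qed.

Lemma sq_actZ c f : sq_act (c *: f) = c *: sq_act f.
Proof.
apply/matrixP => i j; rewrite !mxE pa_coeffZ.
case: (sq_arrow i j) => [a|] /=; first by rewrite pa_coeffZ; ring.
by ring.
Qed.

Lemma sq_act1 : sq_act 1 = 1%:M.
Proof.
apply/matrixP => i j; rewrite !mxE.
have t1 x : (1 : KQ)@_(ptriv x) = 1.
  rewrite [1]/(pa_one K Q) raddf_sum /= (bigD1 x) //= big1 => [|y yx].
    by rewrite coeff_path_elt eqxx addr0.
  rewrite coeff_path_elt; case: eqP => // /(congr1 (@psrc Q)) e.
  by rewrite (e : y = x) eqxx in yx.
have t2 a : (1 : KQ)@_(parrow a) = 0.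
  rewrite [1]/(pa_one K Q) raddf_sum /= big1 // => y _; rewrite coeff_path_elt.
  by rewrite qpath_eqE andbF.
by rewrite t1 mulr1; case: (sq_arrow i j) => [a|] /=; rewrite ?t2 addr0.
Qed.

(** Products of two arrow entries vanish by [sq_arrow2]; what remains is exactly [coeffM_triv] and
    [coeffM_arrow]. *)
Lemma sq_actM f g : sq_act (f * g) = sq_act f *m sq_act g.
Proof.
have delta (i : 'I_(sq_dim D)) (F : 'I_(sq_dim D) -> K) : \sum_k (i == k)%:R * F k = F i.
  rewrite (bigD1 i) //= eqxx mul1r big1 ?addr0 // => k ki.
  by rewrite eq_sym (negbTE ki) mul0r.
pose B (h : KQ) i j := oapp (fun a => h@_(parrow a)) 0 (@sq_arrow _ D i j).
apply/matrixP => i j; rewrite !mxE coeffM_triv.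
transitivity (\sum_k (i == k)%:R * (f@_(ptriv (sq_vert i)) *
                 ((k == j)%:R * g@_(ptriv (sq_vert k)) + B g k j)) +
              \sum_k (j == k)%:R * (B f i k * g@_(ptriv (sq_vert k)))); last first.
  rewrite -big_split /=; apply: eq_bigr => k _; rewrite !mxE -/(B f i k) -/(B g k j).
  have BB : B f i k * B g k j = 0.
    rewrite /B; case E: (sq_arrow i k) => [a|] /=; last by rewrite mul0r.
    case E': (sq_arrow k j) => [b|] /=; last by rewrite mulr0.
    by case: (@sq_arrow2 _ D i k j); rewrite ?E ?E'.
  rewrite (eq_sym j) [RHS]mulrDl [in X in _ = _ + X]mulrDr BB addr0.
  by ring.
rewrite !delta /B; case E: (sq_arrow i j) => [a|] /=; last by ring.
have [e1 e2] := sq_arrowP E.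
by rewrite coeffM_arrow e1 e2; ring.
Qed.

End SqAction.

Section SqModules.
Variables (K : fieldType) (Q : quiver) (A : falgType K).
Variable pi : {lrmorphism path_algebra K Q -> A}.
Hypotheses (pi_surj : surjective pi) (pi_adm : admissible (ker pi)).
Local Notation KQ := (path_algebra K Q).

Lemma pi0_coeff f : pi f = 0 ->
  (forall x, f@_(ptriv x) = 0) /\ (forall a, f@_(parrow a) = 0).
Proof.
by move=> f0; have [_ [m [_ _ sub2]]] := pi_adm; apply: arrow_ideal_sq (sub2 _ f0).
Qed.

Lemma sq_act_eq (D : sqdata Q) (f g : KQ) : pi f = pi g -> sq_act D f = sq_act D g.
Proof.
move=> fg; apply/eqP; rewrite -subr_eq0 -scaleN1r addrC -sq_act_linear; apply/eqP.
have [|h1 h2] := @pi0_coeff (- 1 *: g + f).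
  by rewrite scaleN1r addrC rmorphB /= fg subrr.
apply/matrixP => i j; rewrite !mxE h1 mulr0 add0r.
by case: (sq_arrow i j) => [a|] //=; rewrite h2.
Qed.

Definition pi_lift (a : A) : KQ := projT1 (cid (pi_surj a)).
Lemma pi_liftK a : pi (pi_lift a) = a.
Proof. exact: projT2 (cid (pi_surj a)). Qed.

(** The two proofs are phantom arguments: the action of [A] goes through preimages under [pi] and is
    independent of their choice by admissibility, so the module structure depends on both. *)
Definition sqmod (_ : surjective pi) (_ : admissible (ker pi)) (D : sqdata Q) : Type :=
  'cV[K]_(sq_dim D).

Variable D : sqdata Q.
Local Notation M := (sqmod pi_surj pi_adm D).

HB.instance Definition _ := GRing.Zmodule.on M.

Definition sq_scale (a : A) (v : M) : M := sq_act D (pi_lift a) *m v.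

Lemma sq_scaleE f v : sq_scale (pi f) v = sq_act D f *m v.
Proof. by rewrite /sq_scale (@sq_act_eq _ _ f) ?pi_liftK. Qed.

Fact sq_scaleA a b v : sq_scale a (sq_scale b v) = sq_scale (a * b) v.
Proof.
by rewrite -[a]pi_liftK -[b]pi_liftK -rmorphM !sq_scaleE sq_actM mulmxA.
Qed.

Fact sq_scale1 : left_id 1 sq_scale.
Proof. by move=> v; rewrite -(rmorph1 pi) sq_scaleE sq_act1 mul1mx. Qed.

Fact sq_scaleDr : right_distributive sq_scale +%R.
Proof. by move=> a u v; rewrite /sq_scale mulmxDr. Qed.

Fact sq_scaleDl v : {morph sq_scale^~ v : a b / a + b}.
Proof.
move=> a b; rewrite -[a]pi_liftK -[b]pi_liftK -[in LHS](scale1r (pi_lift a)).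
by rewrite -linearD !sq_scaleE sq_act_linear scale1r mulmxDl.
Qed.

HB.instance Definition _ := GRing.Zmodule_isLmodule.Build A M
  sq_scaleA sq_scale1 sq_scaleDr sq_scaleDl.

Lemma sqmod_scale f (v : M) : pi f *: v = (sq_act D f *m v : M).
Proof. exact: sq_scaleE. Qed.

Lemma sqmod_scaleK (c : K) (v : M) : c%:A *: v = (c *: (v : 'cV[K]_(sq_dim D)) : M).
Proof.
have -> : c%:A = pi (c *: 1) by rewrite linearZ /= rmorph1.
by rewrite sqmod_scale sq_actZ sq_act1 -scalemxAl mul1mx.
Qed.

Lemma sqmod_entry f (v : M) i : (pi f *: v : M) i 0 =
  f@_(ptriv (sq_vert i)) * v i 0 +
  \sum_j oapp (fun a => f@_(parrow a)) 0 (sq_arrow i j) * v j 0.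
Proof.
rewrite sqmod_scale mxE; under eq_bigr => j _ do rewrite !mxE mulrDl.
rewrite big_split /=; congr (_ + _).
rewrite (bigD1 i) //= eqxx mul1r big1 ?addr0 // => j ji.
by rewrite eq_sym (negbTE ji) !mul0r.
Qed.

Lemma sqmod_finite_dim : finite_dim (M : lmodType A).
Proof.
exists (sq_dim D), (fun i => delta_mx i 0 : M) => x; exists (fun i => x i 0).
under eq_bigr => i _ do rewrite sqmod_scaleK.
apply/matrixP => i j; rewrite ord1 -[RHS]/((\sum_k x k 0 *: delta_mx k 0 : 'cV[K]_(sq_dim D)) i 0).
rewrite summxE (bigD1 i) //= !mxE !eqxx mulr1 big1 ?addr0 // => k ki.
by rewrite !mxE eq_sym (negbTE ki) mulr0.
Qed.

End SqModules.

Definition sq_point (Q : quiver) (x : vert Q) : sqdata Q.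
Proof. by refine (@SqData Q 1 (fun=> x) (fun _ _ => None) _ _). Defined.

Section CoordinateSubmodules.
Variables (K : fieldType) (Q : quiver) (A : falgType K).
Variable pi : {lrmorphism path_algebra K Q -> A}.
Hypotheses (pi_surj : surjective pi) (pi_adm : admissible (ker pi)).
Local Notation KQ := (path_algebra K Q).

Definition simple_at x : lmodType A := sqmod pi_surj pi_adm (sq_point x).

Lemma simple_at_scale x f (v : simple_at x) :
  pi f *: v = (f@_(ptriv x))%:A *: v.
Proof.
rewrite sqmod_scaleK; apply/matrixP => i j; rewrite !ord1 sqmod_entry big_ord1 /= mul0r addr0.
by rewrite mxE.
Qed.

Lemma simple_at_gen x (u v : simple_at x) : u != 0 -> exists a : A, v = a *: u.
Proof.
move=> u0; exists (v 0 0 / u 0 0)%:A; rewrite sqmod_scaleK; apply/matrixP => i j.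
rewrite !ord1 mxE divfK //; apply: contra u0 => /eqP u0; apply/eqP/matrixP => k l.
by rewrite !ord1 u0 mxE.
Qed.

Lemma simple_at_one x : exists v : simple_at x, v != 0.
Proof.
exists (const_mx 1 : 'cV[K]_1); apply/eqP => /matrixP/(_ 0 0).
by rewrite !mxE => /eqP; rewrite oner_eq0.
Qed.

Lemma simple_at_simple x : simple (simple_at x).
Proof.
split=> [|U HU]; first exact: simple_at_one.
have [|U0] := pselect (exists2 u, U u & u != 0).
  case=> u Uu u0; right; apply/seteqP; split=> // v _.
  by have [a ->] := simple_at_gen v u0; apply: submoduleZ.
left; apply/seteqP; split=> [u Uu|_ ->]; last by case: HU.
by apply: contrapT => /eqP u0; apply: U0; exists u.
Qed.

Lemma simple_at_inj x y : isomorphic (simple_at x) (simple_at y) -> x = y.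
Proof.
case=> f bf; have [v v0] := simple_at_one x.
have [//|xy] := eqVneq x y.
have : f (pi (path_elt (ptriv x)) *: v) = pi (path_elt (ptriv x)) *: f v by rewrite linearZ.
rewrite !simple_at_scale !coeff_path_elt eqxx.
rewrite scale1r scale1r; case: eqP => [/(congr1 (@psrc Q)) //|_].
by rewrite scale0r scale0r -(linear0 f) => /(bij_inj bf) /eqP; rewrite (negbTE v0).
Qed.

Variable D : sqdata Q.
Local Notation M := (sqmod pi_surj pi_adm D).

Lemma sqmod_arrow c (v : M) i : (pi (path_elt (parrow c)) *: v : M) i 0 =
  \sum_j (sq_arrow i j == Some c)%:R * v j 0.
Proof.
rewrite sqmod_entry coeff_path_elt qpath_eqE andbF mul0r add0r; apply: eq_bigr => j _.
congr (_ * _); case: (sq_arrow i j) => [d|] //=.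
rewrite coeff_path_elt qpath_eqE /= eqseq_cons andbT (inj_eq (@Some_inj _)) eq_sym.
by rewrite (eq_sym d); case: (c =P d) => [->|_]; rewrite ?andbF ?eqxx.
Qed.

Definition sq_span (S : seq 'I_(sq_dim D)) : set M :=
  [set v : M | forall i, i \notin S -> v i 0 = 0].

Definition sq_closed (S : seq 'I_(sq_dim D)) :=
  forall i j, j \in S -> sq_arrow i j -> i \in S.

Lemma sq_span_submodule S : sq_closed S -> submodule (sq_span S).
Proof.
move=> clS; split=> [i _|a u v Uu Uv i iS]; first by rewrite mxE.
rewrite -[RHS]addr0 mxE -{2}(Uv i iS) -(pi_liftK pi_surj a); congr (_ + _).
rewrite -[LHS]/((_ : M) i 0) sqmod_entry (Uu i iS) mulr0 add0r big1 // => j _.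
case E: (sq_arrow i j) => [b|] /=; last by rewrite mul0r.
have [jS|/Uu ->] := boolP (j \in S); last by rewrite mulr0.
by move: iS; rewrite (clS i j jS) ?E.
Qed.

Lemma sq_span_simple (k : 'I_(sq_dim D)) (S : seq 'I_(sq_dim D)) : k \notin S -> sq_closed S ->
  subquotient_iso (sq_span S) (sq_span (rcons S k)) (simple_at (sq_vert k)).
Proof.
move=> kS clS; split.
  by move=> v Uv i; rewrite mem_rcons inE negb_or => /andP[_]; apply: Uv.
exists (fun v : M => (const_mx (v k 0) : 'cV[K]_1)); split.
- move=> a u v Uu Uv; rewrite -(pi_liftK pi_surj a) simple_at_scale sqmod_scaleK.
  apply/matrixP => i j; rewrite !ord1 [LHS]mxE [LHS]mxE [RHS]mxE.
  rewrite [X in _ = X + _]mxE [X in _ = _ * X + _]mxE [X in _ = _ + X]mxE.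
  congr (_ + _); rewrite -[LHS]/((_ : M) k 0).
  rewrite sqmod_entry big1 ?addr0 // => l _.
  case E: (sq_arrow k l) => [b|] /=; last by rewrite mul0r.
  rewrite [u l 0]Uu ?mulr0 // mem_rcons inE negb_or; apply/andP; split.
    apply/eqP => lk; rewrite lk in E.
    by case: (@sq_arrow2 _ D k k k); rewrite E.
  by apply: contra kS => lS; apply: (clS k l lS); rewrite E.
- move=> z; exists (z 0 0 *: delta_mx k 0 : 'cV[K]_(sq_dim D)).
    move=> i; rewrite mem_rcons inE negb_or => /andP[ik _].
    by rewrite !mxE (negbTE ik) mulr0.
  by apply/matrixP => i j; rewrite !ord1 !mxE !eqxx mulr1.
- move=> v Uv; split=> [/matrixP/(_ 0 0)|Sv]; last first.
    by apply/matrixP => i j; rewrite !mxE Sv.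
  rewrite !mxE => vk i iS; have [->//|ik] := eqVneq i k.
  by apply: Uv; rewrite mem_rcons inE negb_or ik.
Qed.

Definition sq_series (s : seq 'I_(sq_dim D)) : seq (set M) :=
  [seq sq_span (take i s) | i <- iota 0 (size s).+1].

Lemma sq_series_composition s : uniq s -> (forall i, i \in s) ->
  (forall i, sq_closed (take i s)) -> composition_series (sq_series s : seq (set (M : lmodType A))).
Proof.
move=> us sall cls; rewrite /sq_series; split.
- rewrite /= take0; apply/seteqP; split=> [v v0|_ -> i _]; last by rewrite mxE.
  by apply/matrixP => i j; rewrite ord1 mxE v0.
- rewrite -nth_last size_map size_iota (nth_map 0%N) ?size_iota // nth_iota // add0n take_size.
  by apply/seteqP; split=> // v _ i; rewrite sall.
- move=> i; rewrite size_map size_iota => ilt.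
  by rewrite (nth_map 0%N) ?size_iota // nth_iota //; apply: sq_span_submodule.
- move=> i; rewrite size_map size_iota ltnS => ilt.
  have ilt' : (i < (size s).+1)%N by apply: leqW.
  have ilt2 : (i.+1 < (size s).+1)%N by [].
  case: s us sall cls ilt ilt' ilt2 => // k0 s us sall cls ilt ilt' ilt2.
  exists (simple_at (sq_vert (nth k0 (k0 :: s) i))); first exact: simple_at_simple.
  rewrite !(nth_map 0%N) ?size_iota // !nth_iota // !add0n (take_nth k0) //.
  apply: sq_span_simple => //; apply: contraTN us => kin.
  rewrite -(cat_take_drop i (k0 :: s)) cat_uniq negb_and; apply/orP; right.
  rewrite negb_and negbK; apply/orP; left; apply/hasP.
  by exists (nth k0 (k0 :: s) i) => //; rewrite (drop_nth k0) // mem_head.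
Qed.

Lemma sq_span_delta S k : k \in S -> sq_span S (delta_mx k 0 : M).
Proof. by move=> kS i iS; rewrite mxE; case: eqVneq iS => // ->; rewrite kS. Qed.

Lemma sq_series_neq s t i k : k \in take i s -> k \notin take i t -> (i <= size s)%N ->
  (i <= size t)%N -> sq_series s <> sq_series t.
Proof.
move=> ks kt si ti /(congr1 (fun u => nth set0 u i)); rewrite /sq_series.
rewrite !(nth_map 0%N) ?size_iota // !nth_iota // !add0n => e.
have := @sq_span_delta _ _ ks; rewrite e => /(_ _ kt)/eqP.
by rewrite !mxE !eqxx oner_eq0.
Qed.

End CoordinateSubmodules.

Section Degrees.
Variables (K : fieldType) (Q : quiver) (A : falgType K).
Variable pi : {lrmorphism path_algebra K Q -> A}.
Hypotheses (pi_surj : surjective pi) (pi_adm : admissible (ker pi)).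
Hypothesis A_nakayama : nakayama A.
Variables (a b : arrow Q) (ab : a != b).

Local Notation i0 := (@Ordinal 3 0 isT).
Local Notation i1 := (@Ordinal 3 1 isT).
Local Notation i2 := (@Ordinal 3 2 isT).

Lemma ord3P (P : 'I_3 -> Prop) : P i0 -> P i1 -> P i2 -> forall i, P i.
Proof.
move=> h0 h1 h2 [[|[|[|i]]] h] //.
- by have -> : Ordinal h = i0 by apply: val_inj.
- by have -> : Ordinal h = i1 by apply: val_inj.
- by have -> : Ordinal h = i2 by apply: val_inj.
Qed.

(** Basis vectors are indexed by ['I_3] and not by vertices, which keeps them apart even when [a] or
    [b] is a loop or the two arrows are parallel. *)
Definition fork_arrow (i j : 'I_3) : option (arrow Q) :=
  match val i, val j with 1, 0 => Some a | 2, 0 => Some b | _, _ => None end%N.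

Definition fork_vert (i : 'I_3) : vert Q :=
  match val i with 0 => src a | 1 => tgt a | _ => tgt b end%N.

Definition cofork_arrow (i j : 'I_3) : option (arrow Q) :=
  match val i, val j with 2, 0 => Some a | 2, 1 => Some b | _, _ => None end%N.

Definition cofork_vert (i : 'I_3) : vert Q :=
  match val i with 0 => src a | 1 => src b | _ => tgt a end%N.

Lemma sum_ord3 (F : 'I_3 -> K) : \sum_i F i = F i0 + F i1 + F i2.
Proof.
rewrite !big_ord_recl big_ord0 addr0 addrA.
by congr (_ + _ + _); congr F; apply: val_inj.
Qed.

(* Otherwise the module with top at [src a] and socle [tgt a], [tgt b] has two
   composition series. *)
Lemma src_neq : src a <> src b.
Proof.
move=> sab.
have P1 i j c : fork_arrow i j = Some c -> src c = fork_vert j /\ tgt c = fork_vert i.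
  by move: i j; apply: ord3P; apply: ord3P => //= -[<-].
have P2 i j k : fork_arrow i j -> fork_arrow j k -> False.
  by move: i j k; apply: ord3P; apply: ord3P; apply: ord3P.
pose D := SqData P1 P2; pose M : lmodType A := sqmod pi_surj pi_adm D.
have ba : (b == a) = false by rewrite eq_sym (negbTE ab).
have act_a (v : M) : pi (path_elt (parrow a)) *: v = (v i0 0 *: delta_mx i1 0 : 'cV[K]_3).
  apply/matrixP => i j; rewrite ord1 sqmod_arrow sum_ord3; move: i.
  by apply: ord3P; rewrite !mxE /= ?(inj_eq (@Some_inj _)) ?eqxx ?ba
    ?mul0r ?mulr0 ?mulr1 ?mul1r ?addr0.
have act_b (v : M) : pi (path_elt (parrow b)) *: v = (v i0 0 *: delta_mx i2 0 : 'cV[K]_3).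
  apply/matrixP => i j; rewrite ord1 sqmod_arrow sum_ord3; move: i.
  by apply: ord3P; rewrite !mxE /= ?(inj_eq (@Some_inj _)) ?eqxx ?(negbTE ab)
    ?mul0r ?mulr0 ?mulr1 ?mul1r ?addr0.
have big (U : set M) : submodule U -> (exists2 v, U v & v i0 0 != 0) -> U = setT.
  move=> HU [v Uv v0]; apply/seteqP; split=> // w _.
  have Ud1 : U (delta_mx i1 0 : 'cV[K]_3).
    have := submoduleZ (v i0 0)^-1%:A HU (submoduleZ (pi (path_elt (parrow a))) HU Uv).
    by rewrite act_a sqmod_scaleK scalerA mulVf // scale1r.
  have Ud2 : U (delta_mx i2 0 : 'cV[K]_3).
    have := submoduleZ (v i0 0)^-1%:A HU (submoduleZ (pi (path_elt (parrow b))) HU Uv).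
    by rewrite act_b sqmod_scaleK scalerA mulVf // scale1r.
  pose c := w i0 0 / v i0 0.
  pose d1 : M := (delta_mx i1 0 : 'cV[K]_3); pose d2 : M := (delta_mx i2 0 : 'cV[K]_3).
  have -> : w = c%:A *: v + ((w i1 0 - c * v i1 0)%:A *: d1 + (w i2 0 - c * v i2 0)%:A *: d2).
    rewrite !sqmod_scaleK; apply/matrixP => i j; rewrite ord1; move: i.
    by apply: ord3P; rewrite !mxE /= /c; field.
  by apply: submoduleD; [|apply: submoduleZ|apply: submoduleD; [|apply: submoduleZ|apply: submoduleZ]].
have : indecomposable M.
  split; first by exists (const_mx 1 : 'cV[K]_3); apply/eqP => /matrixP/(_ i0 0)/eqP;
    rewrite !mxE oner_eq0.
  move=> U V HU HV UV sum.
  have [u [v [Uu Vv /matrixP/(_ i0 0)]]] := sum (const_mx 1 : 'cV[K]_3).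
  rewrite !mxE => e; have [u0|u0] := eqVneq (u i0 0) 0.
    left; rewrite -UV (big V) ?setIT //; exists v => //.
    by move: e; rewrite u0 add0r => <-; apply: oner_neq0.
  by right; rewrite -UV (big U) ?setTI //; exists u.
move=> /(A_nakayama (sqmod_finite_dim _ _ _))[s [_ us]].
have c1 : composition_series (@sq_series _ _ _ _ pi_surj pi_adm D [:: i1; i2; i0]).
  apply: sq_series_composition => //; first by apply: ord3P.
  by case=> [|[|[|i]]] /=; apply: ord3P; apply: ord3P.
have c2 : composition_series (@sq_series _ _ _ _ pi_surj pi_adm D [:: i2; i1; i0]).
  apply: sq_series_composition => //; first by apply: ord3P.
  by case=> [|[|[|i]]] /=; apply: ord3P; apply: ord3P.
have := etrans (esym (us _ c1)) (us _ c2).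
by apply: (@sq_series_neq _ _ _ _ pi_surj pi_adm D _ _ 1%N i1).
Qed.

(** Dual to [src_neq]: two tops at [src a] and [src b] over a common socle. Every nonzero submodule
    contains the socle vector [d2], so the module is indecomposable, and its two tops can be added
    in either order. *)
Lemma tgt_neq : tgt a <> tgt b.
Proof.
move=> tab.
have P1 i j c : cofork_arrow i j = Some c -> src c = cofork_vert j /\ tgt c = cofork_vert i.
  by move: i j; apply: ord3P; apply: ord3P => //= -[<-].
have P2 i j k : cofork_arrow i j -> cofork_arrow j k -> False.
  by move: i j k; apply: ord3P; apply: ord3P; apply: ord3P.
pose D := SqData P1 P2; pose M : lmodType A := sqmod pi_surj pi_adm D.
have ba : (b == a) = false by rewrite eq_sym (negbTE ab).
have act_a (v : M) : pi (path_elt (parrow a)) *: v = (v i0 0 *: delta_mx i2 0 : 'cV[K]_3).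
  apply/matrixP => i j; rewrite ord1 sqmod_arrow sum_ord3; move: i.
  by apply: ord3P; rewrite !mxE /= ?(inj_eq (@Some_inj _)) ?eqxx ?ba
    ?mul0r ?mulr0 ?mulr1 ?mul1r ?addr0.
have act_b (v : M) : pi (path_elt (parrow b)) *: v = (v i1 0 *: delta_mx i2 0 : 'cV[K]_3).
  apply/matrixP => i j; rewrite ord1 sqmod_arrow sum_ord3; move: i.
  by apply: ord3P; rewrite !mxE /= ?(inj_eq (@Some_inj _)) ?eqxx ?(negbTE ab)
    ?mul0r ?mulr0 ?mulr1 ?mul1r ?addr0 ?add0r.
pose d2 : M := (delta_mx i2 0 : 'cV[K]_3).
have soc (U : set M) : submodule U -> U <> [set 0] -> U d2.
  move=> HU U0; have [[v Uv v0]|nU] := pselect (exists2 v, U v & v != 0); last first.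
    case: U0; apply/seteqP; split=> [v Uv|_ ->]; last by case: HU.
    by apply: contrapT => /eqP v0; apply: nU; exists v.
  have [v00|v00] := eqVneq (v i0 0) 0; last first.
    have := submoduleZ (v i0 0)^-1%:A HU (submoduleZ (pi (path_elt (parrow a))) HU Uv).
    by rewrite act_a sqmod_scaleK scalerA mulVf // scale1r.
  have [v10|v10] := eqVneq (v i1 0) 0; last first.
    have := submoduleZ (v i1 0)^-1%:A HU (submoduleZ (pi (path_elt (parrow b))) HU Uv).
    by rewrite act_b sqmod_scaleK scalerA mulVf // scale1r.
  have vE : v = (v i2 0 *: delta_mx i2 0 : 'cV[K]_3).
    apply/matrixP => i j; rewrite ord1; move: i.
    by apply: ord3P; rewrite !mxE /= ?mulr0 ?mulr1 ?v00 ?v10.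
  have v20 : v i2 0 != 0 by apply: contra v0 => /eqP v20; rewrite vE v20 scale0r.
  have := submoduleZ (v i2 0)^-1%:A HU Uv.
  by rewrite vE sqmod_scaleK scalerA !mxE !eqxx mulr1 mulVf // scale1r.
have : indecomposable M.
  split; first by exists (const_mx 1 : 'cV[K]_3); apply/eqP => /matrixP/(_ i0 0)/eqP;
    rewrite !mxE oner_eq0.
  move=> U V HU HV UV _.
  have [|U0] := pselect (U = [set 0]); first by left.
  have [|V0] := pselect (V = [set 0]); first by right.
  have : (U `&` V) d2 by split; apply: soc.
  by rewrite UV => /matrixP/(_ i2 0)/eqP; rewrite !mxE !eqxx oner_eq0.
move=> /(A_nakayama (sqmod_finite_dim _ _ _))[s [_ us]].
have c1 : composition_series (@sq_series _ _ _ _ pi_surj pi_adm D [:: i2; i0; i1]).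
  apply: sq_series_composition => //; first by apply: ord3P.
  by case=> [|[|[|i]]] /=; apply: ord3P; apply: ord3P.
have c2 : composition_series (@sq_series _ _ _ _ pi_surj pi_adm D [:: i2; i1; i0]).
  apply: sq_series_composition => //; first by apply: ord3P.
  by case=> [|[|[|i]]] /=; apply: ord3P; apply: ord3P.
have := etrans (esym (us _ c1)) (us _ c2).
by apply: (@sq_series_neq _ _ _ _ pi_surj pi_adm D _ _ 2%N i0).
Qed.
End Degrees.

Section Cycle.
Variables (K : fieldType) (Q : quiver) (A : falgType K).
Variable pi : {lrmorphism path_algebra K Q -> A}.
Hypotheses (pi_surj : surjective pi) (pi_adm : admissible (ker pi)).
Hypotheses (A_connected : connected_algebra A) (A_nakayama : nakayama A).
Hypothesis Q_cyclic : cyclic_quiver Q.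
Local Notation KQ := (path_algebra K Q).

Lemma pi_triv_neq0 x : pi (path_elt (ptriv x)) <> 0.
Proof.
by move=> /(pi0_coeff pi_adm)[/(_ x)] /eqP; rewrite coeff_path_elt eqxx oner_eq0.
Qed.

Lemma src_inj : injective (@src Q).
Proof.
move=> a b sab; apply: contrapT => /eqP ab; exact: (src_neq pi_surj pi_adm A_nakayama ab sab).
Qed.

Lemma tgt_inj : injective (@tgt Q).
Proof.
move=> a b sab; apply: contrapT => /eqP ab; exact: (tgt_neq pi_surj pi_adm A_nakayama ab sab).
Qed.

Lemma walk_src (x : vert Q) s : walk x s -> [seq src a | a <- s] = belast x [seq tgt a | a <- s].
Proof. by elim: s x => //= a s IHs x /andP[/eqP -> /IHs ->]. Qed.

Lemma path_eltMl (C : pred (vert Q)) (p : qpath Q) :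
  (\sum_(x | C x) path_elt (ptriv x)) * path_elt p = (C (ptgt p))%:R *: path_elt p :> KQ.
Proof.
rewrite mulr_suml; under eq_bigr => x _ do rewrite path_eltM /path_mul pcomp_trivl.
case: (boolP (C _)) => Ct.
  rewrite (bigD1 (ptgt p)) //= eqxx big1 /= ?addr0 ?scale1r // => x /andP[_ xp].
  by rewrite (negbTE xp).
rewrite scale0r big1 // => x Cx; case: eqP => // xp; by rewrite -xp Cx in Ct.
Qed.

Lemma path_eltMr (C : pred (vert Q)) (p : qpath Q) :
  path_elt p * (\sum_(x | C x) path_elt (ptriv x)) = (C (psrc p))%:R *: path_elt p :> KQ.
Proof.
rewrite mulr_sumr; under eq_bigr => x _ do rewrite path_eltM /path_mul pcomp_trivr.
case: (boolP (C _)) => Ct.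
  rewrite (bigD1 (psrc p)) //= eqxx big1 /= ?addr0 ?scale1r // => x /andP[_ xp].
  by rewrite (negbTE xp).
rewrite scale0r big1 // => x Cx; case: eqP => // xp; by rewrite -xp Cx in Ct.
Qed.

(** A path has both ends in [C] or neither, so the sum of the trivial paths at [C] is a central
    idempotent of [A]. Trivial paths survive in [A], so both ideals of the resulting decomposition
    would be nonzero. *)
Lemma closed_vertices_full (C : pred (vert Q)) :
  (forall a, C (src a) = C (tgt a)) -> (exists x, C x) -> forall x, C x.
Proof.
move=> Ca [x0 Cx0] x; apply: contrapT => Cx.
pose E : KQ := \sum_(x | C x) path_elt (ptriv x); pose e : A := pi E.
have Cp (p : qpath Q) : C (psrc p) = C (ptgt p).
  case: p => [[y s] /= h]; rewrite /ptgt /psrc /parrows /walk_end /=.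
  by elim: s y h => //= a s IHs y /andP[/eqP <- /IHs <-].
have EC f : E * f = f * E.
  elim/pa_ind: f => [|u v Eu Ev|c u Eu|p]; rewrite ?mulr0 ?mul0r //.
  - by rewrite mulrDr mulrDl Eu Ev.
  - by rewrite -scalerAl -scalerAr Eu.
  by rewrite path_eltMl path_eltMr Cp.
have EE : E * E = E.
  rewrite {2 3}/E mulr_sumr; apply: eq_bigr => y Cy.
  by rewrite path_eltMl /ptgt /walk_end /psrc /= Cy scale1r.
have eC a : e * a = a * e by have [f <-] := pi_surj a; rewrite -!rmorphM EC.
have ee : e * e = e by rewrite /e -rmorphM EE.
have ex0 : e * pi (path_elt (ptriv x0)) = pi (path_elt (ptriv x0)).
  by rewrite -rmorphM /E path_eltMl /ptgt /walk_end /psrc /= Cx0 scale1r.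
have ex : e * pi (path_elt (ptriv x)) = 0.
  by rewrite -rmorphM /E path_eltMl /ptgt /walk_end /psrc /= (introF idP Cx) scale0r rmorph0.
have [||||I0|J0] := A_connected (I := [set a | e * a = a]) (J := [set a | e * a = 0]).
- split; rewrite /= ?mulr0 //.
  + by move=> u v hu hv; rewrite mulrDr hu hv.
  + by move=> u v hv; rewrite mulrA eC -mulrA hv.
  + by move=> u v hu; rewrite mulrA hu.
- split; rewrite /= ?mulr0 //.
  + by move=> u v hu hv; rewrite mulrDr hu hv addr0.
  + by move=> u v hv; rewrite mulrA eC -mulrA hv mulr0.
  + by move=> u v hu; rewrite mulrA hu mul0r.
- apply/seteqP; split=> [u [/= -> //]|_ ->]; by split; rewrite /= mulr0.
- move=> u; exists (e * u), (u - e * u); split=> /=.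
  + by rewrite mulrA ee.
  + by rewrite mulrBr mulrA ee subrr.
  + by rewrite addrC subrK.
- have : [set a | e * a = a] (pi (path_elt (ptriv x0))) by [].
  by rewrite I0; apply: pi_triv_neq0.
- have : [set a | e * a = 0] (pi (path_elt (ptriv x))) by [].
  by rewrite J0; apply: pi_triv_neq0.
Qed.

Lemma oriented_cycle : exists out : vert Q -> arrow Q,
  [/\ (forall x, src (out x) = x), (forall a, out (src a) = a) &
      (forall x y, exists i, iter i (fun z => tgt (out z)) x = y)].
Proof.
have [[[x s] /= wxs]] := Q_cyclic.
rewrite /plength /ptgt /psrc /parrows /walk_end /= => -[s0 sx].
have srcE := walk_src wxs.
have mem_src y : (y \in [seq src a | a <- s]) = (y \in x :: [seq tgt a | a <- s]).
  rewrite srcE [x :: _]lastI sx mem_rcons inE.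
  by case: (s) s0 => //= a s' _; rewrite inE; case: eqP.
have mem_tgt y : (y \in [seq tgt a | a <- s]) = (y \in x :: [seq tgt a | a <- s]).
  rewrite inE; case: eqP => //= ->; rewrite -{1}sx.
  by case: (s) s0 => //= a s' _; apply: mem_last.
(* An arrow that leaves or enters a vertex of the closed walk is an arrow of the walk, by
   injectivity of [src] and [tgt]. So the vertices of the walk are closed under arrows in both
   directions. *)
have full y : y \in [seq src a | a <- s].
  apply: (closed_vertices_full (C := fun y => y \in [seq src a | a <- s])) => [a|]; last first.
    by exists x; rewrite mem_src mem_head.
  apply/idP/idP => [/mapP[b bs /src_inj ->]|]; first by rewrite mem_src -mem_tgt map_f.
  by rewrite mem_src -mem_tgt => /mapP[b bs /tgt_inj ->]; rewrite map_f.
have [|out outE] := @choice _ _ (fun y (a : arrow Q) => src a = y).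
  by move=> y; have /mapP[a _ ->] := full y; exists a.
have outK a : out (src a) = a by apply: src_inj; rewrite outE.
exists out; split=> // y z; pose succ z := tgt (out z).
have succ_inj : injective succ by move=> u v /tgt_inj /(congr1 (@src Q)); rewrite !outE.
have reach u t : walk u t -> forall v, v \in [seq src a | a <- t] -> fconnect succ u v.
  elim: t u => //= a t IHt u /andP[/eqP au wt] v; rewrite inE au.
  case: eqP => [->|_ /= /(IHt _ wt)]; first by rewrite connect0.
  by apply: connect_trans; apply: connect1; rewrite /= /succ -au outK.
exists (findex succ y z); apply: iter_findex.
apply: (@connect_trans _ _ x); last exact: reach (full z).
by rewrite fconnect_sym //; apply: reach (full y).
Qed.

End Cycle.

(** * Uniserial modules over a cycle *)

Section CyclePaths.
Variables (Q : quiver) (out : vert Q -> arrow Q).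
Hypothesis src_out : forall x, src (out x) = x.
Hypothesis out_src : forall a, out (src a) = a.

Definition succ_of (f : vert Q -> arrow Q) (x : vert Q) : vert Q := tgt (f x).
Local Notation succ := (succ_of out).

Lemma walk_traject x l : walk x (map out (traject succ x l)).
Proof. by elim: l x => //= l IHl x; rewrite src_out eqxx -[tgt (out x)]/(succ x) IHl. Qed.

(** On a cycle a path is determined by its source and its length ([qpath_cpath]), so all later
    computations take place in these coordinates. *)
Definition cpath x l : qpath Q := exist _ (x, map out (traject succ x l)) (walk_traject x l).

Lemma psrc_cpath x l : psrc (cpath x l) = x. Proof. by []. Qed.

Lemma plength_cpath x l : plength (cpath x l) = l.
Proof. by rewrite /plength /parrows /= size_map size_traject. Qed.

Lemma ptgt_cpath x l : ptgt (cpath x l) = iter l succ x.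
Proof.
rewrite /ptgt /walk_end /psrc /parrows /=.
by elim: l x => //= l IHl x; rewrite -[tgt (out x)]/(succ x) IHl -iterSr.
Qed.

Lemma qpath_cpath p : p = cpath (psrc p) (plength p).
Proof.
case: p => [[x s] /= h]; apply: val_inj; rewrite /plength /psrc /parrows /=; congr pair.
by elim: s x h => //= a s IHs x /andP[/eqP <- /IHs {1}->]; rewrite /succ_of out_src.
Qed.

Lemma cpath_inj x y l m : cpath x l = cpath y m -> x = y /\ l = m.
Proof.
by move=> e; split; [have := congr1 (@psrc Q) e | have := congr1 (@plength Q) e;
  rewrite !plength_cpath].
Qed.

Lemma pcomp_cpath x l y m : Defs.pcomp (cpath y m) (cpath x l) =
  if y == iter l succ x then Some (cpath x (l + m)) else None.
Proof.
case: eqP => [->|/eqP ne]; last by rewrite pcomp_None // ptgt_cpath eq_sym.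
have [|r -> rE] := @pcomp_Some _ (cpath (iter l succ x) m) (cpath x l).
  by rewrite ptgt_cpath.
congr Some; apply: val_inj; rewrite rE /= /psrc /parrows /=; congr pair.
elim: l x {r rE} => //= l IHl x; congr cons.
by rewrite -iterS iterSr IHl.
Qed.

Lemma parrows_labelling (v : nat -> vert Q) (alpha : nat -> arrow Q) s l :
  (forall j, (s <= j < s + l)%N -> alpha j = out (v j)) ->
  (forall j, (s <= j < s + l)%N -> v j = iter (j - s) succ (v s)) ->
  parrows (cpath (v s) l) = [seq alpha j | j <- index_iota s (s + l)].
Proof.
move=> al vj; rewrite /index_iota addKn.
have sz : size (parrows (cpath (v s) l)) = l by apply: plength_cpath.
apply: (@eq_from_nth _ (out (v s))); first by rewrite sz size_map size_iota.
move=> i; rewrite sz => il; rewrite (nth_map 0%N) ?size_iota // nth_iota //.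
rewrite al; last lia.
rewrite (vj (s + i)%N); last lia.
rewrite addKn [parrows _]/(map out (traject succ (v s) l)).
by rewrite (nth_map (v s)) ?size_traject // nth_traject.
Qed.

End CyclePaths.

Section CycleAlgebra.
Variables (K : fieldType) (Q : quiver) (A : falgType K).
Variable pi : {lrmorphism path_algebra K Q -> A}.
Hypotheses (pi_surj : surjective pi) (pi_adm : admissible (ker pi)).
Variable out : vert Q -> arrow Q.
Hypothesis src_out : forall x, src (out x) = x.
Hypothesis out_src : forall a, out (src a) = a.
Local Notation KQ := (path_algebra K Q).
Local Notation succ := (succ_of out).
Local Notation cpath := (cpath src_out).

Definition pa x l : A := pi (path_elt (cpath x l)).

Lemma paM x l y m : pa y m * pa x l = (y == iter l succ x)%:R *: pa x (l + m).
Proof.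
rewrite /pa -rmorphM path_eltM /path_mul pcomp_cpath.
by case: eqP => _ /=; rewrite ?scale1r ?scale0r ?rmorph0.
Qed.

Lemma pa_comp x l m : pa (iter l succ x) m * pa x l = pa x (l + m).
Proof. by rewrite paM eqxx scale1r. Qed.

Lemma pa_muln0 x l : pa x l * pa x 0 = pa x l.
Proof. exact: (pa_comp x 0 l). Qed.

Lemma pa_0muln x l : pa (iter l succ x) 0 * pa x l = pa x l.
Proof. by rewrite pa_comp addn0. Qed.

Lemma sum_pa0 : \sum_x pa x 0 = 1.
Proof.
rewrite -(rmorph1 pi) [1 in RHS]/(pa_one K Q) raddf_sum; apply: eq_bigr => x _.
by rewrite /pa; congr (pi (path_elt _)); apply: val_inj.
Qed.

Lemma pa_neq0 x l : (l < 2)%N -> pa x l != 0.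
Proof.
case: l => [|[|//]] _; apply/eqP => /(pi0_coeff pi_adm)[h1 h2].
  have := h1 x; rewrite coeff_path_elt.
  have -> : cpath x 0 = ptriv x by apply: val_inj.
  by move/eqP; rewrite eqxx oner_eq0.
have := h2 (out x); rewrite coeff_path_elt.
have -> : cpath x 1 = parrow (out x) by apply: val_inj; rewrite /= src_out.
by move/eqP; rewrite eqxx oner_eq0.
Qed.

Lemma pa_vanish : exists m, forall x, pa x m = 0.
Proof.
have [_ [m [_ sub _]]] := pi_adm; exists m => x; apply: sub.
by apply: sub_gen_smallest; exists (cpath x m) => //; apply: plength_cpath.
Qed.

Lemma pa_ex0 x : exists l, pa x l == 0.
Proof. by have [m m0] := pa_vanish; exists m; rewrite m0. Qed.

(* The Kupisch number of [x]: the composition length of [A e_x]. *)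
Definition plen x : nat := ex_minn (pa_ex0 x).

Lemma pa_eq0 x l : (pa x l == 0) = (plen x <= l)%N.
Proof.
rewrite /plen; case: ex_minnP => c /eqP c0 cmin; apply/idP/idP; first exact: cmin.
by move=> /subnKC <-; rewrite -pa_comp c0 mulr0.
Qed.

Lemma plen_ge2 x : (2 <= plen x)%N.
Proof. by rewrite ltnNge -pa_eq0 pa_neq0. Qed.

Lemma plen_succ x : (plen x <= (plen (succ x)).+1)%N.
Proof. by rewrite -pa_eq0 -(pa_comp x 1) /= (eqP (_ : pa (succ x) _ == 0)) ?mul0r ?pa_eq0. Qed.

Lemma pi_decomp f x : pi f * pa x 0 = \sum_(l < plen x) (f@_(cpath x l))%:A * pa x l.
Proof.
elim/pa_ind: f => [|u v Eu Ev|c u Eu|p].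
- by rewrite rmorph0 mul0r big1 // => l _; rewrite mcoeff0 scale0r mul0r.
- rewrite rmorphD /= mulrDl Eu Ev -big_split /=.
  by apply: eq_bigr => l _; rewrite mcoeffD scalerDl mulrDl.
- rewrite linearZ /= -scalerAl Eu scaler_sumr.
  by apply: eq_bigr => l _; rewrite pa_coeffZ scalerAl scalerA.
rewrite (qpath_cpath src_out out_src p) -/(pa _ _) paM add0n /=.
set y := psrc p; set m := plength p; under eq_bigr => l _ do rewrite coeff_path_elt.
have eqE l : (cpath y m == cpath x l) = (y == x) && (m == l).
  by apply/eqP/andP => [/cpath_inj[-> ->]|[/eqP -> /eqP ->]].
under eq_bigr => l _ do rewrite eqE; case: (y =P x) => [yx|_]; last first.
  by rewrite scale0r big1 // => l _; rewrite scale0r mul0r.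
rewrite scale1r /=; have [ml|lm] := ltnP m (plen x).
  rewrite (bigD1 (Ordinal ml)) //= eqxx scale1r mul1r big1 ?addr0 // => l lm.
  have /negbTE -> : m != l by apply: contra lm => /eqP ml'; apply/eqP/val_inj.
  by rewrite scale0r mul0r.
rewrite (eqP (_ : pa x m == 0)) ?pa_eq0 // big1 // => l _.
have /negbTE -> : m != l by rewrite gtn_eqF // (leq_trans (ltn_ord l)).
by rewrite scale0r mul0r.
Qed.

Lemma pa_decomp a x : exists k : nat -> K, a * pa x 0 = \sum_(l < plen x) (k l)%:A * pa x l.
Proof. by have [f <-] := pi_surj a; exists (fun l => f@_(cpath x l)); apply: pi_decomp. Qed.

Lemma pa_top a x : exists (k : K) (b : A), a * pa x 0 = k%:A * pa x 0 + b * pa x 1.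
Proof.
have [k ->] := pa_decomp a x.
have p0 : (0 < plen x)%N by have := plen_ge2 x; lia.
exists (k 0), (\sum_(l < plen x | l != Ordinal p0) (k l)%:A * pa (succ x) (l - 1)).
rewrite (bigD1 (Ordinal p0)) //=; congr (_ + _); rewrite mulr_suml.
apply: eq_bigr => -[[|l] lx] l0; first by case/eqP: l0; apply: val_inj.
by rewrite -mulrA -[succ x]/(iter 1 succ x) pa_comp /= subn1.
Qed.

(** The multiplier extends a path of length [l0] to the longest nonzero one; longer terms are pushed
    beyond [plen x] and vanish. This isolates the lowest coefficient of an element of [A e_x]. *)
Lemma mul_pa_sum x (k : nat -> K) l0 : (l0 < plen x)%N -> (forall l, (l < l0)%N -> k l = 0) ->
  pa (iter l0 succ x) (plen x - 1 - l0) * (\sum_(l < plen x) (k l)%:A * pa x l) =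
  (k l0)%:A * pa x (plen x - 1).
Proof.
move=> lc k0; rewrite mulr_sumr (bigD1 (Ordinal lc)) //= big1 => [|l ll0].
  rewrite addr0 -!scalerAl !mul1r -scalerAr pa_comp; congr (_ *: pa x _); lia.
rewrite -scalerAl mul1r -scalerAr paM; have [llt|] := ltnP l l0.
  by rewrite k0 ?scale0r.
rewrite leq_eqVlt => /orP[/eqP e|l0l]; first by case/eqP: ll0; apply: val_inj.
rewrite (eqP (_ : pa x _ == 0)) ?scaler0 // pa_eq0; lia.
Qed.

Lemma pa_indep x (k : nat -> K) : \sum_(l < plen x) (k l)%:A * pa x l = 0 ->
  forall l, (l < plen x)%N -> k l = 0.
Proof.
move=> k0; elim/ltn_ind => l IH lc.
have := mul_pa_sum lc (fun i il => IH i il (ltn_trans il lc)).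
rewrite k0 mulr0 -scalerAl mul1r => /esym/eqP; rewrite scaler_eq0 pa_eq0.
by case/orP => [/eqP //|]; have := plen_ge2 x; lia.
Qed.

(* [A e_x] has simple socle, spanned by its longest nonzero path. *)
Lemma pa_socle a x : a * pa x 0 != 0 -> exists w : A, w * (a * pa x 0) = pa x (plen x - 1).
Proof.
have [k ->] := pa_decomp a x => k0.
have [l [lc kl kmin]] : exists l, [/\ (l < plen x)%N, k l != 0 & forall i, (i < l)%N -> k i = 0].
  have ex : exists l, (l < plen x)%N && (k l != 0).
    apply: contrapT => nex; case/eqP: k0; rewrite big1 // => l _.
    have [->|kl] := eqVneq (k l) 0; first by rewrite scale0r mul0r.
    by case: nex; exists l; rewrite ltn_ord.
  case: (ex_minnP ex) => l /andP[lc kl] lmin; exists l; split=> // i il.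
  by apply/eqP/negPn/negP => ki; have := lmin i; rewrite ki (ltn_trans il lc) leqNgt il => /(_ isT).
exists ((k l)^-1%:A * pa (iter l succ x) (plen x - 1 - l)).
by rewrite -mulrA mul_pa_sum // -scalerAl mul1r -scalerAl mul1r scalerA mulVf // scale1r.
Qed.

End CycleAlgebra.

Section PathModules.
Variables (K : fieldType) (Q : quiver) (A : falgType K).
Variable pi : {lrmorphism path_algebra K Q -> A}.
Hypotheses (pi_surj : surjective pi) (pi_adm : admissible (ker pi)).
Variable out : vert Q -> arrow Q.
Hypothesis src_out : forall x, src (out x) = x.
Hypothesis out_src : forall a, out (src a) = a.
Local Notation succ := (succ_of out).
Local Notation pa := (pa pi src_out).
Local Notation plen := (plen pi_adm src_out).

Definition pm_set x j : set (A^o : lmodType A) := [set a : A^o | exists b : A, a = b * pa x j].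

Lemma pm_set_submodule x j : submodule (pm_set x j).
Proof.
split; first by exists 0; rewrite mul0r.
by move=> a _ _ [u ->] [v ->]; exists (a * u + v); rewrite mulrDl -mulrA.
Qed.

(* The submodule [A p] of [A e_x], where p is the path of length j from x. *)
Definition pmod x j : lmodType A := submod_type (pm_set_submodule x j).
Definition pval {x j} : {linear pmod x j -> A^o} := \val.

Lemma pval_inj x j : injective (@pval x j). Proof. exact: val_inj. Qed.

Lemma pmod_ex x j (b : A) : exists u : pmod x j, pval u = b * pa x j.
Proof. by apply: (@submod_type_ex _ _ _ _ (pm_set_submodule x j)); exists b. Qed.

Lemma pmodP x j (u : pmod x j) : exists b : A, pval u = b * pa x j.
Proof. exact: (submod_typeP u). Qed.

Lemma pvalZ x j (a : A) (u : pmod x j) : pval (a *: u) = a * pval u.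
Proof. by rewrite linearZZ. Qed.

Lemma pval_mul0 x (u : pmod x 0) : pval u * pa x 0 = pval u.
Proof. by have [b ->] := pmodP u; rewrite -mulrA pa_muln0. Qed.

Lemma projective_pmod0 x : projective (pmod x 0).
Proof.
move=> M N f g fs; have [e eE] := pmod_ex x 0 1; rewrite mul1r in eE.
have [m mE] := fs (g e).
have l : linear (fun u : pmod x 0 => (pval u : A) *: m).
  by move=> a u v; rewrite linearD pvalZ scalerDl scalerA.
exists (mklin l) => u; rewrite mklinE linearZZ mE -linearZZ; congr (g _).
by apply: pval_inj; rewrite pvalZ eE pval_mul0.
Qed.

Lemma pmod_incl x l m : exists i : {linear pmod x (l + m) -> pmod x l},
  forall u, pval (i u) = pval u.
Proof.
apply: (@factor_injective _ _ _ _ _ (@pval x l)); first exact: pval_inj.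
move=> u; have [b ->] := pmodP u.
by have [v vE] := pmod_ex x l (b * pa (iter l succ x) m); exists v; rewrite vE -mulrA pa_comp.
Qed.

Lemma pmod_mul x j : exists h : {linear pmod (iter j succ x) 0 -> pmod x j},
  surjective h /\ forall u, pval (h u) = pval u * pa x j.
Proof.
have l : linear (fun u : pmod (iter j succ x) 0 => (pval u * pa x j : A^o)).
  by move=> a u v; rewrite linearD pvalZ mulrDl -mulrA.
have [|u|h hE] := @factor_injective _ _ _ _ _ (@pval x j) (mklin l); first exact: pval_inj.
  have [b] := pmodP u; rewrite mklinE => ->.
  have [v vE] := pmod_ex x j b; exists v.
  by rewrite vE -mulrA pa_0muln.
exists h; split=> [u|u]; last by rewrite hE.
have [b bE] := pmodP u; have [v vE] := pmod_ex (iter j succ x) 0 b.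
by exists v; apply: pval_inj; rewrite hE mklinE vE bE -mulrA pa_0muln.
Qed.

(** Multiplying by the path of length [plen x - 1 - j - l] isolates the coefficient of the path of
    length [l], as in [mul_pa_sum]. All coefficients below [plen x - j] vanish in turn, and a path
    of that length can be factored out on the right. *)
Lemma pmod_ann x j (a : A) : a * pa (iter j succ x) 0 * pa x j = 0 ->
  exists b : A, a * pa (iter j succ x) 0 = b * pa (iter j succ x) (plen x - j).
Proof.
set y := iter j succ x; have [k ->] := pa_decomp pi_surj pi_adm src_out out_src a y => k0.
have kl : forall l, (l < plen x - j)%N -> (l < plen y)%N -> k l = 0.
  elim/ltn_ind => l IH lx ly.
  have /(congr1 (fun u => pa (iter l succ y) (plen x - 1 - j - l) * u)) := k0.
  rewrite mulr0 mulrA mulr_sumr (bigD1 (Ordinal ly)) //= mulrDl.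
  rewrite -!scalerAl !mul1r -scalerAr pa_comp -scalerAl paM eqxx scale1r.
  rewrite mulr_suml big1 ?addr0 => [|i il].
    move/eqP; rewrite scaler_eq0 (pa_eq0 pi_adm) => /orP[/eqP //|]; lia.
  rewrite -!scalerAl !mul1r -scalerAr paM -scalerAl; have [ilt|] := ltnP i l.
    by rewrite IH ?scale0r //; lia.
  rewrite leq_eqVlt => /orP[/eqP e|li]; first by case/eqP: il; apply: val_inj.
  rewrite -scalerAl paM (eqP (_ : pa x _ == 0)) ?scaler0 // (pa_eq0 pi_adm); lia.
exists (\sum_(l < plen y) (k l)%:A * pa (iter (plen x - j) succ y) (l - (plen x - j))).
rewrite mulr_suml; apply: eq_bigr => l _; have [lx|xl] := ltnP l (plen x - j).
  by rewrite kl // !scale0r !mul0r.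
by rewrite -mulrA pa_comp subnKC.
Qed.

(** The syzygy of [pmod x j]. Subtraction is truncated: if [plen x <= j], then [pmod x j] is zero
    and the kernel is all of [A e_y], for y the end of the path. *)
Lemma pmod_ses x j : exists (i : {linear pmod (iter j succ x) (plen x - j) -> pmod (iter j succ x) 0})
  (h : {linear pmod (iter j succ x) 0 -> pmod x j}),
  ses i h /\ forall u, pval (h u) = pval u * pa x j.
Proof.
have [i iE] := pmod_incl (iter j succ x) 0 (plen x - j).
have [h [hs hE]] := pmod_mul x j; exists i, h; split=> //; split=> //.
  by move=> u v /(congr1 (@pval _ _)); rewrite !iE => /pval_inj.
move=> u; split=> [hu|[v <-]].
  have := hE u; rewrite hu linear0 -pval_mul0 => /esym/pmod_ann[b].
  rewrite pval_mul0 => bE; have [v vE] := pmod_ex (iter j succ x) (plen x - j) b.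
  by exists v; apply: pval_inj; rewrite iE vE bE.
apply: pval_inj; rewrite hE iE linear0; have [b ->] := pmodP v.
rewrite -mulrA paM eqxx scale1r (eqP (_ : pa x _ == 0)) ?mulr0 // (pa_eq0 pi_adm); lia.
Qed.

Lemma pdim_pmodS d x j : pdim_le d.+1 (pmod x j) <->
  pdim_le d (pmod (iter j succ x) (plen x - j)).
Proof.
have [i [h [e _]]] := pmod_ses x j.
exact (pdim_le_syzygy d (@projective_pmod0 _) e).
Qed.

Lemma pmod_eq0 x j (u : pmod x j) : (plen x <= j)%N -> u = 0.
Proof.
rewrite -(pa_eq0 pi_adm) => /eqP p0; apply: pval_inj.
by have [b ->] := pmodP u; rewrite p0 mulr0 linear0.
Qed.

(** The cases are a zero module and a cover [h] with zero kernel. Otherwise a section [s] of [h]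
    sends the generator [g] to a nonzero element of [A e_y], and some [w] carries [s g] to the socle
    path. But [w] kills [g], since the path of length [j + plen y - 1] from [x] is already zero. *)
Lemma projective_pmod x j : projective (pmod x j) <->
  (plen x <= j)%N \/ (plen (iter j succ x) + j <= plen x)%N.
Proof.
have [i [h [[ii hs ex] hE]]] := pmod_ses x j; set y := iter j succ x in i h ii hs ex hE *.
split=> [Pp|[xj|yx]]; last first.
- apply: (@projective_iso _ _ (pmod y 0) _ _ (@projective_pmod0 y)); exists h.
  apply: bijective_inj_surj => //; apply: injective_ker => u /ex[v <-].
  by rewrite (@pmod_eq0 _ _ v) ?linear0 //; lia.
- by apply: projective0 => u; apply: pmod_eq0.
have [|jx] := leqP (plen x) j; [by left | right].
rewrite leqNgt; apply/negP => yx.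
have [s sK] := projective_section Pp hs.
have [g gE] := pmod_ex x j 1; rewrite mul1r in gE.
have g0 : g <> 0.
  move=> g0; have := gE; rewrite g0 linear0 => /esym/eqP.
  by rewrite (pa_eq0 pi_adm) leqNgt jx.
have sg : pval (s g) * pa y 0 != 0.
  rewrite pval_mul0; apply/eqP => sg0; apply: g0; rewrite -(sK g).
  have -> : s g = 0 by apply: pval_inj; rewrite sg0 linear0.
  by rewrite linear0.
have [w wE] := pa_socle pi_surj pi_adm out_src sg; rewrite pval_mul0 in wE.
have wg : w *: g = 0.
  rewrite -(sK g) -linearZZ; apply: pval_inj; rewrite hE pvalZ wE linear0.
  by rewrite paM eqxx scale1r; apply/eqP; rewrite (pa_eq0 pi_adm); lia.
have : pval (s (w *: g)) = pa y (plen y - 1) by rewrite linearZZ pvalZ wE.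
rewrite wg !linear0 => /esym/eqP; rewrite (pa_eq0 pi_adm); have := plen_ge2 pi_adm src_out y; lia.
Qed.

Lemma simple_at_cover x : exists (i : {linear pmod x 1 -> pmod x 0})
  (h : {linear pmod x 0 -> simple_at pi_surj pi_adm x}),
  ses i h.
Proof.
have [i iE] := pmod_incl x 0 1.
have [o o0] := simple_at_one pi_surj pi_adm x.
have l : linear (fun u : pmod x 0 => (pval u : A) *: o).
  by move=> a u v; rewrite linearD pvalZ scalerDl scalerA.
have pao k : pa x k *: o = (k == 0)%:R%:A *: o.
  rewrite simple_at_scale coeff_path_elt; congr ((_%:R%:A) *: o).
  rewrite qpath_eqE; case: k => [|k]; last by rewrite andbF.
  by rewrite !eqxx.
exists i, (mklin l); split.
- by move=> u v /(congr1 (@pval _ _)); rewrite !iE => /pval_inj.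
- move=> v; have [b ->] := simple_at_gen v o0; have [u uE] := pmod_ex x 0 b.
  by exists u; rewrite mklinE uE -scalerA pao eqxx scale1r scale1r.
move=> u; split=> [|[v <-]]; last first.
  by rewrite mklinE iE; have [b ->] := pmodP v; rewrite -scalerA pao !scale0r scaler0.
rewrite mklinE; have [k [b kE]] := pa_top pi_surj pi_adm src_out out_src (pval u) x.
rewrite pval_mul0 in kE; rewrite kE scalerDl -!scalerA !pao /= !scale0r scaler0 addr0.
rewrite !scale1r sqmod_scaleK => /eqP; rewrite scalemx_eq0 (negbTE o0) orbF => /eqP k0.
have [v vE] := pmod_ex x 1 b; exists v.
by apply: pval_inj; rewrite iE vE kE k0 scale0r mul0r add0r.
Qed.

Lemma pdim_simple_at d x : pdim_le d.+1 (simple_at pi_surj pi_adm x) <-> pdim_le d (pmod x 1).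
Proof.
have [i [h e]] := simple_at_cover x.
exact (pdim_le_syzygy d (@projective_pmod0 _) e).
Qed.

End PathModules.

Arguments pval {K Q A pi out src_out x j}.

(** * Syzygies as a sequence of integers *)

Section Jumps.
Variable e : nat -> nat.
Hypothesis e_mono : forall i, (e i <= e i.+1)%N.
Hypothesis e_gt : forall i, (i < e i)%N.

Lemma jump_mono i j : (i <= j)%N -> (e i <= e j)%N.
Proof. by move=> /subnK <-; elim: (j - i)%N => //= k /leq_trans ->. Qed.

(** This is the function g of the overview: a minimal relation starts at [a] exactly when
    [e a < e a.+1]. *)
Definition jumps y := (\sum_(a < y) (e a < e a.+1))%N.

Lemma jumpsS y : jumps y.+1 = (jumps y + (e y < e y.+1))%N.
Proof. by rewrite /jumps big_ord_recr. Qed.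

Lemma jumps_mono y z : (y <= z)%N -> (jumps y <= jumps z)%N.
Proof.
move=> /subnK <-; elim: (z - y)%N => //= k /leq_trans -> //.
by rewrite addSn jumpsS leq_addr.
Qed.

(** Both functions are monotone and [jumps] grows at precisely the steps where [e] does. A vanishing
    syzygy, which is an equality between values of [e], thus becomes an equality of counts. *)
Lemma jumps_eq y z : (y <= z)%N -> (jumps y == jumps z) = (e y == e z).
Proof.
move=> yz; rewrite -(subnK yz); elim: (z - y)%N => [|k IH]; first by rewrite !eqxx.
rewrite addSn jumpsS; have := jumps_mono (leq_addl k y); have := jump_mono (leq_addl k y).
by have := e_mono (k + y); move: IH; lia.
Qed.

(* Intervals [i, j) of the universal cover stand for uniserial modules; when the
   projective cover of [i, j) is [i, e i), its syzygy is [j, e i), so the t-th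
   syzygy is [syz t, syz (t+1)). *)
Fixpoint syz (i j t : nat) : nat := if t is t'.+1 then syz j (e i) t' else i.

Lemma syzSS i j t : syz i j t.+2 = e (syz i j t).
Proof. by elim: t i j => //= t IHt i j; rewrite -IHt. Qed.

Variables (N r : nat).
Hypothesis cut : forall y, (y < N)%N -> (e y <= N)%N \/ e y = e N.
Hypothesis jumpsN : jumps N = r.

(** The second alternative of [cut], [e y = e N], would give [jumps y = jumps N = r]. *)
Lemma cut_jumps y : (y <= N)%N -> (jumps y < r)%N -> (e y <= N)%N.
Proof.
move=> yN yr; have yN' : (y < N)%N.
  by rewrite ltn_neqAle yN andbT; apply: contraTneq yr => ->; rewrite jumpsN ltnn.
have [//|/eqP] := cut yN'; rewrite -jumps_eq // jumpsN; lia.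
Qed.

Lemma syz_mono i j t : (i <= j)%N -> (j <= e i)%N -> (syz i j t <= syz i j t.+1)%N.
Proof. by elim: t i j => //= t IHt i j ij ji; apply: IHt => //; apply: jump_mono. Qed.

(** A nonzero syzygy raises [jumps] strictly along the sequence. Since [syz T.+1] is still at most
    [N], its count is at most [r], so [syz T] has count below [r] and [cut_jumps] keeps the
    following term [e (syz T)] within [N]. *)
Lemma syz_jumps y T : (y < N)%N -> (T <= r)%N ->
  (forall t, (t < T)%N -> syz y y.+1 t.+2 != syz y y.+1 t.+3) ->
  (syz y y.+1 T.+1 <= N)%N /\ (T <= jumps (syz y y.+1 T))%N.
Proof.
move=> yN; elim: T => [|T IHT] Tr ne; first by split.
have [||leN Tg] := IHT; [by lia|by move=> t tT; apply: ne; lia|].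
have le1 := syz_mono T (leqnSn y) (e_gt y).
have := ne T (ltnSn T); rewrite !syzSS -jumps_eq // => neg.
have le2 := jumps_mono le1; have := jumps_mono leN; rewrite jumpsN => le3.
split; last lia.
by apply: cut_jumps; [exact: leq_trans leN | lia].
Qed.

Lemma syz_stops y : (y < N)%N -> exists2 t, (t <= r)%N & syz y y.+1 t.+2 = syz y y.+1 t.+3.
Proof.
move=> yN; apply: contrapT => nex.
have ne t : (t <= r)%N -> syz y y.+1 t.+2 != syz y y.+1 t.+3.
  by move=> tr; apply/eqP => et; apply: nex; exists t.
have [leN rg] := @syz_jumps y r yN (leqnn r) (fun t tr => ne t (ltnW tr)).
have le1 := syz_mono r (leqnSn y) (e_gt y).
have := ne r (leqnn r); rewrite !syzSS -jumps_eq //.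
have := jumps_mono le1; have := jumps_mono leN; rewrite jumpsN; lia.
Qed.

Lemma jump_exists k i : (0 < i <= jumps k)%N ->
  exists a, [/\ (a < k)%N, jumps a = i.-1 & (e a < e a.+1)%N].
Proof.
elim: k => [|k IHk]; first by rewrite /jumps big_ord0; lia.
move=> ik; have [ile|] := leqP i (jumps k).
  by have [|a [ak ga ea]] := IHk; [lia|exists a; split=> //; lia].
by move=> kb; exists k; move: ik kb; rewrite jumpsS; case: ltnP => //= ek; split=> //; lia.
Qed.

(** Here [a i] is the start of the i-th relation before [N]. A sequence of maximal length leaves no
    slack in [syz_jumps]: the term of index [t] has count exactly [t] for [t < r]. This locates each
    end [e (a i)] among the starts, and the last two clauses are the chain conditions. *)
Lemma long_syz_chain y : (y < N)%N ->
  (forall t, (t < r)%N -> syz y y.+1 t.+2 != syz y y.+1 t.+3) ->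
  exists a : nat -> nat,
  [/\ (forall i, (0 < i <= r)%N -> [/\ (a i < N)%N, (e (a i) < e (a i).+1)%N & (e (a i) <= N)%N]),
     (forall z, (z < N)%N -> (e z < e z.+1)%N -> exists2 i, (0 < i <= r)%N & a i = z),
     (forall i j, (0 < i)%N -> (i < j <= r)%N -> (a i < a j)%N),
     (forall i, (0 < i < r)%N -> (a i.+1 < e (a i))%N) &
     (forall i, (0 < i)%N -> (i.+2 <= r)%N -> (e (a i) <= a i.+2)%N)].
Proof.
move=> yN ne.
have [|a aP] := @choice _ _ (fun i a => (0 < i <= r)%N ->
    [/\ (a < N)%N, jumps a = i.-1 & (e a < e a.+1)%N]).
  move=> i; have [ir|ir] := boolP (0 < i <= r)%N; last by exists 0%N.
  by have [a aP] := @jump_exists N i (etrans (congr1 (fun u => 0 < i <= u)%N jumpsN) ir); exists a.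
have gS i : (0 < i <= r)%N -> jumps (a i).+1 = i.
  by move=> ir; have [_ ga ea] := aP i ir; rewrite jumpsS ga ea; lia.
(* The lower bound is [syz_jumps]. The upper bound descends from [jumps (syz r) <= r], losing at
   least one at each step because the counts are distinct. *)
have gm t : (t < r)%N -> jumps (syz y y.+1 t) = t /\ (syz y y.+1 t <= N)%N.
  move=> tr; have H s : (s <= r)%N -> _ :=
    fun sr => @syz_jumps y s yN sr (fun t ts => ne t (leq_trans ts sr)).
  have le1 s := syz_mono s (leqnSn y) (e_gt y).
  have leN s : (s <= r)%N -> (syz y y.+1 s <= N)%N.
    by move=> sr; have [h _] := H s sr; apply: leq_trans h.
  split; last by apply: leN; lia.
  have gl s : (s <= r)%N -> (s <= jumps (syz y y.+1 s))%N by move=> /H[].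
  have : forall d, (d <= r)%N -> (jumps (syz y y.+1 (r - d)) <= r - d)%N.
    elim=> [_|d IHd dr]; first by rewrite subn0 -{2}jumpsN; apply: jumps_mono; apply: leN.
    have := ne (r - d.+1)%N; rewrite !syzSS -jumps_eq //.
    have -> : (r - d.+1).+1 = (r - d)%N by lia.
    have := IHd; have := jumps_mono (le1 (r - d.+1)%N).
    have -> : (r - d.+1).+1 = (r - d)%N by lia.
    lia.
  move=> /(_ (r - t)%N); rewrite subKn; last lia.
  by have := gl t; lia.
(* Both [a i] and the term of index [i.-1] have count [i.-1], so [e] agrees on them and [e (a i)] is
   the term of index [i.+1]. For [i.+1 = r] this lies beyond the range of [gm], and only the lower
   bound is kept; it suffices for the overlap. *)
have gb i : (0 < i < r)%N -> jumps (e (a i)) = i.+1 \/ i.+1 = r /\ (r <= jumps (e (a i)))%N.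
  move=> ir.
  have [gi iN] := gm i.-1 ltac:(lia).
  have [|_ ga _] := aP i; first lia.
  have ea : e (a i) = syz y y.+1 i.+1.
    have -> : i.+1 = i.-1.+2 by lia.
    rewrite syzSS; apply/eqP.
    have [le|le] := leqP (a i) (syz y y.+1 i.-1); first by rewrite -jumps_eq // ga gi.
    by rewrite eq_sym -jumps_eq ?ga ?gi // ltnW.
  have [ir'|ir'] := ltnP i.+1 r; first by left; rewrite ea; case: (gm i.+1 ir').
  right; split; first lia.
  have : (i.+1 <= r)%N by lia.
  rewrite ea => h; have [_] := @syz_jumps y i.+1 yN h (fun t ts => ne t (leq_trans ts h)).
  by apply: leq_trans; lia.
exists a; split.
- move=> i ir; have [aN ga ea] := aP i ir; split=> //.
  by apply: cut_jumps; [exact: ltnW | rewrite ga; lia].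
- move=> z zN ez; exists (jumps z.+1).
    by have := jumps_mono zN; rewrite jumpsN jumpsS ez; lia.
  have zr : (0 < jumps z.+1 <= r)%N.
    by have := jumps_mono zN; rewrite jumpsN jumpsS ez; lia.
  have [aN ga ea] := aP _ zr; have gaS := gS _ zr.
  have gz : jumps z.+1 = (jumps z).+1 by rewrite jumpsS ez addn1.
  have [lt|lt|//] := ltngtP (a (jumps z.+1)) z.
    by have := jumps_mono lt; rewrite gaS gz; lia.
  by have := jumps_mono lt; rewrite ga gz; lia.
- move=> i j i0 ij; have [_ gi _] := aP i ltac:(lia); have [_ gj _] := aP j ltac:(lia).
  by rewrite ltnNge; apply/negP => /jumps_mono; rewrite gi gj; lia.
- move=> i ir; have [_ gi _] := aP i.+1 ltac:(lia).
  rewrite ltnNge; apply/negP => /jumps_mono; rewrite gi /=.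
  by case: (gb i ir) => [->|[]]; lia.
- move=> i i0 ir; rewrite leqNgt; apply/negP => /jumps_mono.
  rewrite gS; last lia.
  by case: (gb i ltac:(lia)) => [->|[]]; lia.
Qed.

End Jumps.

(** * Global dimension from the simple modules *)

Section Span.
Variables (K : fieldType) (A : falgType K) (M : lmodType A).

Fixpoint span (s : seq M) : set M :=
  if s is w :: s' then [set x | exists (a : A) u, span s' u /\ x = a *: w + u] else [set 0].

Lemma span_submodule s : submodule (span s).
Proof.
elim: s => [|w s [IH0 IHD]] /=.
  by split=> // a x y /= -> ->; rewrite scaler0 addr0.
split; first by exists 0, 0; rewrite scale0r addr0.
move=> c _ _ [a [u [su ->]]] [b [v [sv ->]]]; exists (c * a + b), (c *: u + v).
by split; [exact: IHD | rewrite scalerDr scalerDl scalerA addrACA].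
Qed.

Lemma span_cons w s x : span s x -> span (w :: s) x.
Proof. by move=> sx; exists 0, x; rewrite scale0r add0r. Qed.

Lemma span_mem s w : w \in s -> span s w.
Proof.
elim: s => //= v s IHs; rewrite inE => /orP[/eqP ->|/IHs sw]; last exact: (span_cons v sw).
by exists 1, 0; rewrite scale1r addr0; split=> //; case: (span_submodule s).
Qed.

Lemma span_cat t s x : span s x -> span (t ++ s) x.
Proof. by elim: t => //= w t IHt /IHt; apply: span_cons. Qed.

End Span.

Section GlobalDimension.
Variables (K : fieldType) (Q : quiver) (A : falgType K).
Variable pi : {lrmorphism path_algebra K Q -> A}.
Hypotheses (pi_surj : surjective pi) (pi_adm : admissible (ker pi)).
Variable out : vert Q -> arrow Q.
Hypothesis src_out : forall x, src (out x) = x.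
Hypothesis out_src : forall a, out (src a) = a.
Local Notation succ := (succ_of out).
Local Notation pa := (pa pi src_out).
Local Notation plen := (plen pi_adm src_out).
Local Notation pmod := (pmod pi src_out).

Section Layers.
Variable M : lmodType A.

Fixpoint layered (s : seq M) : Prop :=
  if s is w :: s' then
    (exists y, pa y 0 *: w = w /\ span s' (pa y 1 *: w)) /\ layered s'
  else True.

Lemma layered_cat t s :
  (forall w, w \in t -> exists y, pa y 0 *: w = w /\ span s (pa y 1 *: w)) ->
  layered s -> layered (t ++ s).
Proof.
elim: t => //= w t IHt tP ss; split; last first.
  by apply: IHt => // v vt; apply: tP; rewrite inE vt orbT.
have [|y [yw sw]] := tP w; first by rewrite mem_head.
by exists y; split=> //; apply: span_cat.
Qed.

(* Each new generator adds a factor that is simple or zero. *)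
Lemma pdim_layered d s : (forall y, pdim_le d (pmod y 1)) -> layered s ->
  pdim_le d.+1 (submod_type (span_submodule s)).
Proof.
move=> pd; elim: s => [_|w s IHs [[y [yw sw]] /IHs Ld]].
  by apply: (@pdim_le_leq _ _ 0) => //; apply: projective0 => u; apply/val_inj/(submod_typeP u).
pose L : lmodType A := submod_type (span_submodule s).
pose N : lmodType A := submod_type (span_submodule (w :: s)).
pose iL : {linear L -> M} := \val; pose iN : {linear N -> M} := \val.
have [u|i iE] := @factor_injective _ _ _ _ _ iN iL val_inj.
  exact: (@submod_type_ex _ _ _ _ (span_submodule (w :: s)) (iL u)
           (span_cons w (submod_typeP u))).
(* If [w] is already in the span, the factor is zero and both spans are the same module. Otherwise
   the factor is simple with cover [pmod y 0] and syzygy [pmod y 1], as the horseshoe lemma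
   requires. *)
have [sw0|nsw] := pselect (span s w).
  apply: pdim_le_iso Ld; exists i; apply: bijective_inj_surj.
    by move=> u v e; apply: val_inj; rewrite -[LHS]iE e iE.
  move=> x; have [a [u [su xE]]] := submod_typeP x.
  have [|v vE] := @submod_type_ex _ _ _ _ (span_submodule s) (a *: w + u).
    by apply: submoduleD; [exact: span_submodule | apply: submoduleZ => //; exact: span_submodule |].
  by exists v; apply: val_inj; rewrite -[LHS]/(iN (i v)) iE xE -vE.
have l : linear (fun u : pmod y 0 => (pval u : A) *: w).
  by move=> a u v; rewrite linearD pvalZ scalerDl scalerA.
have [u|h hE] := @factor_injective _ _ _ _ _ iN (mklin l) val_inj.
  apply: (@submod_type_ex _ _ _ _ (span_submodule (w :: s))).
  by exists (pval u), 0; rewrite addr0; split=> //; case: (span_submodule s).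
have [j jE] := pmod_incl pi src_out y 0 1.
apply: (@pdim_le_horseshoe _ _ d L N (pmod y 0) (pmod y 1) i h j) => //.
- exact: pdim_le_ext.
- by move=> u v e; apply: val_inj; rewrite -[LHS]iE e iE.
- by move=> u v /(congr1 pval); rewrite !jE => /pval_inj.
- exact: projective_pmod0.
- move=> x; have [a [u [su xE]]] := submod_typeP x.
  have [v vE] := @submod_type_ex _ _ _ _ (span_submodule s) u su.
  have [p pE] := pmod_ex pi src_out y 0 a; exists v, p.
  apply: val_inj; rewrite xE -[RHS]/(iN (i v + h p)) linearD iE hE mklinE pE.
  by rewrite -scalerA yw addrC -vE.
move=> u; split=> [[v vE]|[v <-]].
  have := hE u; rewrite -vE iE mklinE => swu.
  have := submod_typeP v; rewrite -[val v]/(iL v) swu.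
  (* If [u] carries [w] into the span of [s], its coefficient [k] at the trivial path is zero, since
     otherwise [w] itself would lie in that span. So [u] comes from [pmod y 1]. *)
  have [k [b]] := pa_top pi_surj pi_adm src_out out_src (pval u) y.
  rewrite pval_mul0 => uE; rewrite uE scalerDl -!scalerA yw => sk.
  have /(submoduleD (span_submodule s) sk) : span s (- (b *: (pa y 1 *: w))).
    by apply: submoduleN; [|apply: submoduleZ => //]; exact: span_submodule.
  rewrite addrK => {}sk; have [k0|k0] := eqVneq k 0.
    have [z zE] := pmod_ex pi src_out y 1 b; exists z; apply: pval_inj.
    by rewrite jE zE uE k0 scale0r mul0r add0r.
  case: nsw; have := submoduleZ k^-1%:A (span_submodule s) sk.
  by rewrite scalerA -scalerAl mul1r scalerA mulVf // !scale1r.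
have [b bE] := pmodP v.
have [|z zE] := @submod_type_ex _ _ _ _ (span_submodule s) (b *: (pa y 1 *: w)).
  by apply: submoduleZ => //; exact: span_submodule.
exists z; apply: val_inj; rewrite -[LHS]/(iN (i z)) -[RHS]/(iN (h (j v))) iE hE mklinE jE bE.
by rewrite -scalerA -zE.
Qed.

End Layers.

(** The vectors [pa x l *: b i], sorted by increasing length [l], generate [M]. An arrow carries
    block [l] into block [l.+1], and paths of length [c] act as zero, so the list is layered. *)
Lemma pdim_finite_dim d : (forall y, pdim_le d (pmod y 1)) ->
  forall M : lmodType A, finite_dim M -> pdim_le d.+1 M.
Proof.
move=> pd M [m [b bM]].
pose block l := [seq pa x l *: b i | x <- enum (vert Q), i <- enum 'I_m].
pose layers := fix layers n l := if n is n'.+1 then block l ++ layers n' l.+1 else [::].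
have [c c0] := pa_vanish pi_adm src_out.
have blockP x l i : pa x l *: b i \in block l by apply: allpairs_f; rewrite mem_enum.
have lay n l : (n + l = c)%N -> layered (layers n l).
  elim: n l => //= n IHn l nl; apply: layered_cat; last by apply: IHn; lia.
  move=> w /allpairsP[[x i] /= [_ _ ->]]; exists (iter l succ x).
  rewrite !scalerA pa_0muln pa_comp addn1; split=> //.
  case: n nl {IHn} => [|n] nl /=; first by rewrite -nl add1n in c0; rewrite c0 scale0r.
  by apply: span_mem; rewrite mem_cat blockP.
have full : span (layers c 0) = setT.
  apply/seteqP; split=> // x _; have [k ->] := bM x.
  have HU := span_submodule (layers c 0).
  apply: submodule_sum => // i; apply: submoduleZ => //.
  rewrite -[b i]scale1r -(sum_pa0 pi src_out) scaler_suml; apply: submodule_sum => // y.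
  case: c c0 {lay HU} => [|c] c0 /=; first by rewrite c0 scale0r.
  by apply: span_mem; rewrite mem_cat blockP.
apply: pdim_le_iso (pdim_layered pd (lay c 0 (addn0 c))).
exists \val; apply: bijective_inj_surj; first exact: val_inj.
move=> x; apply: (@submod_type_ex _ _ _ _ (span_submodule (layers c 0))).
by rewrite full.
Qed.

End GlobalDimension.

(** * Classification of the simple modules *)

Section AlgebraScalars.
Variables (K : fieldType) (A : falgType K) (M : lmodType A).
Implicit Types (k : K) (a : A) (x : M).

Lemma scaler_algC k a x : a *: (k%:A *: x) = k%:A *: (a *: x).
Proof. by rewrite !scalerA -scalerAr mulr1 -scalerAl mul1r. Qed.

Lemma scaler_algM k l x : (k * l)%:A *: x = k%:A *: (l%:A *: x).
Proof. by rewrite (scalerA k%:A) -scalerAl mul1r (scalerA k). Qed.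

Lemma scaler_algK k x : k != 0 -> k^-1%:A *: (k%:A *: x) = x.
Proof. by move=> k0; rewrite -scaler_algM mulVf // scale1r scale1r. Qed.

End AlgebraScalars.

Section SimpleModules.
Variables (K : fieldType) (Q : quiver) (A : falgType K).
Variable pi : {lrmorphism path_algebra K Q -> A}.
Hypotheses (pi_surj : surjective pi) (pi_adm : admissible (ker pi)).
Variable out : vert Q -> arrow Q.
Hypothesis src_out : forall x, src (out x) = x.
Hypothesis out_src : forall a, out (src a) = a.
Local Notation succ := (succ_of out).
Local Notation pa := (pa pi src_out).
Local Notation plen := (plen pi_adm src_out).
Local Notation simple_at := (simple_at pi_surj pi_adm).

Lemma pa_cases (P : A -> Prop) :
  P 0 -> (forall a b, P a -> P b -> P (a + b)) -> (forall (c : K) a, P a -> P (c%:A * a)) ->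
  (forall x l, P (pa x l)) -> forall a, P a.
Proof.
move=> P0 PD PZ Pp a; have [f <-] := pi_surj a.
elim/pa_ind: f => [|u v Pu Pv|c u Pu|p]; first by rewrite rmorph0.
- by rewrite rmorphD; apply: PD.
- by rewrite linearZ /= -[pi u]mul1r scalerAl; apply: PZ.
by rewrite (qpath_cpath src_out out_src p); apply: Pp.
Qed.

(** The vectors killed by all arrows form a submodule. Were it zero, a nonzero vector could be moved
    by nonzero paths of every length, against [pa_vanish]. *)
Lemma simple_rad (S : lmodType A) (s : S) x : simple S -> pa x 1 *: s = 0.
Proof.
move=> [_ sS]; pose U : set S := [set s | forall x, pa x 1 *: s = 0].
have HU : submodule U.
  split=> [y|a u v Uu Uv y]; first by rewrite scaler0.
  rewrite scalerDr Uv addr0; move: a y.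
  apply: pa_cases => [y|a b Ha Hb y|c a Ha y|z l y].
  - by rewrite scale0r scaler0.
  - by rewrite scalerDl scalerDr Ha Hb addr0.
  - rewrite scalerA mulrA -scalerAr mulr1 -scalerAl -[pa y 1 * a]mul1r scalerAl.
    by rewrite -!scalerA Ha scaler0.
  rewrite scalerA paM; case: eqP => _; last by rewrite !scale0r.
  rewrite scale1r addn1 -(pa_comp pi src_out z 1 l) -scalerA.
  by rewrite Uu scaler0.
case: (sS U HU) => [U0|UT]; last by have : U s by rewrite UT.
suff deep l : s != 0 -> exists y, pa y l *: s != 0.
  have [->|s0] := eqVneq s 0; first by rewrite scaler0.
  have [c c0] := pa_vanish pi_adm src_out.
  by have [y] := deep c s0; rewrite c0 scale0r eqxx.
move=> s0; elim: l => [|l [y ys]].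
  apply: contrapT => nex; case/eqP: s0; rewrite -[s]scale1r -(sum_pa0 pi src_out) scaler_suml.
  by rewrite big1 // => y _; apply/eqP/negPn/negP => ys; apply: nex; exists y.
have [z zs] : exists z, pa z 1 *: (pa y l *: s) != 0.
  apply: contrapT => nex; case/eqP: ys; have : U (pa y l *: s).
    by move=> z; apply/eqP/negPn/negP => zs; apply: nex; exists z.
  by rewrite U0.
exists y; apply: contra zs => /eqP e; rewrite scalerA paM addn1.
by rewrite -[pa y _]mul1r scalerAl -scalerA e scaler0.
Qed.

Lemma simple_iso (S : lmodType A) : simple S -> exists x, isomorphic (simple_at x) S.
Proof.
move=> sS; have [[s s0] max] := sS.
have [x xs] : exists x, pa x 0 *: s != 0.
  apply: contrapT => nex; case/eqP: s0; rewrite -[s]scale1r -(sum_pa0 pi src_out) scaler_suml.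
  by rewrite big1 // => y _; apply/eqP/negPn/negP => ys; apply: nex; exists y.
exists x; set t := pa x 0 *: s in xs.
have tE a : pi a *: t = (a@_(ptriv x))%:A *: t.
  elim/pa_ind: a => [|u v Eu Ev|c u Eu|p].
  - by rewrite rmorph0 mcoeff0 !scale0r.
  - by rewrite rmorphD mcoeffD !scalerDl Eu Ev.
  - have -> : pi (c *: u) = c%:A * pi u by rewrite linearZ /= -scalerAl mul1r.
    rewrite pa_coeffZ -(scalerA c%:A (pi u) t) Eu (scalerA c%:A) -scalerAl mul1r.
    by rewrite (scalerA c).
  rewrite (qpath_cpath src_out out_src p) coeff_path_elt -/(pa _ _) /t scalerA paM add0n.
  rewrite qpath_eqE; set y := psrc p; case: (plength p) => [|l] /=.
    rewrite andbT; case: (y =P x) => [yx|_]; last by rewrite !scale0r.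
    by rewrite scale1r scale1r scale1r.
  rewrite andbF scale0r scale0r; case: (y =P x) => _; last by rewrite scale0r scale0r.
  by rewrite scale1r -(pa_comp pi src_out x 1 l) -scalerA simple_rad // scaler0.
have l : linear (fun v : simple_at x => ((v : 'cV[K]_1) 0 0)%:A *: t).
  move=> a u v; rewrite -[a](pi_liftK pi_surj) simple_at_scale sqmod_scaleK.
  rewrite [X in X%:A]mxE [X in (X + _)%:A]mxE !scalerDl; congr (_ + _).
  by rewrite scaler_algC tE scaler_algM scaler_algC.
exists (mklin l); apply: bijective_inj_surj.
  apply: injective_ker => v; rewrite mklinE => /eqP v0.
  apply/matrixP => i j; rewrite !ord1 [RHS]mxE.
  apply/eqP; apply: contraTT v0 => v0; apply: contra xs => /eqP e.
  by rewrite -[t](scaler_algK _ v0) e scaler0.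
case: (max _ (submodule_range (mklin l))) => [r0|rT u]; last first.
  have [v _ vE] : range (mklin l) u by rewrite rT.
  by exists v.
case/eqP: xs; have : range (mklin l) t.
  exists (const_mx 1 : 'cV[K]_1) => //; by rewrite mklinE mxE !scale1r.
by rewrite r0.
Qed.

Lemma isomorphic_simple (M N : lmodType A) : isomorphic M N -> simple M -> simple N.
Proof.
move=> /isomorphic_sym[f bf] [[x x0] max]; have [g fK gK] := bf; split.
  by exists (g x); apply: contra x0 => /eqP gx0; rewrite -(gK x) gx0 linear0.
move=> U HU.
have HV : submodule [set y | U (g y)].
  split=> [|a y z Uy Uz].
    by rewrite /= -(linear0 f) fK; case: HU.
  rewrite /= -(gK y) -(gK z) -linearP fK.
  by case: HU => _; apply.
case: (max _ HV) => V; [left|right]; apply/seteqP; split=> // u.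
- move=> Uu; have : [set y | U (g y)] (f u) by rewrite /= fK.
  by rewrite V => /= fu0; apply: (bij_inj bf); rewrite fu0 linear0.
- by move=> ->; case: HU.
- by move=> _; have : [set y | U (g y)] (f u); [rewrite V | rewrite /= fK].
Qed.

(** Turns the number of simple modules and [lambda1_is] into counts of vertices. *)
Lemma num_iso_classes_card (F : lmodType A -> Prop) m :
  (forall S, F S -> simple S) -> (forall S T, isomorphic S T -> F S -> F T) ->
  num_iso_classes F m -> m = #|[pred x | `[< F (simple_at x) >]]|.
Proof.
move=> Fs Fi [S [FS Sinj Sall]].
have [|y yS] := @choice _ _ (fun i x => isomorphic (simple_at x) (S i)).
  by move=> i; apply: simple_iso; apply: Fs.
have y_inj : injective y.
  move=> i j yij; apply: Sinj; apply: isomorphic_trans (yS j).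
  by rewrite -yij; apply: isomorphic_sym.
rewrite -[LHS]card_ord -(card_imset _ y_inj); apply: eq_card => x; rewrite [RHS]inE.
apply/imsetP/asboolP => [[i _ ->]|Fx]; first exact: Fi (isomorphic_sym (yS i)) (FS i).
have [i xi] := Sall _ Fx; exists i => //; apply: (simple_at_inj (pi_surj := pi_surj) (pi_adm := pi_adm)).
exact: isomorphic_trans xi (isomorphic_sym (yS i)).
Qed.

End SimpleModules.

(** * Iteration of a transitive map on a finite set *)

Section CycleIteration.
Variables (T : finType) (f : T -> T).
Hypothesis f_trans : forall x y, exists i, iter i f x = y.

Lemma cycle_inj : injective f.
Proof.
have f_surj y : exists x, f x = y.
  by have [i iE] := f_trans (f y) y; exists (iter i f y); rewrite -[RHS]iE -iterSr.
have [g gK] := choice f_surj.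
have [h hK fhK] : bijective g by apply: injF_bij; apply: can_inj gK.
by apply: (can_inj (g := g)) => x; rewrite -[x in LHS]fhK gK fhK.
Qed.

Lemma cycle_order x : order f x = #|T|.
Proof.
apply: eq_card => y; rewrite inE; have [i <-] := f_trans x y.
exact: fconnect_iter.
Qed.

Lemma iter_card x : iter #|T| f x = x.
Proof. by rewrite -(cycle_order x) iter_order //; apply: cycle_inj. Qed.

Lemma iter_modn i x : iter (i %% #|T|) f x = iter i f x.
Proof.
rewrite [in RHS](divn_eq i #|T|) addnC iterD; congr (iter _ f _).
by elim: (i %/ #|T|)%N => // k IHk; rewrite mulSn iterD -IHk iter_card.
Qed.

Lemma iter_inj i j x : (i < #|T|)%N -> (j < #|T|)%N -> iter i f x = iter j f x -> i = j.
Proof.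
rewrite -(cycle_order x) => ix jx e.
by rewrite -(findex_iter ix) -(findex_iter jx) e.
Qed.

Lemma iter_eq_mod i j x : iter i f x = iter j f x <-> i = j %[mod #|T|].
Proof.
split=> [e|e]; last by rewrite -(iter_modn i) -(iter_modn j) e.
have T0 : (0 < #|T|)%N by apply/card_gt0P; exists x.
by apply: (iter_inj (x := x)); rewrite ?ltn_mod // !iter_modn.
Qed.

Lemma iter_ex x y : exists2 i, (i < #|T|)%N & iter i f x = y.
Proof.
have [i iE] := f_trans x y; exists (i %% #|T|)%N; last by rewrite iter_modn.
by rewrite ltn_mod; apply/card_gt0P; exists x.
Qed.

End CycleIteration.

(** * Quasi-hereditary structures *)

Section QuasiHereditary.
Variables (K : fieldType) (Q : quiver) (A : falgType K).
Variable pi : {lrmorphism path_algebra K Q -> A}.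
Hypotheses (pi_surj : surjective pi) (pi_adm : admissible (ker pi)).
Variable out : vert Q -> arrow Q.
Hypothesis src_out : forall x, src (out x) = x.
Hypothesis out_src : forall a, out (src a) = a.
Local Notation succ := (succ_of out).
Local Notation pa := (pa pi src_out).
Local Notation plen := (plen pi_adm src_out).
Local Notation simple_at := (simple_at pi_surj pi_adm).
Local Notation pmod := (pmod pi src_out).

(** Since [e] kills the top factor, it moves each vector one step down the filtration; idempotency
    allows this to be repeated until zero. *)
Lemma filtered_by_kill (F : lmodType A -> Prop) (M : lmodType A) (W : set M) (e : A) :
  e * e = e -> (forall N, F N -> forall z : N, e *: z = 0) -> filtered_by F W ->
  forall w, W w -> e *: w = 0.
Proof.
move=> ee F0 [s [s0 sW ssub sF]].
have s_gt0 : (0 < size s)%N.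
  case: s s0 {sW ssub sF} => //= e0; have : [set 0] (0 : M) by [].
  by rewrite -e0.
have kill i : (i < size s)%N -> forall w, nth set0 s i w -> e *: w = 0.
  elim: i => [|i IHi] ilt w; first by rewrite nth0 s0 => ->; rewrite scaler0.
  have [N FN [UV [g [glin _ gker]]]] := sF i ilt.
  have Hi := ssub i (ltnW ilt); have Hi1 := ssub i.+1 ilt.
  move=> Vw; have U0 : nth set0 s i 0 by case: Hi.
  have g0 : g 0 = 0 by apply/(gker 0 (UV _ U0)).
  have : nth set0 s i (e *: w).
    apply/gker; first exact: submoduleZ.
    have := glin e w 0 Vw (UV _ U0); rewrite addr0 g0 addr0 => ->.
    exact: F0.
  by move=> /(IHi (ltnW ilt)); rewrite scalerA ee.
move=> w; rewrite -sW -nth_last; apply: kill.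
by rewrite prednK.
Qed.

Lemma simple_pa_kill (S : lmodType A) x y (s : S) :
  isomorphic (simple_at y) S -> x != y -> pa x 0 *: s = 0.
Proof.
case=> f [g fK gK] xy; rewrite -(gK s) -linearZZ simple_at_scale coeff_path_elt qpath_eqE.
by rewrite [psrc _ == _](negbTE xy) /= scale0r scale0r linear0.
Qed.

Lemma pmod0_socle y (u : pmod y 0) : u <> 0 ->
  exists w : A, w * pval u = pa y (plen y - 1).
Proof.
move=> u0; have [|w] := @pa_socle _ _ _ _ pi_surj pi_adm _ src_out out_src (pval u) y.
  rewrite pval_mul0; apply/eqP => e; apply: u0; apply: pval_inj.
  by rewrite e linear0.
by rewrite pval_mul0; exists w.
Qed.

Lemma pa_last_neq0 y : pa y (plen y - 1) <> 0.
Proof.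
by move/eqP; rewrite (pa_eq0 pi_adm); have := plen_ge2 pi_adm src_out y; lia.
Qed.

Lemma projective_cover_iso (P S : lmodType A) (p : {linear P -> S}) y :
  projective_cover p -> isomorphic (simple_at y) S -> isomorphic (pmod y 0) P.
Proof.
case=> Pp ps pmin [f bf].
have [i [c [_ cs _]]] := simple_at_cover pi_surj pi_adm src_out out_src y.
have cs' : surjective (f \o c : {linear pmod y 0 -> S}).
  by move=> s; have [g _ gK] := bf; have [u uE] := cs (g s); exists u; rewrite /= uE gK.
have [h hE] := @projective_pmod0 _ _ _ pi _ src_out y _ _ p (f \o c : {linear pmod y 0 -> S}) ps.
have hs : surjective h.
  have rT : range h = setT.
    apply: pmin => [|z]; first exact: submodule_range.
    have [u uE] := cs' (p z); exists (h u), (z - h u); split; first by exists u.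
      by rewrite /ker /= linearB hE uE subrr.
    by rewrite addrC subrK.
  by move=> x; have [u _ uE] : range h x by [rewrite rT]; exists u.
exists h; apply: bijective_inj_surj => //; apply: injective_ker => u hu.
apply: contrapT => u0; have [w wE] := pmod0_socle u0.
have [s sK] := projective_section Pp hs.
have [o o0] : exists o : P, o <> 0.
  have [v v0] := simple_at_one pi_surj pi_adm y; have [o oE] := ps (f v); exists o => o0.
  by case/eqP: v0; apply: (bij_inj bf); rewrite -oE o0 !linear0.
have so0 : s o <> 0 by move=> so; apply: o0; rewrite -(sK o) so linear0.
have [w' w'E] := pmod0_socle so0.
have e : w' *: s o = w *: u by apply: pval_inj; rewrite !pvalZ w'E wE.
have : pval (w' *: s o) = 0.
  have : h (w' *: s o) = 0 by rewrite e linearZZ hu scaler0.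
  by rewrite -linearZZ sK => ->; rewrite !linear0.
by rewrite pvalZ w'E; apply: pa_last_neq0.
Qed.

Lemma fin_maximal (disp : Order.disp_t) (X : finPOrderType disp) (x0 : X) :
  exists x : X, forall y, ~~ (x < y)%O.
Proof.
pose F (x : X) := #|[pred z | (z <= x)%O]|.
case: (@arg_maxnP _ x0 xpredT F isT) => x _ xmax; exists x => y.
apply/negP => xy; have : (F y <= F x)%N := xmax y isT; rewrite leqNgt => /negP; apply.
apply/proper_card/fintype.properP; split.
  by apply/fintype.subsetP => z; rewrite !inE => /Order.POrderTheory.le_trans -> //; apply: Order.POrderTheory.ltW.
exists y; rewrite !inE ?Order.POrderTheory.lexx //.
by apply/negP => yx; have := Order.POrderTheory.lt_le_trans xy yx; rewrite Order.POrderTheory.ltxx.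
Qed.

(* [x] is a maximal element of the poset, so Delta(x) = P_x.  A filtration of P_y
   in which e_x acts nontrivially must have Delta(x) as a factor, and the
   projection onto this factor splits. *)
Lemma quasi_hereditary_top : quasi_hereditary A -> exists x,
  (forall l, (0 < l)%N -> iter l succ x = x -> pa x l = 0) /\
  (forall y, y != x -> (exists u : pmod y 0, pa x 0 *: u <> 0) ->
     exists phi : {linear pmod x 0 -> pmod y 0}, injective phi).
Proof.
case=> disp [X [S [P [D [p [q [s [[Ss Sinj Sall] Pc qs sD qD]]]]]]]].
have [|w wS] := @choice _ _ (fun t x => isomorphic (simple_at x) (S t)).
  by move=> t; apply: (simple_iso pi_surj pi_adm src_out out_src).
have w_inj t u : w t = w u -> t = u.
  move=> wtu; apply: Sinj; apply: isomorphic_trans (wS u); rewrite -wtu.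
  exact: isomorphic_sym.
have w_surj y : exists t, w t = y.
  have [t tS] := Sall _ (simple_at_simple pi_surj pi_adm y); exists t.
  apply: (simple_at_inj (pi_surj := pi_surj) (pi_adm := pi_adm)).
  exact: isomorphic_trans (wS t) (isomorphic_sym tS).
have Piso t : isomorphic (pmod (w t) 0) (P t) := projective_cover_iso (Pc t) (wS t).
have [v0 _] := card_gt0P (vert_gt0 Q); have [t0 _] := w_surj v0.
have [x xmax] := fin_maximal t0.
pose e := pa (w x) 0; have ee : e * e = e by rewrite /e pa_muln0.
have killS t (z : S t) : t <> x -> e *: z = 0.
  move=> tx; apply: simple_pa_kill (wS t) _; apply/eqP => wxt.
  by apply: tx; apply: w_inj.
have killK t : forall z, ker (s t) z -> e *: z = 0.
  apply: filtered_by_kill (sD t) => // N [y yt [f [g fK gK]]] z.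
  apply: (can_inj fK); rewrite linearZZ linear0 killS //.
  by move=> yx; move: (xmax t); rewrite -yx yt.
have killD t (z : D t) : t <> x -> e *: z = 0.
  move=> tx; rewrite -ee -scalerA; apply: killK.
  by rewrite /ker /= linearZZ killS.
(* Nothing lies above the maximal [x], so the filtration of the kernel has no factors.
   [filtered_by_kill] with the idempotent 1 then shows that the kernel is zero. *)
have qx_inj : injective (q x).
  apply: injective_ker => z qz; rewrite -[z]scale1r.
  apply: (@filtered_by_kill _ _ _ 1 _ _ (qD x) z qz); first by rewrite mulr1.
  by move=> N [t xt]; case/negP: (xmax t).
have Dx : isomorphic (pmod (w x) 0) (D x).
  apply: isomorphic_trans (Piso x) _; exists (q x); apply: bijective_inj_surj => //.
  by case: (qs x).
exists (w x); split.
  (* A path of positive length from the vertex to itself lies in the kernel of [s x], whose factors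
     are all killed by [e]. But [e] fixes this path, so it is zero. *)
  move=> l l0 wl; have [f bf] := Dx.
  have [g gE] := pmod_ex pi src_out (w x) 0 1; rewrite mul1r in gE.
  have kz : ker (s x) (f (pa (w x) l *: g)).
    rewrite /ker /= !linearZZ -(prednK l0) -add1n -pa_comp -scalerA.
    by rewrite (simple_rad pi_surj pi_adm src_out out_src) ?scaler0.
  have := killK _ _ kz; rewrite -linearZZ -(linear0 f) => /(bij_inj bf).
  rewrite scalerA /e paM wl eqxx scale1r addn0 => /(congr1 pval).
  by rewrite pvalZ gE linear0 pa_muln0.
move=> y yx [u eu]; have [t wt] := w_surj y; rewrite -wt in u eu *.
have tx : t <> x by move=> tx; case/eqP: yx; rewrite -wt tx.
have [h [h' hK h'K]] := Piso t.
(* Every factor other than [D x] is killed by [e]. Without a factor [D x], [e] would therefore kill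
   first [ker (q t)] and then all of [P t], contrary to [eu]. *)
have [U [V [HV [N [xN UV]]]]] : exists (U V : set (P t)), submodule V /\
    exists N : lmodType A, isomorphic N (D x) /\ subquotient_iso U V N /\ U 0.
  apply: contrapT => nex.
  have kq : forall z, ker (q t) z -> e *: z = 0.
    have [fs [fs0 fsW fssub fsF]] := qD t.
    apply: (@filtered_by_kill (fun N => exists2 u, u <> x & isomorphic N (D u)) _ _ e ee).
      move=> N [v vx [f bf]] z; apply: (bij_inj bf).
      by rewrite linearZZ linear0 killD.
    exists fs; split=> // i ilt; have [N [v tv Nv] UV] := fsF i ilt.
    exists N => //; exists v => // vx; apply: nex.
    exists (nth set0 fs i), (nth set0 fs i.+1); split; first exact: fssub.
    exists N; rewrite -vx; split=> //; split=> //.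
    by have [] := fssub i (ltnW ilt).
  apply: eu; apply: (can_inj hK); rewrite linear0 linearZZ -/e -ee -scalerA.
  by apply: kq; rewrite /ker /= linearZZ killD.
have [[sUV [g [glin gsurj gker]]] U0] := UV.
have [th [th' thK th'K]] := isomorphic_trans Dx (isomorphic_sym xN).
have [gen genE] := pmod_ex pi src_out (w x) 0 1; rewrite mul1r in genE.
(* [v] lifts a generator of the factor. The map sending [u] to [u v] becomes an isomorphism after
   composition with the projection [g], hence is injective. *)
have [v Vv gv] := gsurj (th gen).
have g0 : g 0 = 0 by apply/gker => //; apply: sUV.
have l : linear (fun u : pmod (w x) 0 => (pval u : A) *: v).
  by move=> a z z'; rewrite linearD pvalZ scalerDl scalerA.
have [h'' [h''' hhK hhK']] := isomorphic_sym (Piso t).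
exists (h'' \o mklin l : {linear pmod (w x) 0 -> pmod (w t) 0}).
apply: injective_ker => z /=; rewrite -[X in _ = X](linear0 h'') => /(can_inj hhK) zv.
have : g (pval z *: v + 0) = 0 by rewrite addr0 (zv : (pval z : A) *: v = 0).
rewrite glin // ?g0 ?addr0 ?gv; last exact: sUV.
rewrite -linearZZ -(linear0 th) => /(can_inj thK) => zg.
by apply: pval_inj; rewrite -pval_mul0 -genE -pvalZ zg.
Qed.

End QuasiHereditary.

(** * The universal cover of the cycle *)

Section Cover.
Variables (K : fieldType) (Q : quiver) (A : falgType K).
Variable pi : {lrmorphism path_algebra K Q -> A}.
Hypotheses (pi_surj : surjective pi) (pi_adm : admissible (ker pi)).
Variable out : vert Q -> arrow Q.
Hypothesis src_out : forall x, src (out x) = x.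
Hypothesis out_src : forall a, out (src a) = a.
Local Notation succ := (succ_of out).
Hypothesis succ_trans : forall x y, exists i, iter i succ x = y.
Local Notation pa := (pa pi src_out).
Local Notation plen := (plen pi_adm src_out).
Local Notation simple_at := (simple_at pi_surj pi_adm).
Local Notation pmod := (pmod pi src_out).
Local Notation N := #|vert Q|.

Lemma plen_iter l x : (plen x <= l + plen (iter l succ x))%N.
Proof.
elim: l x => //= l IHl x; apply: leq_trans (plen_succ pi_adm src_out x) _.
by rewrite addSn ltnS -iterS iterSr.
Qed.

(* No minimal relation runs strictly through the vertex [x]. *)
Lemma quasi_hereditary_cut : quasi_hereditary A -> exists x, (plen x <= N)%N /\
  forall y m, (0 < m < N)%N -> iter m succ y = x -> (m < plen y)%N -> plen y = (m + plen x)%N.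
Proof.
case/(quasi_hereditary_top pi_surj pi_adm src_out out_src) => x [loop top]; exists x.
have N0 : (0 < N)%N by apply: vert_gt0.
split=> [|y m /andP[m0 mN] ym my].
  by rewrite -pa_eq0; apply/eqP/loop => //; apply: iter_card.
have yx : y != x.
  apply/eqP => yx; have := iter_inj succ_trans (x := y) mN N0; rewrite ym yx => /(_ erefl).
  by move=> m0'; rewrite m0' in m0.
have [|phi phi_inj] := top y yx.
  have [u uE] := pmod_ex pi src_out y 0 (pa y m); exists u => /(congr1 pval).
  rewrite pvalZ uE linear0 mulrA -ym pa_0muln pa_muln0 => /eqP.
  by rewrite (pa_eq0 pi_adm) leqNgt my.
have [g gE] := pmod_ex pi src_out x 0 1; rewrite mul1r in gE.
set c := plen x.
(* By injectivity of [phi], the longest nonzero path from [x] does not kill [phi g], a combination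
   of paths from [y] to [x]. These all have length at least [m], so [plen y < m + c] would make
   every product vanish. *)
have gc : pa x (c - 1) *: phi g <> 0.
  rewrite -linearZZ -(linear0 phi) => /phi_inj /(congr1 pval).
  by rewrite pvalZ gE linear0 pa_muln0; apply: pa_last_neq0.
have gx : pa x 0 *: phi g = phi g.
  by rewrite -linearZZ; congr (phi _); apply: pval_inj; rewrite pvalZ gE pa_muln0.
apply/eqP; rewrite eqn_leq; apply/andP; split; first by rewrite /c -ym plen_iter.
rewrite leqNgt; apply/negP => ylt; apply: gc; apply: pval_inj; rewrite linear0 pvalZ.
have [k] := pa_decomp pi_surj pi_adm src_out out_src (pval (phi g)) y.
rewrite pval_mul0 => ->; rewrite mulr_sumr big1 // => l _.
rewrite -scalerAl mul1r -scalerAr paM; case: (x =P iter l succ y) => [xl|]; last first.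
  by rewrite scale0r scaler0.
rewrite scale1r (eqP (_ : pa y _ == 0)) ?scaler0 // (pa_eq0 pi_adm).
(* As [m] is smaller than the period, it is the least length of a path from [y] to [x]. *)
have ml : (m <= l)%N.
  rewrite leqNgt; apply/negP => lm.
  have := @iter_inj _ _ succ_trans l m y (ltn_trans lm mN) mN.
  by rewrite ym -xl => /(_ erefl) e; rewrite e ltnn in lm.
have := plen_ge2 pi_adm src_out x; rewrite -/c; lia.
Qed.

Variable x0 : vert Q.
(* The universal cover of the cycle, unrolled from [x0]. *)
Definition cov i := iter i succ x0.
(** The function e of the overview. *)
Definition cov_end i := (i + plen (cov i))%N.

Lemma covD i j : cov (i + j) = iter j succ (cov i).
Proof. by rewrite /cov addnC iterD. Qed.

Lemma cov_end_mono i : (cov_end i <= cov_end i.+1)%N.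
Proof.
by rewrite /cov_end addSnnS leq_add2l; apply: (plen_iter 1).
Qed.

Lemma cov_end_gt i : (i.+1 < cov_end i)%N.
Proof. by rewrite /cov_end; have := plen_ge2 pi_adm src_out (cov i); lia. Qed.

Lemma covN i : cov (i + N) = cov i.
Proof. by rewrite covD iter_card. Qed.

Lemma cov_endN i : cov_end (i + N) = (cov_end i + N)%N.
Proof. by rewrite /cov_end covN; lia. Qed.

(** [pmod (cov i) (j - i)] is the interval [j, e(i)), which is [syz 1, syz 2), so its d-th syzygy is
    [syz d.+1, syz d.+2). The alternatives say that this syzygy is zero, or that the next one is and
    hence it is projective. *)
Lemma pdim_interval d i j : (i <= j)%N -> (j <= cov_end i)%N ->
  pdim_le d (pmod (cov i) (j - i)) <->
  (syz cov_end i j d.+2 <= syz cov_end i j d.+1)%N \/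
  (syz cov_end i j d.+3 <= syz cov_end i j d.+2)%N.
Proof.
elim: d i j => [|d IHd] i j ij ji.
  refine (iff_trans (projective_pmod pi_surj pi_adm src_out out_src _ _) _).
  rewrite -covD subnKC // /= /cov_end.
  by split=> -[]; [left|right|left|right]; lia.
refine (iff_trans (pdim_pmodS pi_surj pi_adm src_out out_src _ _ _) _).
rewrite -covD subnKC //.
have -> : (plen (cov i) - (j - i) = cov_end i - j)%N by rewrite /cov_end; lia.
by apply: IHd => //; apply: (jump_mono cov_end_mono).
Qed.

Lemma pdim_simple_cov d y : pdim_le d.+1 (simple_at (cov y)) <->
  (syz cov_end y y.+1 d.+2 <= syz cov_end y y.+1 d.+1)%N \/
  (syz cov_end y y.+1 d.+3 <= syz cov_end y y.+1 d.+2)%N.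
Proof.
refine (iff_trans (pdim_simple_at pi_surj pi_adm src_out out_src _ _) _).
by rewrite -(subSnn y); apply: pdim_interval; rewrite ?(ltnW (cov_end_gt y)).
Qed.

(** The socle path of [A e_x] has positive length and so maps to zero in the simple module, yet it
    would lie in the image of a section of the cover. This excludes dimension 0 in
    [proj_dim_simple_at]. *)
Lemma simple_at_not_projective x : ~ projective (simple_at x).
Proof.
have [i [h e]] := simple_at_cover pi_surj pi_adm src_out out_src x.
move=> Sp; have [_ hs _] := e; have [s sK] := projective_section Sp hs.
have [o o0] := simple_at_one pi_surj pi_adm x.
have so0 : s o <> 0 by move=> so; move: o0; rewrite -(sK o) so linear0 eqxx.
have [w wE] := pmod0_socle pi_surj pi_adm out_src so0.
have c2 := plen_ge2 pi_adm src_out x.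
have kill u : pa x (plen x - 1) *: (u : simple_at x) = 0.
  have -> : (plen x - 1 = 1 + (plen x - 2))%N by lia.
  rewrite -pa_comp -scalerA (simple_rad pi_surj pi_adm src_out out_src) ?scaler0 //.
  exact: simple_at_simple.
have [g gE] := pmod_ex pi src_out x 0 1; rewrite mul1r in gE.
have wso : w *: s o = pa x (plen x - 1) *: g.
  by apply: pval_inj; rewrite !pvalZ wE gE pa_muln0.
have wo : w *: o = 0 by rewrite -(sK o) -linearZZ wso linearZZ kill.
apply: (@pa_last_neq0 _ _ _ pi pi_adm _ src_out x).
by rewrite -wE -pvalZ -linearZZ wo !linear0.
Qed.

Lemma proj_dim_simple_at x : proj_dim_is (simple_at x) 1 <-> (plen (succ x)).+1 = plen x.
Proof.
refine (iff_trans (proj_dim_is1 (@simple_at_not_projective x)) _).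
refine (iff_trans (pdim_simple_at pi_surj pi_adm src_out out_src _ _) _).
refine (iff_trans (projective_pmod pi_surj pi_adm src_out out_src _ _) _) => /=.
have := plen_succ pi_adm src_out x; have := plen_ge2 pi_adm src_out x.
by split; lia.
Qed.

(** Projective dimension 1 at [x] means that [plen] drops by one after [x], that is, [cov_end] does
    not grow there. So the simple modules counted by [lambda1_is] are the jumps within one
    period. *)
Lemma lambda1_jumps r : lambda1_is A r -> jumps cov_end N = r.
Proof.
move/(num_iso_classes_card pi_surj pi_adm src_out out_src) => -> //; last first.
- move=> S T ST [sS dS]; split; first exact: isomorphic_simple ST sS.
  move=> dT; apply: dS; move: dT.
  have pd d : proj_dim_le S d <-> proj_dim_le T d.
    rewrite !pdim_le_proj_dim_le; split; apply: pdim_le_iso => //.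
    exact: isomorphic_sym.
  by case=> /pd ? dmin; split=> // d' /pd; apply: dmin.
- by move=> S [].
have cov_inj : injective (fun i : 'I_N => cov i).
  by move=> i j /(iter_inj succ_trans (ltn_ord i) (ltn_ord j)) e; apply: val_inj.
have cov_bij : bijective (fun i : 'I_N => cov i).
  by apply: inj_card_bij => //; rewrite card_ord.
rewrite -[RHS]sum1_card [RHS](reindex _ (onW_bij _ cov_bij)) /= /jumps.
rewrite [RHS]big_mkcond /=; apply: eq_bigr => i _.
have -> : (cov i \in [pred x | `[< simple (simple_at x) /\ ~ proj_dim_is (simple_at x) 1 >]])
    = (plen (cov i) < (plen (succ (cov i))).+1)%N.
  rewrite inE; apply/asboolP/idP => [[_ /proj_dim_simple_at nd]|lt].
    by rewrite ltnNge; apply/negP => le; apply: nd; have := plen_succ pi_adm src_out (cov i); lia.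
  by split; [exact: simple_at_simple | move/proj_dim_simple_at; lia].
by rewrite /cov_end addSnnS ltn_add2l; case: ltnP.
Qed.

Lemma num_simples_card n : num_simples_is A n -> n = N.
Proof.
move/(num_iso_classes_card pi_surj pi_adm src_out out_src) => -> //.
  by apply: eq_card => x; rewrite inE; apply/asboolP; apply: simple_at_simple.
by move=> S T; apply: isomorphic_simple.
Qed.

End Cover.

(** * Relations and chains *)

Section PathIdeals.
Variables (K : fieldType) (Q : quiver) (A : falgType K).
Variable pi : {lrmorphism path_algebra K Q -> A}.
Hypotheses (pi_surj : surjective pi) (pi_adm : admissible (ker pi)).
Variable out : vert Q -> arrow Q.
Hypothesis src_out : forall x, src (out x) = x.
Hypothesis out_src : forall a, out (src a) = a.
Local Notation succ := (succ_of out).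
Local Notation plen := (plen pi_adm src_out).
Local Notation KQ := (path_algebra K Q).

Definition subpath (q p : qpath Q) : Prop :=
  exists o, psrc q = iter o succ (psrc p) /\ (o + plength q <= plength p)%N.

Lemma coeffM_ex (f g : KQ) p : (f * g)@_p != 0 -> exists p1 p2,
  [/\ f@_p1 != 0, g@_p2 != 0 & Defs.pcomp p1 p2 = Some p].
Proof.
move=> fg; apply: contrapT => nex; case/eqP: fg.
rewrite -[f * g]/(pa_mul f g) pa_mulE raddf_sum /= big1 // => p1 _.
rewrite raddf_sum /= big1 // => p2 _; rewrite pa_coeffZ path_mulE.
case: eqP => [e|_]; last by rewrite mulr0.
rewrite mulr1; apply/eqP; rewrite mulf_eq0 -[X in X || _]negbK -[X in _ || X]negbK -negb_and.
by apply/negP => /andP[f1 g2]; apply: nex; exists p1, p2.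
Qed.

Lemma pcomp_length (p1 p2 p : qpath Q) : Defs.pcomp p1 p2 = Some p ->
  [/\ psrc p = psrc p2, plength p = (plength p2 + plength p1)%N &
      psrc p1 = iter (plength p2) succ (psrc p2)].
Proof.
rewrite {1}(qpath_cpath src_out out_src p1) {1}(qpath_cpath src_out out_src p2) pcomp_cpath.
by case: eqP => // e [<-]; rewrite plength_cpath.
Qed.

(** A path in the support of a product is a composite of paths in the two supports. So the elements
    whose support consists of paths through [T] form a two-sided ideal, as for monomial ideals. *)
Lemma path_idealE (T : set (qpath Q)) (f : KQ) : (path_ideal T : set KQ) f <->
  forall p, f@_p != 0 -> exists2 q, T q & subpath q p.
Proof.
split.
  apply: (@smallest_sub _ (@two_sided_ideal KQ) _
    [set f | forall p, f@_p != 0 -> exists2 q, T q & subpath q p]).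
    split=> [p|u v hu hv p|u v hv p|u v hu p].
    - by rewrite mcoeff0 eqxx.
    - rewrite mcoeffD => uv; have [u0|] := eqVneq u@_p 0; last exact: hu.
      by apply: hv; move: uv; rewrite u0 add0r.
    - move=> /coeffM_ex[p1 [p2 [_ v2 /pcomp_length[sp lp sp1]]]].
      have [q Tq [o [qo le]]] := hv _ v2; exists q => //; exists o; rewrite sp; split=> //.
      by rewrite lp; apply: leq_trans le _; apply: leq_addr.
    - move=> /coeffM_ex[p1 [p2 [u1 _ /pcomp_length[sp lp sp1]]]].
      have [q Tq [o [qo le]]] := hu _ u1; exists q => //; exists (o + plength p2)%N.
      by rewrite sp iterD -sp1 lp; split=> //; lia.
  move=> _ [q Tq <-] p; rewrite coeff_path_elt; case: (q =P p) => [<- _|]; last by rewrite eqxx.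
  by exists q => //; exists 0%N.
move=> fT; have [I0 ID IMl IMr] : two_sided_ideal (path_ideal T : set KQ).
  split=> [|u v hu hv|u v hv|u v hu] J HJ; have [[J0 JD Jl Jr] _] := HJ => //.
  - by apply: JD; [apply: hu HJ | apply: hv HJ].
  - by apply: Jl; apply: hv HJ.
  - by apply: Jr; apply: hu HJ.
rewrite [f]Defs.pa_expand; apply: big_ind => // p _.
have [->|fp] := eqVneq f@_p 0; first by rewrite scale0r.
rewrite -[path_elt p]mul1r scalerAl; apply: (IMl).
have [q Tq [o [qo le]]] := fT p fp.
have key x a b c : path_elt (cpath src_out x (a + (b + c))) =
    path_elt (cpath src_out (iter b succ (iter a succ x)) c)
    * path_elt (cpath src_out (iter a succ x) b) * path_elt (cpath src_out x a) :> KQ.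
  by rewrite path_eltM /path_mul pcomp_cpath eqxx /= path_eltM /path_mul pcomp_cpath eqxx.
have qE : q = cpath src_out (iter o succ (psrc p)) (plength q).
  by rewrite -qo; apply: qpath_cpath.
rewrite (qpath_cpath src_out out_src p).
rewrite (_ : plength p = o + (plength q + (plength p - (o + plength q))))%N; last lia.
rewrite key -qE.
have Iq : (path_ideal T : set KQ) (path_elt q) by apply: sub_gen_smallest; exists q.
by apply: IMr; apply: IMl.
Qed.

(** Nonzero paths from one vertex are independent in [A] ([pa_indep]), so [ker pi] is spanned by the
    paths it contains. *)
Lemma ker_piE (f : KQ) : ker pi f <-> forall p, f@_p != 0 -> (plen (psrc p) <= plength p)%N.
Proof.
split=> [f0 p|fp].
  rewrite (qpath_cpath src_out out_src p) plength_cpath => fp.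
  rewrite leqNgt; apply: contra fp => lp; apply/eqP.
  apply: (pa_indep (pi_adm := pi_adm) (src_out := src_out) (k := fun l => f@_(cpath src_out (psrc p) l))) lp.
  by rewrite -(pi_decomp pi_adm src_out out_src) f0 mul0r.
rewrite /ker /= [f]Defs.pa_expand raddf_sum big1 // => p _.
have [->|/fp le] := eqVneq f@_p 0; first by rewrite scale0r raddf0.
rewrite /= linearZ /= (_ : pi (path_elt p) = 0) ?scaler0 //.
by rewrite (qpath_cpath src_out out_src p); apply/eqP; rewrite -/(pa pi _ _ _) (pa_eq0 pi_adm).
Qed.

Lemma path_ideal_ker (T : set (qpath Q)) : (path_ideal T : set KQ) = ker pi <->
  forall p, (plen (psrc p) <= plength p)%N <-> exists2 q, T q & subpath q p.
Proof.
split=> [TI p|H].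
  have one : (path_elt p : KQ)@_p != 0 by rewrite coeff_path_elt eqxx oner_eq0.
  have self (P : qpath Q -> Prop) : P p -> forall p', (path_elt p : KQ)@_p' != 0 -> P p'.
    by move=> Pp p'; rewrite coeff_path_elt; case: (p =P p') => [<-|]; rewrite ?eqxx.
  split=> [le|ex].
    have /path_idealE Tp : (path_ideal T : set KQ) (path_elt p).
      by rewrite TI; apply/ker_piE; apply: (self (fun p' => plen (psrc p') <= plength p')%N).
    exact: Tp one.
  have /ker_piE kp : ker pi (path_elt p : KQ).
    by rewrite -TI; apply/path_idealE; apply: (self (fun p' => exists2 q, T q & subpath q p')).
  exact: kp one.
apply/seteqP; split=> f.
  by move/path_idealE => fT; apply/ker_piE => p /fT /H.
by move/ker_piE => fT; apply/path_idealE => p /fT /H.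
Qed.

(** The zero paths that become nonzero when an end arrow is removed: for the last arrow by
    minimality of [plen], for the first by the inequality. On the cover, the inequality reads e(i) <
    e(i+1). *)
Definition minimal_relations : set (qpath Q) :=
  [set p | plength p = plen (psrc p) /\ (plen (psrc p) <= plen (succ (psrc p)))%N].

(** Where the inequality fails, [plen] drops by exactly one and the end of the shortest zero path
    stays put. Moving the start forward must stop, since [plen] remains at least 2. *)
Lemma minimal_relation_ex x : exists o, (o + plen (iter o succ x) = plen x)%N /\
  (plen (iter o succ x) <= plen (iter o.+1 succ x))%N.
Proof.
elim: {x}(plen x) {-2}x (erefl (plen x)) => [|c IHc] x xc.
  by have := plen_ge2 pi_adm src_out x; rewrite xc.
have [le|lt] := leqP (plen x) (plen (succ x)); first by exists 0%N.
have := plen_succ pi_adm src_out x => le.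
have [|o [oE ole]] := IHc (succ x); first lia.
by exists o.+1; rewrite !iterSr in ole *; split=> //; lia.
Qed.

Lemma irredundant_minimal_relations :
  irredundant_path_relations (ker pi : set KQ) minimal_relations.
Proof.
split.
  apply/path_ideal_ker => p; split=> [le|[q [lq _] [o [qo]]]]; last first.
    by rewrite lq => le; apply: leq_trans le; rewrite qo plen_iter.
  have [o [oE ole]] := minimal_relation_ex (psrc p).
  exists (cpath src_out (iter o succ (psrc p)) (plen (iter o succ (psrc p)))).
    by split; rewrite ?plength_cpath.
  by exists o; rewrite plength_cpath oE.
move=> T' sub /path_ideal_ker TI; apply/seteqP; split=> // p [lp sp].
(* A generator inside [p] that starts later would make [p] without its first arrow a zero path,
   against minimality. So [q] starts where [p] does, and equals it. *)
have [q T'q [o [qo le]]] : exists2 q, T' q & subpath q p by apply/TI; rewrite lp.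
have [lq sq] := sub _ T'q; case: o qo le => [|o] qo le.
  suff -> : p = q by [].
  rewrite (qpath_cpath src_out out_src p) (qpath_cpath src_out out_src q) -[psrc p]qo.
  by rewrite lp lq qo.
have := plen_iter pi_adm src_out o (succ (psrc p)).
by rewrite -iterSr -qo -lq; lia.
Qed.

End PathIdeals.

Section Chains.
Variables (K : fieldType) (Q : quiver) (A : falgType K).
Variable pi : {lrmorphism path_algebra K Q -> A}.
Hypotheses (pi_surj : surjective pi) (pi_adm : admissible (ker pi)).
Variable out : vert Q -> arrow Q.
Hypothesis src_out : forall x, src (out x) = x.
Hypothesis out_src : forall a, out (src a) = a.
Local Notation succ := (succ_of out).
Hypothesis succ_trans : forall x y, exists i, iter i succ x = y.
Local Notation plen := (plen pi_adm src_out).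
Local Notation simple_at := (simple_at pi_surj pi_adm).
Local Notation N := #|vert Q|.

Lemma global_dim_le_simples d :
  global_dim_le A d.+1 <-> forall x, pdim_le d.+1 (simple_at x).
Proof.
split=> [gd x|gd M Mfd].
  by apply/pdim_le_proj_dim_le/gd; apply: sqmod_finite_dim.
apply/pdim_le_proj_dim_le; refine (pdim_finite_dim pi_surj pi_adm out_src _ Mfd) => x.
by have [+ _] := pdim_simple_at pi_surj pi_adm src_out out_src d x; apply.
Qed.

(** The cover is unrolled from the vertex of [quasi_hereditary_cut], which becomes both 0 and [N]. A
    nonzero path from [y] running past [N] meets that vertex after [N - y] steps. *)
Lemma cut_base : quasi_hereditary A -> exists x0,
  forall y, (y < N)%N -> (cov_end pi_adm src_out x0 y <= N)%N \/
    cov_end pi_adm src_out x0 y = cov_end pi_adm src_out x0 N.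
Proof.
move=> /(quasi_hereditary_cut pi_surj pi_adm src_out out_src succ_trans)[x [xN cut]].
exists x => -[|y] yN; first by left.
have [|lt] := leqP (cov_end pi_adm src_out x y.+1) N; [by left | right].
have -> : cov_end pi_adm src_out x N = (plen x + N)%N.
  exact: (cov_endN pi_adm src_out succ_trans x 0).
rewrite /cov_end (cut (cov out x y.+1) (N - y.+1)%N); [lia|lia| |].
  by rewrite -covD subnKC ?(ltnW yN) //; apply: (covN succ_trans x 0).
by move: lt; rewrite /cov_end; lia.
Qed.

Lemma cycle_labelling (y0 : vert Q) : oriented_cycle_labelling N
  (fun i => iter i.-1 succ y0) (fun i => out (iter i.-1 succ y0)).
Proof.
have N_gt0 : (0 < N)%N by apply: vert_gt0.
have ex1 x : exists! i, (1 <= i <= N)%N /\ iter i.-1 succ y0 = x.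
  have [i iN ix] := iter_ex succ_trans y0 x; exists i.+1; split=> // j [jN jx].
  by rewrite -(@iter_inj _ _ succ_trans j.-1 i y0) ?ix //; lia.
split=> // [a|i iN]; last first.
  split=> //; have [->|ni] := eqVneq i N; last by case: i iN {ni}.
  by rewrite -[LHS]/(iter N.-1.+1 succ y0) prednK // iter_card.
have [i [[iN ix] iu]] := ex1 (src a); exists i; split; first by rewrite ix out_src.
by move=> j [jN ja]; apply: iu; split=> //; rewrite -ja src_out.
Qed.

Section Base.
Variable x0 : vert Q.
Local Notation cov := (cov out x0).
Local Notation e := (cov_end pi_adm src_out x0).
Local Notation syz := (syz e).
Variable r : nat.
Hypothesis cut : forall y, (y < N)%N -> (e y <= N)%N \/ e y = e N.
Hypothesis jumpsN : jumps e N = r.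

Let N_gt0 : (0 < N)%N := vert_gt0 Q.
Let e_mono i : (e i <= e i.+1)%N := cov_end_mono pi_adm src_out x0 i.
Let e_gt i : (i < e i)%N := ltnW (cov_end_gt pi_adm src_out x0 i).

(** With no jump in a period [e] would be constant on it, but [e N = e 0 + N]. *)
Lemma jumps_gt0 : (0 < r)%N.
Proof.
rewrite lt0n; apply/eqP => r0; have := jumps_eq e_mono (leq0n N).
rewrite jumpsN r0 /jumps big_ord0 eqxx => /esym/eqP.
by rewrite (cov_endN pi_adm src_out succ_trans x0 0 : e N = (e 0 + N)%N); have := N_gt0; lia.
Qed.

Lemma cov_ex x : exists2 y, (y < N)%N & cov y = x.
Proof. exact: (iter_ex succ_trans x0 x). Qed.

Lemma global_dim_le_jumps : global_dim_le A r.+1.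
Proof.
apply/global_dim_le_simples => x; have [y yN <-] := cov_ex x.
have [t tr st] := syz_stops e_mono e_gt cut jumpsN yN.
apply: (@pdim_le_leq _ _ t.+1); first by rewrite ltnS.
by apply/(pdim_simple_cov pi_surj pi_adm src_out out_src); right; rewrite st.
Qed.

Lemma global_dim_is_jumps : global_dim_is A (r + 1) <-> exists2 y, (y < N)%N &
  ~ pdim_le r (simple_at (cov y)).
Proof.
have := jumps_gt0; have := global_dim_le_jumps; rewrite addn1; case: r => // r' gd _.
split=> [[_ dmin]|[y yN npd]].
  apply: contrapT => nex; have := dmin r'.+1; rewrite ltnn => H; suff : false by [].
  apply: H; apply/global_dim_le_simples => x; have [y yN <-] := cov_ex x.
  by apply: contrapT => npd; apply: nex; exists y.
split=> // d' gd'; rewrite ltnNge; apply/negP => d'r; apply: npd.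
apply: (pdim_le_leq d'r); apply/pdim_le_proj_dim_le/gd'.
exact: sqmod_finite_dim.
Qed.

Lemma chain_of_long_syzygy : (exists2 y, (y < N)%N & ~ pdim_le r (simple_at (cov y))) ->
  relations_form_chain N r (ker pi).
Proof.
case=> y yN npd.
have ne t : (t < r)%N -> syz y y.+1 t.+2 != syz y y.+1 t.+3.
  move=> tr; apply/eqP => st; apply: npd.
  apply: (@pdim_le_leq _ _ t.+1) => //.
  by apply/(pdim_simple_cov pi_surj pi_adm src_out out_src); right; rewrite st.
have [a [aP aS amono alt ale]] := long_syz_chain e_mono e_gt cut jumpsN yN ne.
have r0 := jumps_gt0.
have a1 i : (0 < i <= r)%N -> (a 1 <= a i)%N.
  by move=> ir; have [->//|i1] := eqVneq i 1%N; apply/ltnW/amono; lia.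
have e2 i : (a i + 2 <= e (a i))%N by have := cov_end_gt pi_adm src_out x0 (a i); lia.
pose y0 := cov (a 1%N).
(* Labels count from the start [a 1] of the first relation, which gets label 1. The i-th relation
   ends at the vertex [e (a i)], so its last arrow starts one step earlier; this cancels the shift
   by one and gives [e (a i) - a 1]. *)
pose k j := (if odd j then (a j.+1./2 - a 1).+1 else e (a j./2) - a 1)%N.
have kodd i : (0 < i)%N -> k (2 * i - 1)%N = (a i - a 1).+1%N.
  move=> i0; rewrite /k; have -> : (2 * i - 1 = i.-1.*2.+1)%N by lia.
  by rewrite /= odd_double /= doubleK prednK.
have keven i : k (2 * i)%N = (e (a i) - a 1)%N.
  by rewrite /k mul2n odd_double doubleK.
exists (fun i => iter i.-1 succ y0), (fun i => out (iter i.-1 succ y0)), k; split.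
- exact: cycle_labelling.
- rewrite [X in irredundant_path_relations _ X](_ : _ = minimal_relations pi_adm src_out).
    exact: irredundant_minimal_relations.
  have rel i : (0 < i <= r)%N -> forall p : qpath Q,
      psrc p = iter (k (2 * i - 1)%N).-1 succ y0 -> parrows p =
        [seq out (iter j.-1 succ y0) | j <- index_iota (k (2 * i - 1)%N) (k (2 * i)%N).+1]
      <-> plength p = plen (cov (a i)).
    move=> ir p sp; have [aN ea eN] := aP i ir; have ai := a1 i ir; have e2i := e2 i.
    have i0 : (0 < i)%N by lia.
    have lE : ((k (2 * i)).+1 = k (2 * i - 1) + plen (cov (a i)))%N.
      rewrite keven kodd //; rewrite /cov_end in e2i *; lia.
    rewrite lE; have <- := @parrows_labelling _ _ src_out (fun i => iter i.-1 succ y0)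
      (fun i => out (iter i.-1 succ y0)) (k (2 * i - 1)%N) (plen (cov (a i))); last 2 first.
    + by [].
    + by move=> j kj; rewrite -iterD; congr (iter _ _ _); rewrite kodd // in kj *; lia.
    split=> [pE|pl]; first by rewrite /plength pE; apply: plength_cpath.
    by rewrite {1}(qpath_cpath src_out out_src p) sp pl.
  have srcE i : (0 < i <= r)%N -> iter (k (2 * i - 1)%N).-1 succ y0 = cov (a i).
    move=> ir; have ai := a1 i ir; rewrite kodd; last lia.
    by rewrite /= /y0 -covD subnKC.
  apply/seteqP; split=> p.
    case=> i ir [sp /(rel i ir p sp) lp]; have [aN ea eN] := aP i ir.
    rewrite srcE // in sp; rewrite /minimal_relations /= sp lp; split=> //.
    by move: ea; rewrite /cov_end addSnnS ltn_add2l ltnS.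
  case=> lp sp; have [z zN zp] := cov_ex (psrc p).
  have [|i ir az] := aS z zN.
    by move: sp; rewrite -zp /cov_end addSnnS ltn_add2l ltnS.
  have sp' : psrc p = iter (k (2 * i - 1)%N).-1 succ y0 by rewrite srcE // az zp.
  exists i => //; split=> //; apply/(rel i ir p sp').
  by rewrite lp -zp az.
- split=> [j jr|i ir]; last first.
    have ir' : (0 < i)%N by lia.
    by rewrite keven kodd //; have := e2 i; have := a1 i ir; lia.
  have [i [ir jE]] : exists i, (0 < i <= r)%N /\ (j = 2 * i - 1 \/ j = 2 * i)%N.
    exists (j.+1./2); have := odd_double_half j.+1; case: (odd j.+1) => /= h; lia.
  case: jE => ->; first by rewrite kodd; [have [aN _ _] := aP i ir; lia | lia].
  by rewrite keven; have [aN _ eN] := aP i ir; have := a1 i ir; have := e2 i; lia.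
- by have := kodd 1%N isT; rewrite subnn.
split=> [i ir|i ir|i ir|i i0 ir].
- rewrite (_ : 2 * i + 1 = 2 * i.+1 - 1)%N; last lia.
  by rewrite !kodd //; [have := amono i i.+1; have := a1 i; lia | lia].
- rewrite (_ : 2 * i + 2 = 2 * i.+1)%N; last lia.
  have [|_ ei _] := aP i; first lia.
  have ii : (a i < a i.+1)%N by apply: amono; lia.
  have := jump_mono e_mono ii; have := a1 i; have := e2 i.
  by rewrite !keven; lia.
- rewrite (_ : 2 * i + 1 = 2 * i.+1 - 1)%N; last lia.
  by rewrite keven kodd //; have := alt i; have := a1 i.+1; lia.
rewrite (_ : 2 * i + 3 = 2 * i.+2 - 1)%N; last lia.
have ir2 : (i.+2 <= r)%N by lia.
by rewrite keven kodd //; have := ale i i0 ir2; have := a1 i.+2; lia.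
Qed.

End Base.
End Chains.

(** * Syzygies computed from a chain of relations *)

Section ChainJumps.
Variables (e A B : nat -> nat) (N r : nat).
Hypothesis e_mono : forall i, (e i <= e i.+1)%N.
Hypothesis e_gt : forall i, (i < e i)%N.
Hypothesis eN : forall i, e (i + N)%N = (e i + N)%N.
Hypothesis r_gt0 : (0 < r)%N.
Hypothesis AB : forall i, (0 < i <= r)%N -> (A i + 2 <= B i <= N)%N.
Hypothesis A1 : A 1%N = 0%N.
Hypothesis A_incr : forall i, (0 < i < r)%N -> (A i < A i.+1)%N.
Hypothesis B_incr : forall i, (0 < i < r)%N -> (B i < B i.+1)%N.
Hypothesis AB_overlap : forall i, (0 < i < r)%N -> (A i.+1 < B i)%N.
Hypothesis BA_apart : forall i, (0 < i)%N -> (i.+2 <= r)%N -> (B i <= A i.+2)%N.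
Hypothesis eP : forall y z, (y <= z)%N -> (e y <= z)%N <-> exists i w,
  [/\ (0 < i <= r)%N, (y <= A i + w * N)%N & (B i + w * N <= z)%N].

Lemma chain_incr (F : nat -> nat) : (forall i, (0 < i < r)%N -> (F i < F i.+1)%N) ->
  forall i j, (0 < i)%N -> (i <= j <= r)%N -> (F i <= F j)%N.
Proof.
move=> Fi i j i0 /andP[ij jr]; rewrite -(subnK ij) in jr *.
elim: (j - i)%N jr => //= k IHk kr; rewrite addSn.
by apply: (leq_trans (IHk _)); [lia | apply/ltnW/Fi; lia].
Qed.

(** By [eP], [e y] is the least end of a relation starting at or after [y]. The ends increase with
    the starts, so this is the relation with the first such start; translates by a period end beyond
    [N]. *)
Lemma chain_end i y : (0 < i <= r)%N -> (y <= A i)%N ->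
  (forall j, (0 < j < i)%N -> (A j < y)%N) -> e y = B i.
Proof.
move=> ir yA Ay; have ABi := AB ir; apply/eqP; rewrite eqn_leq; apply/andP; split.
  by apply/eP; [lia | exists i, 0%N; rewrite mul0n !addn0; split].
have [j [[|w] [jr]]] := (eP (ltnW (e_gt y))).1 (leqnn _); last by rewrite mulSn; lia.
rewrite mul0n !addn0 => yAj; apply: leq_trans.
apply: (chain_incr B_incr); first lia.
rewrite leqNgt; have := Ay j; lia.
Qed.

Lemma chain_end_first : e 0%N = B 1%N.
Proof. by apply: chain_end => // j; lia. Qed.

(** Past the last start in the period, the next relation is the first one translated by [N]. *)
Lemma chain_end_last y : (A r < y)%N -> (y <= N)%N -> e y = (B 1 + N)%N.
Proof.
move=> Ay yN; apply/eqP; rewrite eqn_leq; apply/andP; split.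
  by rewrite -chain_end_first -eN add0n; apply: jump_mono.
have [j [[|w] [jr]]] := (eP (ltnW (e_gt y))).1 (leqnn _).
  by rewrite mul0n addn0 => yA; have := chain_incr A_incr (i := j) (j := r); lia.
move=> _; apply: leq_trans; rewrite mulSn.
by have := chain_incr B_incr (i := 1%N) (j := j); lia.
Qed.

Lemma chain_cut y : (y < N)%N -> (e y <= N)%N \/ e y = e N.
Proof.
move=> yN; have Nr := AB (i := r); have [le|lt] := leqP y (A r); last first.
  by right; rewrite !chain_end_last //; lia.
by left; apply: (@leq_trans (B r)); [apply/eP; [lia | exists r, 0%N; split; lia] | lia].
Qed.

(** From [A 1 = 0] and [A 2 >= 1], the values of [e] at 0 and 1 are [B 1] and [B 2]. After that,
    [B t] lies after [A t.+1] by overlap and not after [A t.+2] by separation, so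
    [e (B t) = B t.+2]. *)
Lemma chain_syz t : (0 < t <= r)%N -> syz e 0 1 t.+1 = B t.
Proof.
elim/ltn_ind: t => -[|[|[|t]]] IH tr //; rewrite syzSS.
- exact: chain_end_first.
- rewrite /=; apply: chain_end => [//||j j2]; first by have := A_incr (i := 1%N); lia.
  have -> : j = 1%N by lia.
  by rewrite A1.
rewrite IH; [|lia|lia]; apply: chain_end => // [|j jt]; first by apply: BA_apart; lia.
apply: leq_ltn_trans (AB_overlap (i := t.+1) _); last lia.
by apply: chain_incr; [exact: A_incr | lia | lia].
Qed.

(** Since [A r < B r.-1], the term after [B r] is [B 1 + N], in the next period. For [r = 1] the
    preceding term is 1 instead of [B r.-1]. These strict inequalities negate both cases of
    [pdim_simple_cov]. *)
Lemma chain_syz_strict : (syz e 0 1 r < syz e 0 1 r.+1)%N /\ (syz e 0 1 r.+1 < syz e 0 1 r.+2)%N.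
Proof.
have ABr := AB (i := r); have AB1 := AB (i := 1%N).
rewrite syzSS (chain_syz (t := r)); last lia.
have [r1|r1] := eqVneq r 1%N.
  by rewrite r1 /= (chain_end_last (y := 1%N)) ?r1 ?A1; lia.
have -> : syz e 0 1 r = B r.-1 by rewrite -[r in LHS]prednK // chain_syz //; lia.
have := B_incr (i := r.-1); have := AB_overlap (i := r.-1); have := AB (i := r.-1).
rewrite prednK // => h1 h2 h3; split; first lia.
by rewrite chain_end_last; lia.
Qed.

End ChainJumps.

Section ChainConverse.
Variables (K : fieldType) (Q : quiver) (A : falgType K).
Variable pi : {lrmorphism path_algebra K Q -> A}.
Hypotheses (pi_surj : surjective pi) (pi_adm : admissible (ker pi)).
Variable out : vert Q -> arrow Q.
Hypothesis src_out : forall x, src (out x) = x.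
Hypothesis out_src : forall a, out (src a) = a.
Local Notation succ := (succ_of out).
Hypothesis succ_trans : forall x y, exists i, iter i succ x = y.
Local Notation simple_at := (simple_at pi_surj pi_adm).
Local Notation N := #|vert Q|.

(** Unrolling from the vertex labelled 1 makes the start of the first relation the point 0. The
    chain itself yields a cut there, so this base point can serve in [global_dim_is_jumps]. *)
Lemma long_syzygy_of_chain r : (0 < r)%N -> relations_form_chain N r (ker pi) ->
  exists x0, (forall y, (y < N)%N -> (cov_end pi_adm src_out x0 y <= N)%N \/
    cov_end pi_adm src_out x0 y = cov_end pi_adm src_out x0 N) /\
    ~ pdim_le r (simple_at (cov out x0 0)).
Proof.
move=> r0 [v [alpha [k [[vP aP av] [TI _] [kN klt] k1 [kodd keven kover kapart]]]]].
pose x0 := v 1%N; exists x0; set e := cov_end pi_adm src_out x0.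
have N0 : (0 < N)%N by apply: vert_gt0.
have alE i : (1 <= i <= N)%N -> alpha i = out (v i).
  by move=> iN; have [<- _] := av i iN; rewrite out_src.
have vE i : (i < N)%N -> v i.+1 = cov out x0 i.
  elim: i => // i IHi iN; have [|_] := av i.+1; first lia.
  rewrite alE ?ltn_eqF //; last lia.
  by rewrite IHi 1?ltnW // => <-.
(* Label [i.+1] is the point [i] of the cover, so a relation starts one below its first label. It
   ends one after the start of its last arrow, which is the point numbered by the last label. *)
pose a i := (k (2 * i - 1)).-1%N; pose b i := k (2 * i)%N.
have kE i : (0 < i <= r)%N -> k (2 * i - 1)%N = (a i).+1 /\ (a i + 2 <= b i <= N)%N.
  move=> ir; have := kN (2 * i - 1)%N; have := kN (2 * i)%N; have := klt i ir.
  by rewrite /a /b; lia.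
have len i : (0 < i <= r)%N ->
    cpath src_out (cov out x0 (a i)) (b i - a i) \in [set p | exists2 i, (1 <= i <= r)%N &
           psrc p = v (k (2 * i - 1)%N) /\
           parrows p = [seq alpha j | j <- index_iota (k (2 * i - 1)%N) (k (2 * i)%N).+1]].
  move=> ir; have [ka ab] := kE i ir; rewrite inE; exists i => //.
  rewrite ka vE; last lia.
  split=> //; rewrite -/(b i) (_ : (b i).+1 = (a i).+1 + (b i - a i))%N; last lia.
  rewrite -vE; last lia.
  apply: parrows_labelling => j jab; first by apply: alE; lia.
  rewrite -[j in LHS]prednK ?vE; [|lia|lia|lia].
  by rewrite -covD; congr (cov _ _ _); lia.
have lenE p i : (0 < i <= r)%N ->  psrc p = v (k (2 * i - 1)%N) ->
   parrows p = [seq alpha j | j <- index_iota (k (2 * i - 1)%N) (k (2 * i)%N).+1] ->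
   psrc p = cov out x0 (a i) /\ plength p = (b i - a i)%N.
  move=> ir -> pE; have [ka ab] := kE i ir; rewrite /plength pE size_map size_iota ka vE; last lia.
  by split=> //; rewrite -/(b i); lia.
have eP y z : (y <= z)%N -> (e y <= z)%N <-> exists i w,
    [/\ (0 < i <= r)%N, (y <= a i + w * N)%N & (b i + w * N <= z)%N].
  move=> yz; have H := (path_ideal_ker pi_adm src_out out_src _).1 TI
    (cpath src_out (cov out x0 y) (z - y)).
  rewrite psrc_cpath plength_cpath in H.
  have -> : (e y <= z)%N = (plen pi_adm src_out (cov out x0 y) <= z - y)%N.
    by rewrite /e /cov_end; lia.
  split=> [/H[q [i ir [sq pq]] [o [qo le]]]|[i [w [ir yw wz]]]].
    have [sq' lq] := lenE q i ir sq pq; have [ka ab] := kE i ir.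
    (* The copy of relation [i] found inside the path starts at [y + o], congruent to [a i] modulo
       [N]. As [a i < N], the quotient is the number of full turns. *)
    exists i, ((y + o) %/ N)%N; split=> //.
      move: qo; rewrite sq' psrc_cpath -covD => /(iter_eq_mod succ_trans).
      rewrite modn_small; last lia.
      by have := divn_eq (y + o) N; lia.
    move: qo; rewrite sq' psrc_cpath -covD => /(iter_eq_mod succ_trans).
    rewrite modn_small; last lia.
    by have := divn_eq (y + o) N; move: le; rewrite plength_cpath lq; lia.
  apply/H; have [ka ab] := kE i ir.
  exists (cpath src_out (cov out x0 (a i)) (b i - a i)); first by rewrite -inE; apply: len.
  exists (a i + w * N - y)%N; rewrite !psrc_cpath !plength_cpath -covD subnKC //; split; last lia.
  by apply/(iter_eq_mod succ_trans); rewrite addnC modnMDl.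
have em : forall i, (e i <= e i.+1)%N by apply: cov_end_mono.
have eg : forall i, (i < e i)%N by move=> i; apply/ltnW/cov_end_gt.
have eN : forall i, e (i + N)%N = (e i + N)%N by move=> i; apply: cov_endN.
have a1 : a 1%N = 0%N by rewrite /a k1.
have ab i : (0 < i <= r)%N -> (a i + 2 <= b i <= N)%N by case/kE.
have a_incr i : (0 < i < r)%N -> (a i < a i.+1)%N.
  move=> ir; have := kodd i ir; rewrite (_ : 2 * i + 1 = 2 * i.+1 - 1)%N; last lia.
  by have [-> _] := kE i ltac:(lia); have [-> _] := kE i.+1 ltac:(lia).
have b_incr i : (0 < i < r)%N -> (b i < b i.+1)%N.
  by move=> ir; have := keven i ir; rewrite (_ : 2 * i + 2 = 2 * i.+1)%N; last lia.
have ab_over i : (0 < i < r)%N -> (a i.+1 < b i)%N.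
  move=> ir; have := kover i ir; rewrite (_ : 2 * i + 1 = 2 * i.+1 - 1)%N; last lia.
  by have [-> _] := kE i.+1 ltac:(lia).
have ba_apart i : (0 < i)%N -> (i.+2 <= r)%N -> (b i <= a i.+2)%N.
  move=> i0 ir; have := kapart i i0 ltac:(lia).
  rewrite (_ : 2 * i + 3 = 2 * i.+2 - 1)%N; last lia.
  by have [-> _] := kE i.+2 ltac:(lia).
split.
  exact: (chain_cut em eg eN r0 ab a1 a_incr b_incr eP).
have [lt1 lt2] := chain_syz_strict em eg eN r0 ab a1 a_incr b_incr ab_over ba_apart eP.
rewrite -(prednK r0) => /(pdim_simple_cov pi_surj pi_adm src_out out_src).
by rewrite prednK // -/e; lia.
Qed.

End ChainConverse.

Theorem theorem3p3 (K : closedFieldType) (Q : quiver) (A : falgType K)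
    (pi : {lrmorphism path_algebra K Q -> A}) (n r : nat)
    (pi_surj : surjective pi)
    (pi_adm : admissible (ker pi))
    (A_connected : connected_algebra A)
    (A_nakayama : nakayama A)
    (Q_cyclic : cyclic_quiver Q)
    (A_qh : quasi_hereditary A)
    (A_n : num_simples_is A n)
    (A_r : lambda1_is A r) :
  global_dim_is A (r + 1) <-> relations_form_chain n r (ker pi).
Proof.
have [out [src_out out_src trans]] :=
  oriented_cycle pi_surj pi_adm A_connected A_nakayama Q_cyclic.
have succ_trans : forall x y, exists i, iter i (succ_of out) x = y by [].
have jumpsN x0 : jumps (cov_end pi_adm src_out x0) #|vert Q| = r.
  exact: (lambda1_jumps pi_surj pi_adm src_out out_src succ_trans x0 A_r).
have r_gt0 : (0 < r)%N.
  have [x0 _] := card_gt0P (vert_gt0 Q); exact: (jumps_gt0 succ_trans (jumpsN x0)).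
rewrite (num_simples_card pi_surj pi_adm src_out out_src A_n); split.
  have [x0 cut] := cut_base pi_surj pi_adm src_out out_src succ_trans A_qh.
  move/(global_dim_is_jumps pi_surj out_src succ_trans cut (jumpsN x0)).
  exact (chain_of_long_syzygy out_src succ_trans cut (jumpsN x0)).
move/(long_syzygy_of_chain pi_surj pi_adm src_out out_src succ_trans r_gt0).
case=> x0 [cut npd].
apply/(global_dim_is_jumps pi_surj out_src succ_trans cut (jumpsN x0)).
by exists 0%N => //; apply: vert_gt0.
Qed.
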